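(* Let $p>0$ and let $u:\mathbb{R}^4\to\mathbb{R}$ be a solution to $\Delta^2 u=(1-|x|^p)e^{4u}$ in $\mathbb{R}^4$ such that $(1-|y|^p)e^{4u}\in L^1(\mathbb{R}^4)$, and set $\Lambda:=\int_{\mathbb{R}^4}(1-|x|^p)e^{4u}\,dx$. Define $$v(x):=\frac{1}{8\pi^2}\int_{\mathbb{R}^4}\log\left(\frac{|y|}{|x-y|}\right)(1-|y|^p)e^{4u(y)}\,dy.$$ Then there exists a polynomial $P$ of degree at most $2$ which is bounded from above on $\mathbb{R}^4$ such that $u=v+P$. Moreover, $$u(x)=-\frac{\Lambda}{8\pi^2}\log|x|+P(x)+o(\log|x|),\quad\text{as } |x|\to\infty.$$ *)

(* Defs.v *)
From HB Require Import structures.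
From mathcomp Require Import all_boot all_order all_algebra.
From mathcomp Require Import all_classical all_reals all_analysis.
Set Implicit Arguments. Unset Strict Implicit. Unset Printing Implicit Defensive.
Import Order.TTheory GRing.Theory Num.Theory.
Import numFieldNormedType.Exports.
Local Open Scope classical_set_scope.
Local Open Scope ring_scope.

Section R4.
Variable R : realType.

Notation R4 := 'rV[R]_4.

Definition e4 (i : 'I_4) : R4 := delta_mx 0 i.

(* Euclidean norm |x| (the library norm on 'rV is the sup norm) *)
Definition enorm (x : R4) : R := Num.sqrt (\sum_(i < 4) x 0 i ^+ 2).

Definition partial (i : 'I_4) (f : R4 -> R) : R4 -> R :=
  fun x => 'D_(e4 i) f x.

Fixpoint Ck (k : nat) (f : R4 -> R) : Prop :=
  match k with
  | 0 => continuous f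
  | k'.+1 => continuous f /\
      (forall (i : 'I_4) (x : R4), derivable f x (e4 i)) /\
      (forall i : 'I_4, Ck k' (partial i f))
  end.

Definition laplacian (f : R4 -> R) : R4 -> R :=
  fun x => \sum_(i < 4) partial i (partial i f) x.

Definition bilaplacian (f : R4 -> R) : R4 -> R := laplacian (laplacian f).

(* Lebesgue measure on R^4, realised as the product measure on
   (R * R) * (R * R), transported to 'rV_4 through the coordinates below. *)
Definition leb4 := ((@lebesgue_measure R \x @lebesgue_measure R) \x
                    (@lebesgue_measure R \x @lebesgue_measure R))%E.

Definition of_coords (z : (R * R) * (R * R)) : R4 :=
  \row_(i < 4) match nat_of_ord i with
               | 0 => z.1.1 | 1 => z.1.2 | 2 => z.2.1 | _ => z.2.2 end.

Definition integrable4 (f : R4 -> R) : Prop :=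
  leb4.-integrable setT (fun z => (f (of_coords z))%:E).

Definition integral4 (f : R4 -> R) : R :=
  fine (\int[leb4]_z (f (of_coords z))%:E)%E.

Definition poly_deg_le2 (P : R4 -> R) : Prop :=
  exists (c : R) (b : 'I_4 -> R) (a : 'I_4 -> 'I_4 -> R),
    forall x : R4,
      P x = c + \sum_(i < 4) b i * x 0 i
              + \sum_(i < 4) \sum_(j < 4) a i j * x 0 i * x 0 j.

End R4.

(* Main.v *)
(* Put f = Delta^2 u.  Applying Green's formula to the truncated
   powers max(t - |x - y|^2, 0)^j and integrating in t yields the representation
     int Th_t(|x - y|^2) f(y) dy = A_t(u)(x) + 16 pi^2 u(x),
   where Th_t(s) behaves like -ln(s/t) near 0 and vanishes for s >= t, and A_t(u)(x)
   integrates u against a C^2 kernel supported in |x - y|^2 <= t; the constant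
   16 pi^2 comes from testing against Gaussians.  The representation at x = 0 together with
   the integrability of e^{4u} gives int_{|y|^2 <= t} |u| = O(t^3).  Hence in
   A_t(u)(x) - A_t(u)(0) the second order Taylor polynomial of the kernel in x
   dominates as t -> oo, while by the representation this difference tends to
   16 pi^2 (v(x) - u(x) + u(0)): so P = u - v is a pointwise limit of polynomials
   of degree 2.
   Averaging u <= e^{4u} over a unit box at x on which P >= P(x) - C gives
   P(x) = O(1 + ln(3 + |x|)), and a polynomial of degree 2 with such an upper bound
   is bounded above.  Since f <= 0 outside the unit ball, v = O(ln|x|) from above, so f
   grows at most polynomially; the asymptotics of v then follow by
   dominated convergence off the ball |x - y| < |x|^-N, whose contribution is
   negligible. *)
Require Import Defs.
From HB Require Import structures.
From mathcomp Require Import all_boot all_order all_algebra.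
From mathcomp Require Import all_classical all_reals all_analysis.
From mathcomp Require Import measurable_realfun gauss_integral ring lra zify.

Set Implicit Arguments.
Unset Strict Implicit.
Unset Printing Implicit Defensive.

Import Order.TTheory GRing.Theory Num.Theory.
Import numFieldNormedType.Exports.
Local Open Scope classical_set_scope.
Local Open Scope ring_scope.

(** The exponent 6 of the truncated power and the factor t^-7 in front of it are tied together. Two
    Laplacians followed by one integration in t lower the exponents to 3 and 4, so the second
    derivatives of the kernel of [A] are Lipschitz and its Taylor remainder in x is cubic; starting
    from exponent 5 would leave a truncated square, with a quadratic remainder only. The factor t^-7
    makes the t-integral of t^-7 max(t - s, 0)^6 a logarithm, and it also turns the result of the
    two Green formulas into an exact t-derivative. The order O(t^3) for the integral of |u| over
    |y|^2 <= t is that of a quadratic function, so it cannot be improved; against it the remainder,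
    of size |x|^3 t^(-7/2), leaves an error O(t^(-1/2)). The difficulty in that bound is the
    negative part of u: e^{4u} controls the positive part alone, and the representation at the
    single point 0 must supply a lower bound on averages of u. *)

(* The sigma-finite instance that the library declares on product measures is
   shadowed by the one for subprobabilities, hence this copy. *)
Definition sprod d1 d2 (T1 : measurableType d1) (T2 : measurableType d2)
    (R : realType) (m1 : {sigma_finite_measure set T1 -> \bar R})
    (m2 : {sigma_finite_measure set T2 -> \bar R}) : set (T1 * T2) -> \bar R :=
  (m1 \x m2)%E.

(** * Products of sigma-finite measures *)

Section sprod.
Context d1 d2 (T1 : measurableType d1) (T2 : measurableType d2) (R : realType).
Variable m1 : {sigma_finite_measure set T1 -> \bar R}.
Variable m2 : {sigma_finite_measure set T2 -> \bar R}.

HB.instance Definition _ := Measure.copy (sprod m1 m2) (m1 \x m2)%E.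

Lemma sprod_sigma_finite : sigma_finite setT (sprod m1 m2).
Proof.
have /sigma_finiteP[F [TF ndF Foo]] := sigma_finiteT m1.
have /sigma_finiteP[G [TG ndG Goo]] := sigma_finiteT m2.
exists (fun n => F n `*` G n).
  rewrite -setXTT TF TG predeqE => -[x y]; split.
    move=> [/= [n _ Fnx] [k _ Gky]]; exists (maxn n k) => //; split.
    - by move: x Fnx; exact/subsetPset/ndF/leq_maxl.
    - by move: y Gky; exact/subsetPset/ndG/leq_maxr.
  by move=> [n _ []/= ? ?]; split; exists n.
move=> k; have [? ?] := Foo k; have [? ?] := Goo k.
split; first exact: measurableX.
by rewrite /sprod product_measure1E// lte_mul_pinfty// ge0_fin_numE.
Qed.

HB.instance Definition _ := Measure_isSigmaFinite.Build _ _ _ (sprod m1 m2)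
  sprod_sigma_finite.

End sprod.

(** * Lebesgue integration on R^4 in coordinates *)

Section integral4.
Variable R : realType.
Notation R4 := 'rV[R]_4.
Notation mT := (measurableTypeR R).
Notation lb := (@lebesgue_measure R).

Definition lb2 : {sigma_finite_measure set (mT * mT)%type -> \bar R} :=
  sprod lb lb.
Definition lb4 : {sigma_finite_measure set ((mT * mT) * (mT * mT))%type -> \bar R} :=
  sprod lb2 lb2.

Definition meas4 (g : R4 -> R) :=
  measurable_fun setT (fun z : (mT * mT) * (mT * mT) => g (of_coords z)).

Lemma measurable_coord (i : 'I_4) :
  measurable_fun setT (fun z : (mT * mT) * (mT * mT) => (of_coords z : R4) 0 i).
Proof.
under eq_fun do rewrite mxE.
case: i => [[|[|[|[|//]]]]] /= _.
- exact: (measurableT_comp measurable_fst measurable_fst).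
- exact: (measurableT_comp measurable_snd measurable_fst).
- exact: (measurableT_comp measurable_fst measurable_snd).
- exact: (measurableT_comp measurable_snd measurable_snd).
Qed.

(** Measurability refers to the product sigma-algebra of the coordinates, openness to the topology
    of row vectors. They meet because an open set is the countable union of the cubes with rational
    centre and radius 1/(n+1) that it contains. *)
Lemma continuous_meas4 (g : R4 -> R) : continuous g -> meas4 g.
Proof.
move=> cg; apply: (measurability _ (RGenOpens.measurableE R)).
move=> _ [_ [a [b ->]] <-]; rewrite setTI.
set O := g @^-1` `]a, b[%classic.
have oO : open O by move/continuousP: cg; apply; exact: interval_open.
pose Bq (k : ({ffun 'I_4 -> rat} * nat)%type) : set R4 :=
  [set y | forall i, `|y 0 i - ratr (k.1 i)| < k.2.+1%:R^-1].
have mBq k : measurable [set z : (mT * mT) * (mT * mT) | Bq k (of_coords z)].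
  have -> : [set z : (mT * mT) * (mT * mT) | Bq k (of_coords z)] =
      \bigcap_(i in [set: 'I_4])
      ((fun z : (mT * mT) * (mT * mT) => (of_coords z : R4) 0 i) @^-1`
       ball (ratr (k.1 i) : R) k.2.+1%:R^-1).
    apply/seteqP; split=> [z Bz i _|z Bz i].
      by rewrite -ball_normE /= distrC; exact: Bz.
    by have := Bz i I; rewrite -ball_normE /= distrC.
  apply: fin_bigcap_measurable => [|i _]; first exact: finite_finset.
  rewrite -[X in measurable X]setTI.
  by apply: measurable_coord => //; rewrite ball_itv; exact: measurable_itv.
have -> : (fun z : (mT * mT) * (mT * mT) => g (of_coords z)) @^-1` `]a, b[ =
   \bigcup_k (if `[< Bq k `<=` O >] then
       [set z : (mT * mT) * (mT * mT) | Bq k (of_coords z)] else set0).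
  apply/seteqP; split=> [z Oz|z [k _]]; last first.
    by case: asboolP => // sub; exact: sub.
  have /nbhs_ballP[e /= e0 xe] : nbhs (of_coords z : R4) O by exact: open_nbhs_nbhs.
  have [n ne] : exists n : nat, n.+1%:R^-1 < e / 2.
    have e20 : 0 < e / 2 by rewrite divr_gt0.
    have [n _ nP] := near_infty_natSinv_lt (PosNum e20).
    by exists n; apply: (nP n) => /=.
  have hq i : exists q : rat, `|(of_coords z : R4) 0 i - ratr q| < n.+1%:R^-1.
    have [q] := @rat_in_itvoo R ((of_coords z : R4) 0 i - n.+1%:R^-1)
      ((of_coords z : R4) 0 i + n.+1%:R^-1) ltac:(by rewrite ltrBlDr -addrA ltrDl addr_gt0).
    rewrite in_itv /= => /andP[q1 q2]; exists q.
    by rewrite distrC ltr_distl q1 q2.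
  have /choice[q qP] := hq.
  exists ([ffun i => q i], n) => //.
  have Bz : Bq ([ffun i => q i], n) (of_coords z) by move=> i /=; rewrite ffunE.
  case: asboolP => // -[]; move=> y By; apply: xe; split => // j i.
  rewrite (ord1 j) -ball_normE /=.
  have := By i; have := Bz i; rewrite /= ffunE => h1 h2.
  rewrite (le_lt_trans (ler_distD (ratr (q i)) _ _))//.
  by rewrite (splitr e) ltrD// ?(lt_trans _ ne)// distrC.
apply: countable_bigcupT_measurable => [|k]; first exact: countableP.
by case: ifP.
Qed.


Lemma integrable4_meas (f : R4 -> R) : integrable4 f -> meas4 f.
Proof. by move=> /integrableP[/measurable_EFinP]. Qed.

Lemma le_integrable4 (f g : R4 -> R) : meas4 f -> integrable4 g ->
  (forall y, `|f y| <= g y) -> integrable4 f.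
Proof.
move=> mf ig fg.
apply: (le_integrable (mu := lb4) measurableT _ _ ig).
  exact/measurable_EFinP.
by move=> z _; rewrite /= lee_fin (le_trans (fg _))// ler_norm.
Qed.

Lemma integrable4D (f g : R4 -> R) : integrable4 f -> integrable4 g ->
  integrable4 (fun y => f y + g y).
Proof. by move=> h1 h2; exact: (integrableD (mu := lb4) measurableT h1 h2). Qed.

Lemma integrable4B (f g : R4 -> R) : integrable4 f -> integrable4 g ->
  integrable4 (fun y => f y - g y).
Proof. by move=> h1 h2; exact: (integrableB (mu := lb4) measurableT h1 h2). Qed.

Lemma integrable4Z (k : R) (f : R4 -> R) : integrable4 f ->
  integrable4 (fun y => k * f y).
Proof. by move=> h1; exact: (integrableZl (mu := lb4) measurableT k h1). Qed.

Lemma integrable4_norm (f : R4 -> R) : integrable4 f ->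
  integrable4 (fun y => `|f y|).
Proof. by move=> h1; exact: (integrable_norm (mu := lb4) h1). Qed.

Lemma integrable4_eq (f g : R4 -> R) : (forall y, f y = g y) -> integrable4 f ->
  integrable4 g.
Proof. by move=> /funext ->. Qed.

Lemma integral4D (f g : R4 -> R) : integrable4 f -> integrable4 g ->
  integral4 (fun y => f y + g y) = integral4 f + integral4 g.
Proof. by move=> h1 h2; exact: (RintegralD (mu := lb4) measurableT h1 h2). Qed.

Lemma integral4B (f g : R4 -> R) : integrable4 f -> integrable4 g ->
  integral4 (fun y => f y - g y) = integral4 f - integral4 g.
Proof. by move=> h1 h2; exact: (RintegralB (mu := lb4) measurableT h1 h2). Qed.

Lemma integral4Z (k : R) (f : R4 -> R) : integrable4 f ->
  integral4 (fun y => k * f y) = k * integral4 f.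
Proof. by move=> h1; exact: (RintegralZl (mu := lb4) _ measurableT h1). Qed.

Lemma le_integral4 (f g : R4 -> R) : integrable4 f -> integrable4 g ->
  (forall y, f y <= g y) -> integral4 f <= integral4 g.
Proof.
by move=> h1 h2 fg; apply: (le_Rintegral (mu := lb4) measurableT h1 h2).
Qed.

Lemma le_normr_integral4 (f : R4 -> R) : integrable4 f ->
  `|integral4 f| <= integral4 (fun y => `|f y|).
Proof. by move=> h1; exact: (le_normr_Rintegral (mu := lb4) measurableT h1). Qed.

Lemma integral4_ge0 (f : R4 -> R) : (forall y, 0 <= f y) -> 0 <= integral4 f.
Proof. by move=> f0; apply: (Rintegral_ge0 lb4) => z _. Qed.

Lemma eq_integral4 (f g : R4 -> R) : (forall y, f y = g y) ->
  integral4 f = integral4 g.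
Proof. by move=> /funext ->. Qed.

Lemma integrable4_0 : integrable4 (fun _ : R4 => 0 : R).
Proof. exact: (integrable0 lb4 setT). Qed.

Lemma integrable4_sum (h : 'I_4 -> R4 -> R) :
  (forall i, integrable4 (h i)) -> integrable4 (fun y => \sum_(i < 4) h i y).
Proof.
move=> ih; apply: (@integrable4_eq (fun y => h 0 y + (h 1 y + (h (inord 2) y + h (inord 3) y)))).
  move=> y; rewrite !big_ord_recl big_ord0 addr0; congr (h _ y + (h _ y + (h _ y + h _ y))); by apply/val_inj; rewrite /= ?inordK.
by do 3 apply: integrable4D => //.
Qed.

Lemma integral4_sum (h : 'I_4 -> R4 -> R) :
  (forall i, integrable4 (h i)) ->
  integral4 (fun y => \sum_(i < 4) h i y) = \sum_(i < 4) integral4 (h i).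
Proof.
move=> ih; under eq_integral4 => y do rewrite !big_ord_recl big_ord0 addr0.
by rewrite !integral4D// ?(big_ord_recl, big_ord0, addr0)//; do ? apply: integrable4D.
Qed.

Lemma integral_prodM d1 d2 (T1 : measurableType d1) (T2 : measurableType d2)
    (m1 : {sigma_finite_measure set T1 -> \bar R})
    (m2 : {sigma_finite_measure set T2 -> \bar R}) (f : T1 -> R) (g : T2 -> R) :
  measurable_fun setT f -> measurable_fun setT g ->
  (forall x, 0 <= f x) -> (forall x, 0 <= g x) ->
  (\int[sprod m1 m2]_z (f z.1 * g z.2)%:E =
   \int[m1]_x (f x)%:E * \int[m2]_y (g y)%:E)%E.
Proof.
move=> mf mg f0 g0; rewrite /sprod fubini_tonelli1//=; last 2 first.
- apply/measurable_EFinP; apply: measurable_funM.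
    exact: (measurableT_comp mf measurable_fst).
  exact: (measurableT_comp mg measurable_snd).
- by move=> z; rewrite lee_fin mulr_ge0.
rewrite /fubini_F /=.
have inner x : (\int[m2]_y (f x * g y)%:E = (f x)%:E * \int[m2]_y (g y)%:E)%E.
  under eq_integral do rewrite EFinM.
  rewrite ge0_integralZl//; first exact/measurable_EFinP.
    by move=> y _; rewrite lee_fin.
  by rewrite lee_fin.
under eq_integral do rewrite inner.
rewrite ge0_integralZr//.
- exact/measurable_EFinP.
- by move=> x _; rewrite lee_fin.
- by apply: integral_ge0 => y _; rewrite lee_fin.
Qed.

Lemma integral4_prod (h : 'I_4 -> mT -> R) :
  (forall i, measurable_fun setT (h i)) -> (forall i x, 0 <= h i x) ->
  (\int[lb4]_z (\prod_(i < 4) h i ((of_coords z : R4) 0 i))%:E =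
   \prod_(i < 4) \int[lb]_x (h i x)%:E)%E.
Proof.
move=> mh h0; rewrite !big_ord_recl big_ord0 mule1.
under eq_integral => z _.
  rewrite !big_ord_recl big_ord0 mulr1 !mxE /= mulrA.
  over.
rewrite (@integral_prodM _ _ _ _ lb2 lb2
  (fun p => h ord0 p.1 * h (lift ord0 ord0) p.2)
  (fun p => h (lift ord0 (lift ord0 ord0)) p.1 *
            h (lift ord0 (lift ord0 (lift ord0 ord0))) p.2)).
- have I2 i j : (\int[lb2]_z (h i z.1 * h j z.2)%:E =
      \int[lb]_x (h i x)%:E * \int[lb]_x (h j x)%:E)%E.
    exact: (@integral_prodM _ _ _ _ lb lb).
  by rewrite !I2 !muleA.
- apply: measurable_funM; first exact: (measurableT_comp (mh _) measurable_fst).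
  exact: (measurableT_comp (mh _) measurable_snd).
- apply: measurable_funM; first exact: (measurableT_comp (mh _) measurable_fst).
  exact: (measurableT_comp (mh _) measurable_snd).
- by move=> x; rewrite mulr_ge0.
- by move=> x; rewrite mulr_ge0.
Qed.


(** Indicator of a closed cube, written as a product over the coordinates so that its integral
    splits into one-dimensional ones. *)
Definition box (a : R4) (r : R) (y : R4) : R :=
  \prod_(i < 4) \1_(`[a 0 i - r, a 0 i + r]) (y 0 i).

Lemma box_ge0 (a : R4) (r : R) (y : R4) : 0 <= box a r y.
Proof. by apply: prodr_ge0 => i _; rewrite indicE. Qed.

Lemma box_in (a : R4) (r : R) (y : R4) : (forall i, `|y 0 i - a 0 i| <= r) -> box a r y = 1.
Proof.
move=> h; rewrite /box big1// => i _; rewrite indicE mem_set//=.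
by rewrite in_itv /= -ler_distl.
Qed.

Lemma box_out (a : R4) (r : R) (y : R4) : ~ (forall i, `|y 0 i - a 0 i| <= r) -> box a r y = 0.
Proof.
move/existsNP => [i /negP hi]; rewrite /box (bigD1 i)//= indicE memNset ?mul0r//=.
by rewrite in_itv /= -ler_distl; exact/negP.
Qed.

Lemma integral_box (a : R4) (r : R) : 0 < r ->
  (\int[lb4]_z (box a r (of_coords z))%:E = ((2 * r) ^+ 4)%:E)%E.
Proof.
move=> r0; rewrite /box.
rewrite (@integral4_prod (fun i x => \1_(`[a 0 i - r, a 0 i + r]) x))//; last first.
  by move=> i; apply: measurable_indic; exact: measurable_itv.
have E i : (\int[lb]_x (\1_(`[a 0 i - r, a 0 i + r]) x)%:E = (2 * r)%:E)%E.
  rewrite integral_indic// setIT.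
  apply: (etrans (lebesgue_measure_itv _)); rewrite /= lte_fin.
  rewrite ltrD2l gtrN//=  -EFinB opprD opprK addrACA subrr add0r.
  by rewrite mulrDl mul1r.
under eq_bigr do rewrite E.
by rewrite prodEFin prodr_const card_ord.
Qed.

Lemma integrable4_ge0 (f : R4 -> R) : meas4 f -> (forall y, 0 <= f y) ->
  (\int[lb4]_z (f (of_coords z))%:E < +oo)%E -> integrable4 f.
Proof.
move=> mf f0 h; apply/integrableP; split; first exact/measurable_EFinP.
apply: le_lt_trans h; rewrite le_eqVlt; apply/orP; left; apply/eqP.
by apply: (@eq_integral _ _ _ lb4) => z _ /=; rewrite ger0_norm.
Qed.

Lemma measurable_box (a : R4) (r : R) : meas4 (box a r).
Proof.
apply: measurable_prod => i _.
apply: (measurableT_comp _ (measurable_coord i)).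
by apply: measurable_indic; exact: measurable_itv.
Qed.

Lemma integrable4_box (a : R4) (r : R) : 0 < r -> integrable4 (box a r).
Proof.
move=> r0; apply: integrable4_ge0; [exact: measurable_box|exact: box_ge0|].
by rewrite integral_box// ltry.
Qed.

Lemma integral4_box (a : R4) (r : R) : 0 < r -> integral4 (box a r) = (2 * r) ^+ 4.
Proof. by move=> r0; rewrite /integral4 integral_box. Qed.

Lemma le_box (f : R4 -> R) (a : R4) (r C : R) :
  (forall y : R4, (forall i, `|y 0 i - a 0 i| <= r) -> `|f y| <= C) ->
  (forall y : R4, ~ (forall i, `|y 0 i - a 0 i| <= r) -> f y = 0) ->
  forall y, `|f y| <= C * box a r y.
Proof.
move=> h1 h2 y; have [h|h] := pselect (forall i, `|y 0 i - a 0 i| <= r).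
  by rewrite box_in// mulr1; exact: h1.
by rewrite box_out// h2// mulr0 normr0.
Qed.

Lemma integrable4_bnd (f : R4 -> R) (a : R4) (r C : R) : 0 < r -> meas4 f ->
  (forall y : R4, (forall i, `|y 0 i - a 0 i| <= r) -> `|f y| <= C) ->
  (forall y : R4, ~ (forall i, `|y 0 i - a 0 i| <= r) -> f y = 0) -> integrable4 f.
Proof.
move=> r0 mf h1 h2; apply: (le_integrable4 mf _ (le_box h1 h2)).
exact/integrable4Z/integrable4_box.
Qed.

Lemma integral4_bnd (f : R4 -> R) (a : R4) (r C : R) : 0 < r -> meas4 f ->
  (forall y : R4, (forall i, `|y 0 i - a 0 i| <= r) -> `|f y| <= C) ->
  (forall y : R4, ~ (forall i, `|y 0 i - a 0 i| <= r) -> f y = 0) ->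
  `|integral4 f| <= C * (2 * r) ^+ 4.
Proof.
move=> r0 mf h1 h2; have fi := integrable4_bnd r0 mf h1 h2.
rewrite (le_trans (le_normr_integral4 fi))//.
rewrite -(integral4_box a r0) -integral4Z; last exact: integrable4_box.
apply: le_integral4; [exact: integrable4_norm| |exact: le_box].
exact/integrable4Z/integrable4_box.
Qed.

Lemma ae4S (P Q : (mT * mT) * (mT * mT) -> Prop) : (forall z, P z -> Q z) ->
  {ae lb4, forall z, P z} -> {ae lb4, forall z, Q z}.
Proof.
move=> PQ [N [mN N0 sub]]; exists N; split => // z /= nQ.
by apply: sub => /= Pz; exact/nQ/PQ.
Qed.

Lemma ae4I (P Q : (mT * mT) * (mT * mT) -> Prop) :
  {ae lb4, forall z, P z} -> {ae lb4, forall z, Q z} ->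
  {ae lb4, forall z, P z /\ Q z}.
Proof.
move=> [M [mM M0 subM]] [N [mN N0 subN]]; exists (M `|` N); split.
- exact: measurableU.
- by have := @null_set_setU _ _ _ lb4 M N mM mN M0 N0; apply.
- move=> z /= /not_andP[nP|nQ]; [left; exact: subM|right; exact: subN].
Qed.

(** The point lies in the hyperplane fixed by its first coordinate, a product set with a null
    factor. *)
Lemma ae_neq (a : R4) : {ae lb4, forall z, (of_coords z : R4) != a}.
Proof.
exists (([set a ord0 ord0] `*` setT) `*` setT); split.
- by apply: measurableX => //; apply: measurableX => //; exact: measurable_set1.
- rewrite /= /sprod product_measure1E//; last first.
    by apply: measurableX => //; exact: measurable_set1.
  rewrite [X in (X * _)%E]product_measure1E//.
  have h0 : (lb [set a ord0 ord0] = 0)%E by exact: lebesgue_measure_set1.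
  rewrite -[RHS](mul0e (lb2 setT)); congr (_ * _)%E.
  rewrite -[RHS](mul0e (lb setT)); congr (_ * _)%E; exact: h0.
- move=> z /= /negP; rewrite negbK => /eqP <-; split => //=.
  by split => //=; rewrite mxE.
Qed.

Lemma ae_integral4 (f g : R4 -> R) (a : R4) : meas4 f -> meas4 g ->
  (forall y, y != a -> f y = g y) -> integral4 f = integral4 g.
Proof.
move=> mf mg fg; rewrite /integral4; congr fine.
apply: (ae_eq_integral (mu := lb4)) => //.
- exact/measurable_EFinP.
- exact/measurable_EFinP.
- by have := ae_neq a; apply: ae4S => z /fg /= ->.
Qed.

Lemma dominated_cvg4 (g_ : nat -> R4 -> R) (g G : R4 -> R) :
  (forall n, meas4 (g_ n)) -> meas4 g ->
  {ae lb4, forall z, g_ n (of_coords z) @[n --> \oo] --> g (of_coords z)} ->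
  integrable4 G ->
  {ae lb4, forall z, forall n, `|g_ n (of_coords z)| <= G (of_coords z)} ->
  integrable4 g /\ integral4 (g_ n) @[n --> \oo] --> integral4 g.
Proof.
move=> mg_ mg gg iG gG.
have [] := @dominated_convergence _ _ _ lb4 setT measurableT
  (fun n z => (g_ n (of_coords z))%:E) (fun z => (g (of_coords z))%:E)
  (fun z => (G (of_coords z))%:E).
- by move=> n; have := mg_ n; rewrite /meas4 => h; apply/measurable_EFinP.
- by apply/measurable_EFinP; exact: mg.
- by move: gg; apply: ae4S => z gz _; apply: cvg_EFin => //; exact: nearW.
- exact: iG.
- by move: gG; apply: ae4S => z h n _; rewrite lee_fin.
move=> ig _ cg; split => //.
apply: fine_cvg; rewrite /integral4 fineK//.
by apply: (integrable_fin_num (mu := lb4)).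
Qed.

Lemma is_derive_integral4 (f df : R -> R4 -> R) (G : R4 -> R) (a u v : R) :
  a \in `]u, v[ ->
  (forall t, t \in `]u, v[ -> integrable4 (f t)) ->
  (forall t y, t \in `]u, v[ -> is_derive t 1 (f^~ y) (df t y)) ->
  integrable4 G -> (forall t y, t \in `]u, v[ -> `|df t y| <= G y) ->
  is_derive a 1 (fun t => integral4 (f t)) (integral4 (df a)).
Proof.
move=> auv intf derf iG dfG.
pose F t (z : (mT * mT) * (mT * mT)) := f t (of_coords z).
have p1 t z : t \in `]u, v[ -> partial1of2 F t z = df t (of_coords z).
  by move=> tuv; rewrite partial1of2E; apply: (@derive_val _ _ _ _ _ _ _ (derf t (of_coords z) tuv)).
have G0 y : 0 <= G y by exact: le_trans (dfG a y auv).
have h1 t : `]u, v[%classic t -> lb4.-integrable setT (EFin \o F t).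
  by move=> tuv; exact: intf.
have h2 t z : `]u, v[%classic t -> setT z -> derivable (F ^~ z) t 1.
  by move=> tuv _; apply: ex_derive; exact: derf.
have h3 t z : `]u, v[%classic t -> setT z -> `|partial1of2 F t z| <= G (of_coords z).
  by move=> tuv _; rewrite p1//; exact: dfG.
have D := @derivable_under_integral _ _ _ lb4 F setT measurableT a u v auv
  h1 h2 (fun z => G (of_coords z)) (fun z => G0 _) iG h3.
have E := @differentiation_under_integral _ _ _ lb4 F setT measurableT a u v auv
  h1 h2 (fun z => G (of_coords z)) (fun z => G0 _) iG h3.
apply: DeriveDef; first exact: D.
rewrite -derive1E; apply: (etrans E); apply: eq_Rintegral => z _.
exact: p1.
Qed.

End integral4.

(** * Directional derivatives and truncated powers *)

Section calculus.
Variable R : realType.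
Notation R4 := 'rV[R]_4.

Lemma cvg_is_derive (V : normedModType R) (f : V -> R) (x v : V) (df : R) :
  (h^-1 * (f (h *: v + x) - f x)) @[h --> 0^'] --> df -> is_derive x v f df.
Proof.
move=> h; apply: DeriveDef; first by apply/cvg_ex; exists df; exact: h.
by apply: cvg_lim => //; exact: h.
Qed.

Lemma is_derive_cvg (V : normedModType R) (f : V -> R) (x v : V) (df : R) :
  is_derive x v f df -> (h^-1 * (f (h *: v + x) - f x)) @[h --> 0^'] --> df.
Proof. by case=> [d <-]; exact: d. Qed.

(** Restriction to a line carries one-variable rules, notably the chain rule, over to directional
    derivatives. *)
Lemma is_derive1P (V : normedModType R) (f : V -> R) (x v : V) (df : R) :
  is_derive x v f df <-> is_derive (0 : R) 1 (fun h => f (h *: v + x)) df.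
Proof.
have E : (fun h : R => h^-1 * (f (h *: v + x) - f x)) =
    (fun h : R => h^-1 * (f ((h *: (1 : R) + 0) *: v + x) - f (0 *: v + x))).
  by apply/funext => h; rewrite scale0r add0r addr0 [_ *: (1 : R)]mulr1.
split=> [/is_derive_cvg|/is_derive_cvg] h; apply: cvg_is_derive.
  by rewrite -E.
by rewrite E.
Qed.

Lemma is_derive_dircomp (V : normedModType R) (f : V -> R) (g : R -> R)
    (x v : V) (df dg : R) :
  is_derive x v f df -> is_derive (f x) 1 g dg ->
  is_derive x v (fun y => g (f y)) (dg * df).
Proof.
move=> /is_derive1P hf hg; apply/is_derive1P.
apply: (@is_derive1_comp _ g (fun h : R => f (h *: v + x))) => //.
by rewrite scale0r add0r.
Qed.

(** Settles the derivative at a point where a piecewise formula changes, by comparison with the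
    expression valid on one side. *)
Lemma is_derive_squeeze0 (f g : R -> R) (x : R) : f x = 0 -> g x = 0 ->
  (\forall y \near x, `|f y| <= `|g y|) -> is_derive x 1 g 0 -> is_derive x 1 f 0.
Proof.
move=> fx gx fg /is_derive_cvg dg; apply: cvg_is_derive.
have {}fg : \forall h \near (0 : R), `|f (h *: (1 : R) + x)| <= `|g (h *: (1 : R) + x)|.
  have : (fun h : R => h *: (1 : R) + x) h @[h --> (0 : R)] --> x.
    rewrite -[X in _ --> X]add0r; apply: cvgD; last exact: cvg_cst.
    by under eq_fun do rewrite [_ *: _]mulr1; exact: cvg_id.
  by move/(_ _ fg).
apply/cvgr0Pnorm_le => e e0; move/cvgr0Pnorm_le : dg => /(_ _ e0) dg.
near=> h; rewrite fx subr0 normrM.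
apply: (@le_trans _ _ `|h^-1 * (g (h *: 1 + x) - g x)|); last by near: h.
rewrite gx subr0 normrM ler_wpM2l//.
by near: h; exact: nbhs_dnbhs.
Unshelve. all: by end_near. Qed.

(** For j = 0 this is the constant 1 and not an indicator, so the lemmas on vanishing are stated for
    [j.+1]. *)
Definition pp (j : nat) (x : R) : R := Num.max x 0 ^+ j.

Lemma pp_ge0 (j : nat) (x : R) : 0 <= pp j x.
Proof. by rewrite exprn_ge0// le_max lexx orbT. Qed.

Lemma pp_gt0E (j : nat) (x : R) : 0 <= x -> pp j x = x ^+ j.
Proof. by move=> x0; rewrite /pp max_l. Qed.

Lemma pp_le0E (j : nat) (x : R) : x <= 0 -> pp j.+1 x = 0.
Proof. by move=> x0; rewrite /pp max_r// expr0n. Qed.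

Lemma pp_le (j : nat) (x C : R) : x <= C -> 0 <= C -> pp j x <= C ^+ j.
Proof.
move=> xC C0; rewrite /pp; apply: lerXn2r; rewrite ?nnegrE ?le_max ?lexx ?orbT//.
by rewrite ge_max xC.
Qed.

Lemma ppS (j : nat) (x : R) : x * pp j.+1 x = pp j.+2 x.
Proof.
have [x0|x0] := leP 0 x; first by rewrite !pp_gt0E// -exprS.
by rewrite !pp_le0E ?mulr0// ltW.
Qed.

Lemma continuous_pp j : continuous (pp j).
Proof.
move=> x; rewrite (_ : pp j = (fun x => x ^+ j) \o (fun x => Num.max x 0))//.
apply: continuous_comp.
  by apply: continuous_max; [exact: cvg_id|exact: cvg_cst].
exact: exprn_continuous.
Qed.

Lemma is_derive_expr (n : nat) (x : R) :
  is_derive x 1 (fun y : R => y ^+ n) (n%:R * x ^+ n.-1).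
Proof.
apply: DeriveDef; first exact: exprn_derivable.
by rewrite exp_derive [LHS]mulr1.
Qed.

Lemma is_derive_pp (j : nat) (x : R) : is_derive x 1 (pp j.+2) (j.+2%:R * pp j.+1 x).
Proof.
have [x0|x0|->] := ltgtP x 0.
- rewrite pp_le0E ?mulr0; last exact: ltW.
  apply: (@near_eq_is_derive R R R (cst 0)).
  near=> y; rewrite pp_le0E//; apply: ltW; near: y; exact: lt_nbhsl.
- rewrite pp_gt0E; last exact: ltW.
  apply: (@near_eq_is_derive R R R (fun y => y ^+ j.+2)).
    near=> y; rewrite pp_gt0E//; apply: ltW; near: y; exact: lt_nbhsr.
  exact: is_derive_expr.
- rewrite pp_le0E// mulr0.
  apply: (@is_derive_squeeze0 _ (fun y => y ^+ j.+2)).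
  + by rewrite pp_le0E.
  + by rewrite expr0n.
  + near=> y; rewrite normrX /pp normrX; apply: lerXn2r; rewrite ?nnegrE//.
    by rewrite /Num.max; case: ifP; rewrite ?normr0.
  + by have := is_derive_expr j.+2 0; rewrite expr0n mulr0.
Unshelve. all: by end_near. Qed.

End calculus.

(** * Integrals of derivatives of compactly supported fields *)

Section divergence.
Variable R : realType.
Notation R4 := 'rV[R]_4.
Notation mT := (measurableTypeR R).
Notation lb := (@lebesgue_measure R).
Notation lb2 := (lb2 R).
Notation lb4 := (lb4 R).

Lemma is_derive_continuous (f df : R -> R) :
  (forall x : R, is_derive x 1 f (df x)) -> continuous f.
Proof.
move=> h x; apply: differentiable_continuous; apply/derivable1_diffP.
by have [] := h x.
Qed.

Lemma integral_derive_cpt (f df : R -> R) (K : R) : 0 < K ->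
  (forall x : R, is_derive x 1 f (df x)) -> continuous df ->
  (forall x : R, K <= `|x| -> f x = 0) -> (\int[lb]_x (df x)%:E = 0)%E.
Proof.
move=> K0 fdf cdf fK.
have cf := is_derive_continuous fdf.
have df0 (x : R) : K < `|x| -> df x = 0.
  move=> Kx; have [_ <-] := fdf x.
  rewrite (@near_eq_derive R R R f (cst 0)) ?derive_cst//.
  have : \forall y \near x, K < `|y|.
    apply/nbhs_ballP; exists (`|x| - K); first by rewrite /= subr_gt0.
    by move=> y; rewrite -ball_normE /=; have := lerB_dist x y; lra.
  by apply: filterS => y Ky; rewrite fK// ltW.
have -> : (\int[lb]_x (df x)%:E = \int[lb]_(x in `[(- (K + 1))%R, (K + 1)%R]) (df x)%:E)%E.
  rewrite [RHS]integral_mkcond; apply: eq_integral => x _.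
  rewrite patchE; case: ifPn => // /negP xK; rewrite df0// ltNge.
  apply/negP => xK'; apply: xK; rewrite inE /= in_itv /= -ler_norml.
  by rewrite (le_trans xK')// lerDl.
rewrite (@continuous_FTC2 _ _ f)//.
- rewrite !fK ?subee// ?normrN ger0_norm ?lerDl//; lra.
- lra.
- exact: continuous_subspaceT.
- split.
  + by move=> x _; have [] := fdf x.
  + by apply: cvg_at_right_filter; exact: cf.
  + by apply: cvg_at_left_filter; exact: cf.
- by move=> x _; rewrite derive1E; have [_ ->] := fdf x.
Unshelve. all: by end_near. Qed.

(** Almost every slice of an integrable function is integrable. The premise may assume this of the
    slice, which is what allows the lemma to be applied again inside a slice. *)
Lemma integral_zero_fst d1 d2 (T1 : measurableType d1) (T2 : measurableType d2)
    (m1 : {sigma_finite_measure set T1 -> \bar R})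
    (m2 : {sigma_finite_measure set T2 -> \bar R}) (f : T1 * T2 -> \bar R) :
  (sprod m1 m2).-integrable setT f ->
  (forall y, m1.-integrable setT (fun x => f (x, y)) ->
     (\int[m1]_x f (x, y) = 0)%E) ->
  (\int[sprod m1 m2]_z f z = 0)%E.
Proof.
move=> fi f0; rewrite -[LHS](integral21_prod_meas1 fi).
rewrite (@ae_eq_integral _ _ _ m2 setT (cst 0)%E) ?integral0//.
- exact: (measurable_fubini_G fi).
- have [N [mN N0 subN]] := ae_integrable2 fi.
  exists N; split => // y /= yn; apply: subN => /= /f0 h.
  by apply: yn.
Qed.

Lemma integral_zero_snd d1 d2 (T1 : measurableType d1) (T2 : measurableType d2)
    (m1 : {sigma_finite_measure set T1 -> \bar R})
    (m2 : {sigma_finite_measure set T2 -> \bar R}) (f : T1 * T2 -> \bar R) :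
  (sprod m1 m2).-integrable setT f ->
  (forall x, m2.-integrable setT (fun y => f (x, y)) ->
     (\int[m2]_y f (x, y) = 0)%E) ->
  (\int[sprod m1 m2]_z f z = 0)%E.
Proof.
move=> fi f0; rewrite -[LHS](integral12_prod_meas1 fi).
rewrite (@ae_eq_integral _ _ _ m1 setT (cst 0)%E) ?integral0//.
- exact: (measurable_fubini_F fi).
- have [N [mN N0 subN]] := ae_integrable1 fi.
  exists N; split => // y /= yn; apply: subN => /= /f0 h.
  by apply: yn.
Qed.

Lemma integral_line (X DX : R4 -> R) (i : 'I_4) (K : R) (x0 : R4) : 0 < K ->
  (forall y : R4, is_derive y (e4 R i) X (DX y)) -> continuous DX ->
  (forall y : R4, K <= `|y 0 i| -> X y = 0) -> x0 0 i = 0 ->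
  (\int[lb]_a (DX (a *: e4 R i + x0))%:E = 0)%E.
Proof.
move=> K0 dX cDX XK x0i.
apply: (@integral_derive_cpt (fun a => X (a *: e4 R i + x0)) _ K) => //.
- move=> a; apply/is_derive1P.
  have /is_derive1P := dX (a *: e4 R i + x0).
  congr (is_derive _ _ _ _); apply/funext => h; congr (X _).
  by rewrite addrA -scalerDl; congr (_ *: _ + _); rewrite [_ *: (1 : R)]mulr1.
- move=> a; apply: continuous_comp; last exact: cDX.
  apply: cvgD; last exact: cvg_cst.
  by apply: cvgZr_tmp; exact: cvg_id.
- move=> a Ka; apply: XK; rewrite !mxE x0i addr0 !eqxx mulr1; exact: Ka.
Qed.

(** Fubini is arranged so that the i-th coordinate is integrated innermost, where the fundamental
    theorem of calculus gives 0. Vanishing is required only for |y_i| >= K, hence the separate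
    integrability hypothesis. *)
Lemma integral4_partial (X DX : R4 -> R) (i : 'I_4) (K : R) : 0 < K ->
  (forall y : R4, is_derive y (e4 R i) X (DX y)) -> continuous DX ->
  (forall y : R4, K <= `|y 0 i| -> X y = 0) -> integrable4 DX ->
  integral4 DX = 0.
Proof.
move=> K0 dX cDX XK iDX; rewrite /integral4.
suff -> : (\int[lb4]_z (DX (of_coords z))%:E = 0)%E by [].
have line := integral_line K0 dX cDX XK.
have lineE (x0 : R4) (g : R -> R4) : x0 0 i = 0 -> (forall a, g a = a *: e4 R i + x0) ->
    (\int[lb]_a (DX (g a))%:E = 0)%E.
  by move=> x00 gE; under eq_integral do rewrite gE; exact: line.
case: i => [[|[|[|[|//]]]]] Hi in dX XK line lineE *.
- apply: integral_zero_fst => // q iq.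
  apply: integral_zero_fst => // b _.
  apply: (lineE (of_coords ((0, b), q))); first by rewrite mxE.
  by move=> a; apply/rowP => -[[|[|[|[|//]]]]] Hj; rewrite !mxE /= ?mulr1 ?mulr0 ?addr0 ?add0r.
- apply: integral_zero_fst => // q iq.
  apply: integral_zero_snd => // b _.
  apply: (lineE (of_coords ((b, 0), q))); first by rewrite mxE.
  by move=> a; apply/rowP => -[[|[|[|[|//]]]]] Hj; rewrite !mxE /= ?mulr1 ?mulr0 ?addr0 ?add0r.
- apply: integral_zero_snd => // q iq.
  apply: integral_zero_fst => // b _.
  apply: (lineE (of_coords (q, (0, b)))); first by rewrite mxE.
  by move=> a; apply/rowP => -[[|[|[|[|//]]]]] Hj; rewrite !mxE /= ?mulr1 ?mulr0 ?addr0 ?add0r.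
- apply: integral_zero_snd => // q iq.
  apply: integral_zero_snd => // b _.
  apply: (lineE (of_coords (q, (b, 0)))); first by rewrite mxE.
  by move=> a; apply/rowP => -[[|[|[|[|//]]]]] Hj; rewrite !mxE /= ?mulr1 ?mulr0 ?addr0 ?add0r.
Qed.

End divergence.

(** * Green's formula for truncated powers *)

Section green.
Variable R : realType.
Notation R4 := 'rV[R]_4.

Lemma CkS_is_derive (k : nat) (f : R4 -> R) (i : 'I_4) (y : R4) :
  Ck k.+1 f -> is_derive y (e4 R i) f (partial i f y).
Proof. by move=> [_ [df _]]; apply: DeriveDef. Qed.

Lemma Ck_partial (k : nat) (f : R4 -> R) (i : 'I_4) : Ck k.+1 f -> Ck k (partial i f).
Proof. by move=> [_ [_ h]]; exact: h. Qed.

Lemma Ck_continuous (k : nat) (f : R4 -> R) : Ck k f -> continuous f.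
Proof. by case: k => [//|k] []. Qed.

Lemma Ck_cst (k : nat) (c : R) : Ck k (fun _ : R4 => c).
Proof.
elim: k c => [|k IH] c; first exact: cst_continuous.
split; first exact: cst_continuous.
split=> [i x|i]; first exact: derivable_cst.
have -> : partial i (fun=> c) = fun=> 0.
  by apply/funext => x; rewrite /partial derive_cst.
exact: IH.
Qed.

Lemma CkD (k : nat) (f g : R4 -> R) : Ck k f -> Ck k g -> Ck k (fun y => f y + g y).
Proof.
elim: k f g => [|k IH] f g; first by move=> cf cg x; exact: (cvgD (cf x) (cg x)).
move=> [cf [df Cf]] [cg [dg Cg]]; split.
  by move=> x; exact: (cvgD (cf x) (cg x)).
split=> [i x|i]; first by apply: derivableD.
have -> : partial i (fun y => f y + g y) = fun y => partial i f y + partial i g y.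
  by apply/funext => x; rewrite /partial deriveD.
by apply: IH; [exact: Cf|exact: Cg].
Qed.

Lemma Ck_sum (k n : nat) (f : 'I_n -> R4 -> R) : (forall i, Ck k (f i)) ->
  Ck k (fun y => \sum_(i < n) f i y).
Proof.
elim: n f => [|n IH] f h.
  have -> : (fun y => \sum_(i < 0) f i y) = fun=> 0.
    by apply/funext => y; rewrite big_ord0.
  exact: Ck_cst.
have -> : (fun y => \sum_(i < n.+1) f i y) =
    fun y => \sum_(i < n) f (widen_ord (leqnSn n) i) y + f ord_max y.
  by apply/funext => y; rewrite big_ord_recr.
by apply: CkD => //; apply: IH.
Qed.

Lemma Ck_laplacian (k : nat) (f : R4 -> R) : Ck k.+2 f -> Ck k (laplacian f).
Proof. by move=> Cf; apply: Ck_sum => i; do 2 apply: Ck_partial. Qed.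

Lemma continuous_bounded_box (g : R4 -> R) (x : R4) (r : R) : continuous g -> 0 <= r ->
  exists2 C, 0 <= C & forall y : R4, (forall i, `|y 0 i - x 0 i| <= r) -> `|g y| <= C.
Proof.
move=> cg r0.
pose A := [set v : R4 | forall i, `[x 0 i - r, x 0 i + r]%classic (v 0 i)].
have cA : compact A.
  apply: (@rV_compact R 4 (fun i => `[x 0 i - r, x 0 i + r]%classic)) => i.
  exact: segment_compact.
have xA : A !=set0.
  by exists x => i /=; rewrite in_itv /= gerBl// lerDl r0.
have [|c cAc cM] := @EVT_max_rV R _ (fun y => `|g y|) A xA cA.
  apply: continuous_subspaceT => y.
  by apply: continuous_comp; [exact: cg|exact: norm_continuous].
exists `|g c| => // y yA; apply: cM; rewrite inE => i /=.
by rewrite in_itv /= -ler_distl.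
Qed.

Definition sqn (w : R4) : R := \sum_(i < 4) w 0 i ^+ 2.

Lemma sqn_ge0 (w : R4) : 0 <= sqn w.
Proof. by apply: sumr_ge0 => i _; rewrite sqr_ge0. Qed.

Lemma coord_le_sqn (w : R4) (i : 'I_4) : w 0 i ^+ 2 <= sqn w.
Proof.
rewrite /sqn (bigD1 i)//= lerDl; apply: sumr_ge0 => j _; exact: sqr_ge0.
Qed.

Lemma continuous_sqn : continuous sqn.
Proof.
move=> w; have c (i : 'I_4) : {for w, continuous (fun w : R4 => w 0 i ^+ 2)}.
  rewrite (_ : (fun w : R4 => _) = (fun x : R => x ^+ 2) \o (fun w : R4 => w 0 i))//.
  by apply: continuous_comp; [exact: coord_continuous|exact: exprn_continuous].
have -> : sqn = fun w => w 0 0 ^+ 2 + (w 0 1 ^+ 2 +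
    (w 0 (lift ord0 (lift ord0 ord0)) ^+ 2 + w 0 ord_max ^+ 2)).
  apply/funext => v; rewrite /sqn !big_ord_recl big_ord0 addr0.
  by congr (v _ _ ^+ 2 + (v _ _ ^+ 2 + (v _ _ ^+ 2 + v _ _ ^+ 2))); exact/val_inj.
exact: (cvgD (c 0) (cvgD (c 1) (cvgD (c _) (c _)))).
Qed.

Lemma continuous_subl (x : R4) : continuous (fun y : R4 => x - y).
Proof. by move=> y; exact: (cvgB (cvg_cst _) (@cvg_id _ (nbhs y))). Qed.

(** The truncation acts on |x - y|^2 rather than on |x - y|: the Laplacian in y is then a
    combination of the same functions with smaller exponents, and differentiation in t merely lowers
    the exponent. *)
Definition qq (j : nat) (t : R) (x y : R4) : R := pp j (t - sqn (x - y)).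

Lemma qq_ge0 j t x y : 0 <= qq j t x y.
Proof. exact: pp_ge0. Qed.

Lemma continuous_qq (j : nat) (t : R) (x : R4) : continuous (qq j t x).
Proof.
move=> y; rewrite (_ : qq j t x = pp j \o (fun s => t - s) \o sqn \o (fun y => x - y))//.
apply: continuous_comp; first exact: continuous_subl.
apply: continuous_comp; first exact: continuous_sqn.
apply: continuous_comp; last exact: continuous_pp.
exact: (cvgB (cvg_cst _) (@cvg_id _ _)).
Qed.

Lemma qq_out (j : nat) (t : R) (x y : R4) : t <= sqn (x - y) -> qq j.+1 t x y = 0.
Proof. by move=> h; rewrite /qq pp_le0E// subr_le0. Qed.

Lemma qq_support (j : nat) (t r : R) (x y : R4) : 0 <= r -> t <= r ^+ 2 ->
  ~ (forall i, `|y 0 i - x 0 i| <= r) -> qq j.+1 t x y = 0.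
Proof.
move=> r0 tr /existsNP[i /negP]; rewrite -ltNge => h; apply: qq_out.
rewrite (le_trans tr)// (le_trans _ (coord_le_sqn _ i))//.
rewrite -[leRHS]real_normK ?num_real//; apply: lerXn2r; rewrite ?nnegrE//.
by rewrite !mxE distrC; exact: ltW.
Qed.

Lemma qq_le (j : nat) (t : R) (x y : R4) : 0 <= t -> qq j t x y <= t ^+ j.
Proof. by move=> t0; apply: pp_le => //; rewrite gerBl sqn_ge0. Qed.

Lemma integrable_qq (j : nat) (t : R) (x : R4) (g : R4 -> R) : continuous g ->
  integrable4 (fun y => qq j.+1 t x y * g y).
Proof.
move=> cg; set r := `|t| + 1.
have r0 : 0 < r by rewrite /r ltr_wpDl.
have tr : t <= r ^+ 2.
  rewrite (le_trans (ler_norm t))// /r; have := normr_ge0 t; nra.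
have [C C0 Cg] := continuous_bounded_box x cg (ltW r0).
apply: (@integrable4_bnd _ _ x r (`|t| ^+ j.+1 * C)) => //.
- apply: continuous_meas4 => y; exact: (cvgM (@continuous_qq _ _ _ y) (cg y)).
- move=> y yr; rewrite normrM ler_pM//; last exact: Cg.
  rewrite ger0_norm ?qq_ge0//; apply: pp_le => //.
  by rewrite (le_trans _ (ler_norm t))// gerBl sqn_ge0.
- by move=> y yr; rewrite (@qq_support _ _ r) ?mul0r// ltW.
Qed.

Definition Q (j : nat) (t : R) (x : R4) (g : R4 -> R) : R :=
  integral4 (fun y => qq j t x y * g y).

Lemma is_derive_Q (j : nat) (t : R) (x : R4) (g : R4 -> R) : continuous g ->
  is_derive t 1 (fun t => Q j.+2 t x g) (j.+2%:R * Q j.+1 t x g).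
Proof.
move=> cg.
rewrite /Q -integral4Z; last exact: integrable_qq.
set r := `|t| + 2.
have r0 : 0 < r by rewrite /r ltr_wpDl.
have tr s : s \in `]t - 1, t + 1[ -> s <= `|t| + 1.
  by rewrite in_itv /= => /andP[_]; have := ler_norm t; lra.
have tr2 s : s \in `]t - 1, t + 1[ -> s <= r ^+ 2.
  move=> /tr /le_trans; apply; rewrite /r; have := normr_ge0 t; nra.
have [C C0 Cg] := continuous_bounded_box x cg (ltW r0).
apply: (@is_derive_integral4 _ (fun t y => qq j.+2 t x y * g y)
  (fun t y => j.+2%:R * (qq j.+1 t x y * g y))
  (fun y => (j.+2%:R * ((`|t| + 1) ^+ j.+1 * C)) * box x r y) _ (t - 1) (t + 1)).
- by rewrite in_itv /=; apply/andP; split; lra.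
- by move=> s _; exact: integrable_qq.
- move=> s y _.
  have h : is_derive s 1 (fun s => qq j.+2 s x y) (j.+2%:R * qq j.+1 s x y).
    have := @is_derive_dircomp _ _ (fun s : R => s - sqn (x - y)) (pp j.+2) s 1 1 _ _
      (is_derive_pp j (s - sqn (x - y))).
    rewrite mulr1; apply; rewrite -[X in is_derive _ _ _ X]subr0.
    by apply: is_deriveB.
  apply: is_derive_eq; rewrite /= ?scaler0 ?add0r.
  rewrite /GRing.scale /=; ring.
- exact/integrable4Z/integrable4_box.
- move=> s y st; apply: (@le_box _ (fun y => j.+2%:R * (qq j.+1 s x y * g y))) => {}y yr.
    rewrite normrM ger0_norm// ler_wpM2l// normrM ler_pM//; last exact: Cg.
    rewrite ger0_norm ?qq_ge0//; apply: pp_le.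
      by have := tr _ st; have := sqn_ge0 (x - y); lra.
    by rewrite addr_ge0.
  by rewrite (@qq_support _ _ r) ?mul0r ?mulr0//; [exact: ltW|exact: tr2].
Qed.


Lemma is_derive_coord (x y : R4) (i j : 'I_4) :
  is_derive y (e4 R i) (fun y : R4 => x 0 j - y 0 j) (- (i == j)%:R).
Proof.
apply: cvg_is_derive; apply: cvg_near_cst.
near=> h; rewrite !mxE eqxx /= (eq_sym j).
have h0 : h != 0 by near: h; exact: nbhs_dnbhs_neq.
by field.
Unshelve. all: by end_near. Qed.

Lemma is_derive_sqn (x y : R4) (i : 'I_4) :
  is_derive y (e4 R i) (fun y => sqn (x - y)) (- (2 * (x 0 i - y 0 i))).
Proof.
have E : (fun y => sqn (x - y)) =
    \sum_(j < 4) (fun y : R4 => (x 0 j - y 0 j) ^+ 2).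
  apply/funext => w; rewrite /sqn fct_sumE; apply: eq_bigr => j _.
  by rewrite !mxE.
rewrite E; apply: is_derive_eq.
  apply: (@is_derive_sum _ _ _ _ _ _ _ (fun j => 2 * (x 0 j - y 0 j) * (- (i == j)%:R))) => j.
  have := @is_derive_dircomp R _ (fun y : R4 => x 0 j - y 0 j) (fun s => s ^+ 2) y (e4 R i).
  move=> /(_ _ _ (is_derive_coord x y i j) (is_derive_expr 2 _)).
  by rewrite expr1.
rewrite (bigD1 i)//= eqxx big1 ?addr0 ?mulrN1// => j ji.
by rewrite eq_sym (negbTE ji) oppr0 mulr0.
Qed.

Lemma is_derive_qq (j : nat) (t : R) (x y : R4) (i : 'I_4) :
  is_derive y (e4 R i) (qq j.+2 t x) (2 * j.+2%:R * (x 0 i - y 0 i) * qq j.+1 t x y).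
Proof.
have h1 : is_derive y (e4 R i) (fun y => t - sqn (x - y)) (2 * (x 0 i - y 0 i)).
  have h := @is_deriveB _ _ _ (fun _ : R4 => t) (fun y => sqn (x - y)) y (e4 R i) 0 _
    _ (is_derive_sqn x y i).
  by apply: is_derive_eq; rewrite sub0r opprK.
have := is_derive_dircomp h1 (is_derive_pp j _).
by congr (is_derive _ _ _ _); rewrite /qq; ring.
Qed.

(** With k = j + 3 and s = |x - y|^2, in dimension 4 the Laplacian of (t - s)^k is 4k(k-1) s (t -
    s)^(k-2) - 8k (t - s)^(k-1); substituting s = t - (t - s) gives the two coefficients. The
    condition k >= 3 keeps the second derivatives continuous across the sphere s = t. *)
Lemma green_qq (j : nat) (t : R) (x : R4) (g : R4 -> R) : Ck 2 g ->
  Q j.+3 t x (laplacian g) =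
  4 * t * (j.+3 * j.+2)%:R * Q j.+1 t x g - 4 * (j.+3 * j.+4)%:R * Q j.+2 t x g.
Proof.
move=> Cg; have cg := Ck_continuous Cg.
(* [D i] is the i-th partial derivative of q d_i g - g d_i q for the cutoff q of exponent j + 3: the
   products of first derivatives cancel, and the sum over i is the integrand of Green's formula. *)
pose D i (y : R4) := qq j.+3 t x y * partial i (partial i g) y -
  2 * j.+3%:R * (2 * j.+2%:R * ((x 0 i - y 0 i) ^+ 2 * (qq j.+1 t x y * g y)) -
    qq j.+2 t x y * g y).
have c1 i : continuous (partial i g) := Ck_continuous (Ck_partial i Cg).
have c2 i : continuous (partial i (partial i g)) :=
  Ck_continuous (Ck_partial i (Ck_partial i Cg)).
have cx i : continuous (fun y : R4 => x 0 i - y 0 i).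
  move=> y; exact: (cvgB (cvg_cst _) (@coord_continuous R 1 4 0 i y)).
have csq i : continuous (fun y : R4 => (x 0 i - y 0 i) ^+ 2).
  move=> y; rewrite (_ : (fun y : R4 => _) =
    (fun s : R => s ^+ 2) \o (fun y : R4 => x 0 i - y 0 i))//.
  by apply: continuous_comp; [exact: cx|exact: exprn_continuous].
have iq1 i : integrable4 (fun y : R4 => (x 0 i - y 0 i) ^+ 2 * (qq j.+1 t x y * g y)).
  apply: (@integrable4_eq _ (fun y => qq j.+1 t x y * ((x 0 i - y 0 i) ^+ 2 * g y))).
    by move=> y; ring.
  by apply: integrable_qq => y; exact: (cvgM (csq i y) (cg y)).
have D0 i : integral4 (D i) = 0.
  have iD : integrable4 (D i).
    apply: integrable4B; first exact: integrable_qq.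
    apply/integrable4Z/integrable4B; last exact: integrable_qq.
    exact/integrable4Z.
  apply: (@integral4_partial R (fun y => qq j.+3 t x y * partial i g y -
    2 * j.+3%:R * (x 0 i - y 0 i) * (qq j.+2 t x y * g y)) _ i (`|x 0 i| + `|t| + 1)) => //.
  - move=> y.
    have dg : is_derive y (e4 R i) g (partial i g y) := CkS_is_derive i y Cg.
    have ddg : is_derive y (e4 R i) (partial i g) (partial i (partial i g) y) :=
      CkS_is_derive i y (Ck_partial i Cg).
    have d3 := is_derive_qq j.+1 t x y i.
    have d2 := is_derive_qq j t x y i.
    have dx := is_derive_coord x y i i.
    have dc := @is_derive_cst R _ R (2 * j.+3%:R) y (e4 R i).
    have h1 := is_deriveM d3 ddg.
    have h2 := is_deriveM (is_deriveM dc dx) (is_deriveM d2 dg).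
    have := is_deriveB h1 h2.
    congr (is_derive _ _ _ _).
    rewrite /D /GRing.scale /= /cst eqxx !mulrfctE -[1 *- true]/(-1); ring.
  - move=> y; rewrite /D.
    have cq k := @continuous_qq k t x y.
    exact: (cvgB (cvgM (cq _) (c2 i y)) (cvgM (cvg_cst _) (cvgB (cvgM (cvg_cst _)
      (cvgM (csq i y) (cvgM (cq _) (cg y)))) (cvgM (cq _) (cg y))))).
  - move=> y Ky.
    have hs : t <= sqn (x - y).
      apply: le_trans (coord_le_sqn _ i); rewrite !mxE.
      have := lerB_dist (y 0 i) (x 0 i); rewrite distrC => h.
      have t1 : `|t| + 1 <= `|x 0 i - y 0 i| by lra.
      rewrite -[leRHS]real_normK ?num_real//.
      have := normr_ge0 t; have := ler_norm t; nra.
    by rewrite !qq_out// !mul0r mulr0 subr0.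
have : \sum_(i < 4) integral4 (D i) = 0 by apply: big1.
rewrite -integral4_sum; last first.
  move=> i; apply: integrable4B; first exact: integrable_qq.
  apply/integrable4Z/integrable4B; last exact: integrable_qq.
  exact/integrable4Z.
have -> : integral4 (fun y => \sum_(i < 4) D i y) =
  integral4 (fun y => qq j.+3 t x y * laplacian g y -
   (4 * t * (j.+3 * j.+2)%:R * (qq j.+1 t x y * g y) -
    4 * (j.+3 * j.+4)%:R * (qq j.+2 t x y * g y))).
  apply: eq_integral4 => y; rewrite /D sumrB -mulr_sumr; congr (_ - _).
  rewrite -mulr_sumr sumrB -mulr_sumr -mulr_suml sumr_const card_ord.
  have -> : \sum_(i < 4) (x 0 i - y 0 i) ^+ 2 = sqn (x - y).
    by apply: eq_bigr => i _; rewrite !mxE.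
  have -> : qq j.+2 t x y = (t - sqn (x - y)) * qq j.+1 t x y by rewrite /qq ppS.
  rewrite !natrM -!natr1; ring.
have cl : continuous (laplacian g) := Ck_continuous (Ck_laplacian (k := 0) Cg).
have iA := @integrable_qq j.+2 t x _ cl.
have iB := @integrable_qq j t x _ cg.
have iC := @integrable_qq j.+1 t x _ cg.
rewrite (integral4B iA (integrable4B (integrable4Z _ iB) (integrable4Z _ iC))).
rewrite (integral4B (integrable4Z _ iB) (integrable4Z _ iC)).
rewrite (integral4Z _ iB) (integral4Z _ iC).
by move/eqP; rewrite subr_eq0 => /eqP.
Qed.

End green.

(** * Integrability of logarithmic singularities *)

Section log_kernel.
Variable R : realType.
Notation R4 := 'rV[R]_4.
Notation mT := (measurableTypeR R).
Notation lb := (@lebesgue_measure R).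

Lemma enormE (w : R4) : enorm w = Num.sqrt (sqn w). Proof. by []. Qed.

Lemma enorm_ge0 (w : R4) : 0 <= enorm w. Proof. exact: sqrtr_ge0. Qed.

Lemma sqr_enorm (w : R4) : enorm w ^+ 2 = sqn w.
Proof. by rewrite sqr_sqrtr// sqn_ge0. Qed.

Lemma enormN (w : R4) : enorm (- w) = enorm w.
Proof. by congr Num.sqrt; apply: eq_bigr => i _; rewrite !mxE sqrrN. Qed.

Lemma enormBC (a b : R4) : enorm (a - b) = enorm (b - a).
Proof. by rewrite -enormN opprB. Qed.

Lemma enorm0 : enorm (0 : R4) = 0.
Proof.
by rewrite enormE /sqn big1 ?sqrtr0// => i _; rewrite mxE expr0n.
Qed.

Lemma coord_le_enorm (w : R4) (i : 'I_4) : `|w 0 i| <= enorm w.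
Proof.
rewrite -(@ler_pXn2r _ 2)// ?nnegrE ?enorm_ge0//.
by rewrite real_normK ?num_real// sqr_enorm coord_le_sqn.
Qed.

Lemma enorm_eq0 (w : R4) : enorm w = 0 -> w = 0.
Proof.
move=> w0; apply/rowP => i; rewrite mxE; apply/eqP; rewrite -normr_eq0 -normr_le0 normr_id.
by rewrite -w0 coord_le_enorm.
Qed.

Lemma enorm_gt0 (w : R4) : w != 0 -> 0 < enorm w.
Proof.
move=> w0; rewrite lt_neqAle enorm_ge0 andbT eq_sym.
by apply/eqP => /enorm_eq0 /eqP; apply/negP.
Qed.

Lemma cauchy_schwarz4 (a b : R4) :
  \sum_(i < 4) a 0 i * b 0 i <= enorm a * enorm b.
Proof.
have [h|h] := leP (\sum_(i < 4) a 0 i * b 0 i) 0.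
  by rewrite (le_trans h)// mulr_ge0// enorm_ge0.
rewrite -(@ler_pXn2r _ 2)// ?nnegrE ?(ltW h) ?mulr_ge0 ?enorm_ge0//.
rewrite exprMn !sqr_enorm -subr_ge0 /sqn !big_ord_recl !big_ord0.
set a0 := a 0 _; set a1 := a 0 _; set a2 := a 0 _; set a3 := a 0 _.
set b0 := b 0 _; set b1 := b 0 _; set b2 := b 0 _; set b3 := b 0 _.
rewrite (_ : _ - _ = (a0 * b1 - a1 * b0) ^+ 2 + (a0 * b2 - a2 * b0) ^+ 2 +
  (a0 * b3 - a3 * b0) ^+ 2 + (a1 * b2 - a2 * b1) ^+ 2 +
  (a1 * b3 - a3 * b1) ^+ 2 + (a2 * b3 - a3 * b2) ^+ 2); last by ring.
by rewrite !addr_ge0// sqr_ge0.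
Qed.

Lemma sqnD (a b : R4) :
  sqn (a + b) = sqn a + 2 * (\sum_(i < 4) a 0 i * b 0 i) + sqn b.
Proof.
rewrite /sqn mulr_sumr -!big_split /=; apply: eq_bigr => i _.
by rewrite mxE; ring.
Qed.

Lemma enormD (a b : R4) : enorm (a + b) <= enorm a + enorm b.
Proof.
rewrite -(@ler_pXn2r _ 2)// ?nnegrE ?addr_ge0 ?enorm_ge0//.
rewrite sqr_enorm sqnD sqrrD !sqr_enorm.
by have := cauchy_schwarz4 a b; lra.
Qed.

Lemma enorm_trig (a b : R4) : enorm a <= enorm (b - a) + enorm b.
Proof.
have -> : enorm a = enorm (- (b - a) + b) by congr enorm; rewrite opprB subrK.
by rewrite (le_trans (enormD _ _))// enormN.
Qed.

Lemma continuous_enorm : continuous (@enorm R).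
Proof.
move=> w; rewrite (_ : @enorm R = Num.sqrt \o (@sqn R))//.
by apply: continuous_comp; [exact: continuous_sqn|exact: sqrt_continuous].
Qed.

(** A nonnegative majorant of -ln |r| for nonzero r. Since the inverse of 0 is 0, its value at 0 is
    0. *)
Definition k1 (r : R) : R := ln (1 + `|r|^-1).

Lemma k1_ge0 (r : R) : 0 <= k1 r.
Proof. by apply: ln_ge0; rewrite lerDl invr_ge0. Qed.

Lemma ln_pow2_le (n : nat) : ln ((2 : R) ^+ n) <= n%:R.
Proof.
rewrite -[leRHS]expRK ler_ln ?posrE ?exprn_gt0 ?expR_gt0//.
rewrite -[n%:R]mulr1 expRM_natl; apply: lerXn2r; rewrite ?nnegrE ?expR_ge0//.
by have := expR_ge1Dx (1 : R); rewrite -[X in X <= _]/(2%:R).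
Qed.

Lemma exists_pow2 (t : R) : 1 <= t -> exists n : nat, 2 ^+ n <= t /\ t < 2 ^+ n.+1.
Proof.
move=> t1; have t0 : 0 <= t by rewrite (le_trans ler01).
have [m1 m2] := andP (truncn_itv t0).
set m := Num.truncn t in m1 m2.
have m0 : (0 < m)%N by rewrite /m truncn_gt0.
exists (trunc_log 2 m); have /andP[h1 h2] := trunc_log_bounds (isT : (1 < 2)%N) m0.
split; first by rewrite (le_trans _ m1)// -natrX ler_nat.
by rewrite (lt_le_trans m2)// -natrX ler_nat.
Qed.

Lemma measurable_inv_nneg d (T : measurableType d) (f : T -> R) :
  measurable_fun setT f -> (forall x, 0 <= f x) ->
  measurable_fun setT (fun x => (f x)^-1).
Proof.
move=> mf f0; rewrite (_ : (fun x => (f x)^-1) = (fun r => r `^ (-1)) \o f).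
  exact: (measurableT_comp (measurable_powR (-1)) mf).
by apply/funext => x /=; rewrite powR_inv1.
Qed.

Lemma measurable_k1 (c : R) : measurable_fun (setT : set mT) (fun s => k1 (s - c)).
Proof.
rewrite /k1; apply: (measurableT_comp (@measurable_ln R)).
apply: measurable_funD; first exact: measurable_cst.
apply: measurable_inv_nneg => //.
apply: measurableT_comp => //.
by apply: measurable_funB.
Qed.

(** The integrand is at most the series of 2 times the indicators of |s - c| <= 2^-n, whose
    integrals 4 / 2^n add up to 8. *)
Lemma integral_k1 (c : R) :
  (\int[lb]_s (\1_(`[(c - 1)%R, (c + 1)%R]) s * k1 (s - c))%:E <= 8%:E)%E.
Proof.
pose I (n : nat) : set R := `[c - 2 ^- n, c + 2 ^- n]%classic.
have mI n : measurable (I n : set mT) by exact: measurable_itv.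
pose g n (s : mT) : \bar R := (2 * \1_(I n) s)%:E.
have mg n : measurable_fun setT (g n).
  apply/measurable_EFinP; apply: measurable_funM; first exact: measurable_cst.
  exact: measurable_indic.
have g0 n s : (0 <= g n s)%E by rewrite lee_fin mulr_ge0.
have step : (\int[lb]_s (\1_(`[(c - 1)%R, (c + 1)%R]) s * k1 (s - c))%:E <=
   \int[lb]_s (\sum_(n <oo) g n s))%E.
  apply: ge0_le_integral => //.
  - by move=> s _; rewrite lee_fin mulr_ge0// k1_ge0.
  - apply/measurable_EFinP; apply: measurable_funM; last exact: measurable_k1.
    by apply: measurable_indic; exact: measurable_itv.
  - exact: ge0_emeasurable_sum.
  - move=> s _; rewrite indicE.
    case: (boolP (s \in _)) => [|_]; last by rewrite mul0r nneseries_ge0.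
    rewrite mul1r inE /= in_itv /= -ler_distl => sc1.
    have [->|sc] := eqVneq s c.
      by rewrite subrr /k1 normr0 invr0 addr0 ln1 nneseries_ge0.
    have r0 : 0 < `|s - c| by rewrite normr_gt0 subr_eq0.
    (* For 2^n <= 1/|s - c| < 2^(n+1) the first n + 1 terms of the series equal 2, while [k1] is at
       most ln 2^(n+2) <= n + 2 <= 2(n + 1). *)
    have [|n [n1 n2]] := @exists_pow2 `|s - c|^-1; first by rewrite invr_ge1// ?unitfE ?gt_eqF.
    apply: le_trans (nneseries_lim_ge n.+1 _); last by move=> k _ _; exact: g0.
    rewrite (eq_big_nat _ _ (F2 := fun=> (2 : R)%:E)); last first.
      move=> i /andP[_ iN]; rewrite /g indicE mem_set ?mulr1// /I /= in_itv /= -ler_distl.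
      have : `|s - c| <= 2 ^- n by rewrite -[X in X <= _]invrK lef_pV2 ?posrE ?invr_gt0 ?exprn_gt0.
      by move=> h; rewrite (le_trans h)// lef_pV2 ?posrE ?exprn_gt0// ler_eXn2l// ltr1n.
    rewrite sumEFin lee_fin sumr_const_nat subn0.
    apply: (@le_trans _ _ (ln (2 ^+ n.+2))).
      have p1 : 0 < 1 + `|s - c|^-1 by rewrite addr_gt0// invr_gt0.
      rewrite ler_ln ?posrE ?exprn_gt0//.
      rewrite exprS mulr2n mulrDl mul1r lerD// ?(ltW n2)//.
      by apply: exprn_ege1; lra.
    rewrite (le_trans (ln_pow2_le _))// -[X in _ <= X]mulr_natr -natrM ler_nat; lia.
apply: (le_trans step); rewrite integral_nneseries//.
have E n : (\int[lb]_s g n s = (8 / (2 ^ (n + 1))%:R)%:E)%E.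
  rewrite /g; under eq_integral do rewrite EFinM.
  rewrite ge0_integralZl//; last first.
    by apply/measurable_EFinP; exact: measurable_indic.
  rewrite integral_indic// setIT.
  have lI : (lb (I n) = (2 * 2 ^- n)%:E)%E.
    apply: (etrans (lebesgue_measure_itv _)); rewrite /= lte_fin.
    have h : 0 < (2 : R) ^- n by rewrite invr_gt0 exprn_gt0.
    rewrite ltrD2l gtrN// -EFinB; congr EFin; ring.
  transitivity ((2 : R)%:E * (2 * 2 ^- n)%:E)%E; first by congr (_ * _)%E; exact: lI.
  rewrite -EFinM; congr EFin; rewrite natrX exprD expr1.
  by have h := @expf_neq0 R 2 n; field; apply: h; rewrite pnatr_eq0.
have := @cvg_geometric_eseries_half R 8 0.
rewrite expr0 divr1 => /cvg_lim <- //.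
rewrite le_eqVlt; apply/orP; left; apply/eqP; congr (limn _).
by apply/funext => n; apply: eq_bigr => i _; rewrite E.
Qed.

Definition ell (w : R4) : R := ln (1 + (enorm w)^-1).

Lemma ell_ge0 (w : R4) : 0 <= ell w.
Proof. by apply: ln_ge0; rewrite lerDl invr_ge0 enorm_ge0. Qed.

Lemma ellBC (a b : R4) : ell (a - b) = ell (b - a).
Proof. by rewrite /ell enormBC. Qed.

(** One nonzero coordinate suffices, because |w_i| <= |w|. Summing over all coordinates makes the
    bound independent of that choice and reduces the singularity at a point to one-dimensional
    ones. *)
Lemma ell_le_k1 (w : R4) : ell w <= \sum_(i < 4) k1 (w 0 i).
Proof.
have [->|] := eqVneq w 0.
  rewrite /ell enorm0 invr0 addr0 ln1; apply: sumr_ge0 => i _; exact: k1_ge0.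
move=> w0; have [i wi] : exists i, w 0 i != 0.
  apply/existsP; apply: contraNT w0; rewrite negb_exists => /forallP h.
  by apply/eqP/rowP => i; rewrite mxE; have := h i; rewrite negbK => /eqP.
rewrite (bigD1 i)//= -[leLHS]addr0 lerD//; last first.
  by apply: sumr_ge0 => j _; exact: k1_ge0.
have wi0 : 0 < `|w 0 i| by rewrite normr_gt0.
have w1 := enorm_gt0 w0.
rewrite /ell /k1 ler_ln ?posrE ?addr_gt0 ?invr_gt0// lerD2l.
by rewrite lef_pV2 ?posrE// coord_le_enorm.
Qed.

Lemma measurable_enorm (x : R4) : meas4 (fun y => enorm (x - y)).
Proof.
apply: continuous_meas4 => y.
rewrite (_ : (fun y => enorm (x - y)) = @enorm R \o (fun y => x - y))//.
by apply: continuous_comp; [exact: continuous_subl|exact: continuous_enorm].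
Qed.

Lemma measurable_ell (x : R4) : meas4 (fun y => ell (x - y)).
Proof.
rewrite /meas4 /ell; apply: (measurableT_comp (@measurable_ln R)).
apply: measurable_funD; first exact: measurable_cst.
apply: measurable_inv_nneg; first exact: measurable_enorm.
by move=> z; exact: enorm_ge0.
Qed.

Lemma ell_far (x y : R4) : ~ (forall i, `|y 0 i - x 0 i| <= 1) -> ell (x - y) <= 1.
Proof.
move=> /existsNP[i /negP]; rewrite -ltNge => h.
have h1 : 1 < enorm (x - y).
  by apply: (lt_le_trans _ (coord_le_enorm _ i)); rewrite !mxE distrC.
rewrite /ell; apply: (@le_trans _ _ (ln ((2 : R) ^+ 1))); last exact: ln_pow2_le.
have h2 : (enorm (x - y))^-1 <= 1 by rewrite invf_le1 ?ltW// (lt_trans ltr01).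
have h3 : 0 <= (enorm (x - y))^-1 by rewrite invr_ge0 enorm_ge0.
rewrite expr1 ler_ln ?posrE; lra.
Qed.

(** Each of the four terms [k1] contributes at most 8 (2r)^3, whence 4 * 8 * 8 = 256. In the
    singular direction the integral runs over a length of 2 whatever r is, so the power is r^3; any
    positive power is enough for the later use on tiny cubes. *)
Lemma ell_box (x : R4) (r : R) : 0 < r -> r <= 1 ->
  integrable4 (fun y => ell (x - y) * box x r y) /\
  integral4 (fun y => ell (x - y) * box x r y) <= 256 * r ^+ 3.
Proof.
move=> r0 r1.
pose h (i j : 'I_4) (s : mT) : R := \1_(`[(x 0 j - r)%R, (x 0 j + r)%R]) s *
   (if j == i then k1 (s - x 0 i) else 1).
have mh i j : measurable_fun setT (h i j).
  apply: measurable_funM; first by apply: measurable_indic; exact: measurable_itv.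
  by case: eqP => _; [exact: measurable_k1|exact: measurable_cst].
have h0 i j s : 0 <= h i j s.
  by rewrite /h mulr_ge0//; case: eqP => _ //; exact: k1_ge0.
pose H (i : 'I_4) (y : R4) := \prod_(j < 4) h i j (y 0 j).
have H0 i y : 0 <= H i y by apply: prodr_ge0.
have HE i y : H i y = k1 (x 0 i - y 0 i) * box x r y.
  rewrite /H /h big_split /= mulrC; congr (_ * _).
  rewrite (bigD1 i)//= eqxx big1 ?mulr1; last by move=> j /negbTE ->.
  by rewrite /k1 distrC.
have mH i : meas4 (H i).
  apply: measurable_prod => j _.
  exact: (measurableT_comp (mh i j) (measurable_coord j)).
have IH i : (\int[lb4 R]_z (H i (of_coords z))%:E <= ((2 * r) ^+ 3 * 8)%:E)%E.
  rewrite integral4_prod// (bigD1 i)//=.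
  have I1 j : j != i -> (\int[lb]_s (h i j s)%:E = (2 * r)%:E)%E.
    move=> /negbTE ji; rewrite /h ji; under eq_integral do rewrite mulr1.
    rewrite integral_indic// setIT.
    apply: (etrans (lebesgue_measure_itv _)); rewrite /= lte_fin.
    by rewrite ltrD2l gtrN// -EFinB; congr EFin; ring.
  rewrite (eq_bigr (fun=> (2 * r)%:E)); last by move=> j; exact: I1.
  rewrite prodEFin prodr_const.
  have -> : #|[pred j : 'I_4 | j != i]| = 3%N by rewrite cardC1 card_ord.
  have -> : (((2 * r) ^+ 3 * 8)%:E = (8 : R)%:E * ((2 * r) ^+ 3)%:E)%E.
    by rewrite -EFinM mulrC.
  apply: lee_wpmul2r; first by rewrite lee_fin exprn_ge0// mulr_ge0// ltW.
  apply: le_trans (integral_k1 (x 0 i)); apply: ge0_le_integral => //.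
  - by move=> s _; rewrite lee_fin.
  - exact/measurable_EFinP.
  - apply/measurable_EFinP; apply: measurable_funM; last exact: measurable_k1.
    by apply: measurable_indic; exact: measurable_itv.
  - move=> s _; rewrite lee_fin /h eqxx ler_wpM2r ?k1_ge0// !indicE.
    rewrite ler_nat; case: (boolP (s \in `[(x 0 i - r)%R, (x 0 i + r)%R]%classic)) => //.
    rewrite inE /= in_itv /= => /andP[a1 a2]; rewrite mem_set//= in_itv /=.
    by apply/andP; split; lra.
have iH i : integrable4 (H i).
  by apply: integrable4_ge0 => //; apply: (le_lt_trans (IH i)); rewrite ltry.
have IH' i : integral4 (H i) <= (2 * r) ^+ 3 * 8.
  rewrite /integral4 -lee_fin fineK; first exact: IH.
  exact: (integrable_fin_num (mu := lb4 R) measurableT (iH i)).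
have bnd y : `|ell (x - y) * box x r y| <= \sum_(i < 4) H i y.
  rewrite ger0_norm ?mulr_ge0 ?ell_ge0 ?box_ge0//.
  under eq_bigr do rewrite HE.
  rewrite -mulr_suml ler_wpM2r ?box_ge0// (le_trans (ell_le_k1 _))//.
  by under eq_bigr do rewrite !mxE.
have iell : integrable4 (fun y => ell (x - y) * box x r y).
  apply: (le_integrable4 _ _ bnd); last exact: integrable4_sum.
  by apply: measurable_funM; [exact: measurable_ell|exact: measurable_box].
split => //; apply: (@le_trans _ _ (integral4 (fun y => \sum_(i < 4) H i y))).
  apply: le_integral4 => //; first exact: integrable4_sum.
  by move=> y; apply: (le_trans (ler_norm _)).
rewrite integral4_sum//; apply: (@le_trans _ _ (\sum_(i < 4) ((2 * r) ^+ 3 * 8))).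
  by apply: ler_sum => i _.
rewrite sumr_const card_ord -mulr_natr; lra.
Qed.

(** On the unit cube around x the factor f is bounded and [ell] integrable; off it [ell] is at most
    1 and f integrable. *)
Lemma integrable_ell (x : R4) (f : R4 -> R) : continuous f -> integrable4 f ->
  integrable4 (fun y => ell (x - y) * `|f y|).
Proof.
move=> cf fi; have [C C0 fC] := continuous_bounded_box x cf (@ler01 R).
have [i1 _] := ell_box x (@ltr01 R) (lexx 1).
apply: (@le_integrable4 _ _ (fun y => C * (ell (x - y) * box x 1 y) + `|f y|)).
- apply: measurable_funM; first exact: measurable_ell.
  apply: measurableT_comp => //; exact: integrable4_meas.
- by apply: integrable4D; [exact: integrable4Z|exact: integrable4_norm].
move=> y; rewrite normrM normr_id ger0_norm ?ell_ge0//.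
have [h|h] := pselect (forall i, `|y 0 i - x 0 i| <= 1).
  rewrite box_in// mulr1 -[leLHS]addr0 lerD// mulrC ler_wpM2r ?ell_ge0//.
  exact: fC.
rewrite box_out// !mulr0 add0r -[leRHS]mul1r ler_wpM2r//.
exact: ell_far.
Qed.

(** The numbers c = |y| and d = |z - y| differ by at most rho, so c/d <= 1 + rho/d <= (1 + rho)(1 +
    1/d), and likewise for d/c. At y = 0 and y = z the kernel takes the default value ln 0 = 0. *)
Lemma log_kernel_le (rho : R) (z y : R4) : enorm z <= rho ->
  `|ln (enorm y / enorm (z - y))| <= ln (1 + rho) + ell y + ell (z - y).
Proof.
move=> zr; have rho0 : 0 <= rho := le_trans (enorm_ge0 z) zr.
have l0 : 0 <= ln (1 + rho) by apply: ln_ge0; rewrite lerDl.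
have rhs0 : 0 <= ln (1 + rho) + ell y + ell (z - y) by rewrite !addr_ge0// ell_ge0.
set a := enorm y; set b := enorm (z - y).
have [a0|a0] := eqVneq a 0; first by rewrite a0 mul0r ln0// normr0.
have [b0|b0] := eqVneq b 0; first by rewrite b0 invr0 mulr0 ln0// normr0.
have ap : 0 < a by rewrite lt_neqAle eq_sym a0 enorm_ge0.
have bp : 0 < b by rewrite lt_neqAle eq_sym b0 enorm_ge0.
have ab : a <= b + rho by rewrite (le_trans (enorm_trig y z))// lerD2l.
have ba : b <= a + rho.
  by rewrite (le_trans (enormD _ _))// addrC enormN lerD2l.
have key c d : 0 < c -> 0 < d -> c <= d + rho -> ln (c / d) <= ln (1 + rho) + ln (1 + d^-1).
  move=> cp dp cd; have d1 : 0 < d^-1 by rewrite invr_gt0.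
  rewrite -lnM ?posrE; try by rewrite addr_gt0// ?ltr_pwDl//.
    rewrite ler_ln ?posrE ?mulr_gt0//; try lra.
    rewrite (le_trans (ler_wpM2r (ltW d1) cd))// mulrDl divff ?gt_eqF//; nra.
  lra.
have ab' := key _ _ ap bp ab; have ba' := key _ _ bp ap ba.
have E : ln (b / a) = - ln (a / b).
  by rewrite -lnV ?posrE ?divr_gt0// invf_div.
have pa : 0 <= ln (1 + a^-1) by apply: ln_ge0; rewrite lerDl invr_ge0 ltW.
have pb : 0 <= ln (1 + b^-1) by apply: ln_ge0; rewrite lerDl invr_ge0 ltW.
rewrite E in ba'; rewrite /ell -/a -/b ler_norml; apply/andP; split; lra.
Qed.

End log_kernel.

(** * The truncated logarithm *)

Section truncated_log.
Variable R : realType.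
Notation R4 := 'rV[R]_4.

Lemma cst_on_pos (N : R -> R) : (forall t : R, 0 < t -> is_derive t 1 N 0) ->
  forall s t, 0 < s -> 0 < t -> N s = N t.
Proof.
move=> dN.
have key s t : 0 < s -> s < t -> N s = N t.
  move=> s0 st; have [| |c _] := @MVT R N (fun=> 0) s t st.
  - by move=> c; rewrite in_itv /= => /andP[sc _]; apply: dN; exact: lt_trans sc.
  - apply: derivable_within_continuous => c; rewrite in_itv /= => /andP[sc _].
    by have [] := dN c (lt_le_trans s0 sc).
  by rewrite mul0r => /eqP; rewrite subr_eq0 => /eqP.
move=> s t s0 t0; have [st|ts|->//] := ltgtP s t; first exact: key.
by apply/esym; exact: key.
Qed.

Lemma is_derive_invX (n : nat) (t : R) : 0 < t ->
  is_derive t 1 (fun t : R => t ^- n) (- (n%:R * t ^- n.+1)).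
Proof.
move=> t0; have tn0 : t ^+ n != 0 by rewrite expf_neq0// gt_eqF.
have d := is_derive_expr n t.
have := @is_deriveV R (fun t : R => t ^+ n) t _ 1 tn0 d.
congr (is_derive _ _ _ _); rewrite /GRing.scale /= .
case: n tn0 {d} => [|n] tn0; first by rewrite !mul0r mulr0 oppr0.
have t1 : t != 0 by rewrite gt_eqF.
have tnn : t ^+ n != 0 by rewrite expf_neq0.
by rewrite /= !exprS; field; rewrite ?t1 ?tnn.
Qed.

(** The Taylor polynomial of degree 6 of -ln(1 - s) at 0. Its derivative is the geometric sum (1 -
    s^6)/(1 - s), the source of the sixth power in the t-derivative of the truncated logarithm. *)
Definition P6 (s : R) : R := \sum_(j < 6) j.+1%:R^-1 * s ^+ j.+1.

Lemma is_derive_P6 (s : R) : is_derive s 1 P6 (\sum_(j < 6) s ^+ j).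
Proof.
have -> : P6 = \sum_(j < 6) (fun s => j.+1%:R^-1 * s ^+ j.+1).
  by apply/funext => w; rewrite fct_sumE.
apply: is_derive_eq.
  apply: (@is_derive_sum _ _ _ _ _ _ _ (fun j : 'I_6 => s ^+ j)) => j.
  have := @is_deriveZ _ _ _ (fun s : R => s ^+ j.+1) j.+1%:R^-1 s 1 _ (is_derive_expr j.+1 s).
  by congr (is_derive _ _ _ _); rewrite /GRing.scale /= mulKf.
by [].
Qed.

Lemma P6_0 : P6 0 = 0.
Proof. by rewrite /P6 big1// => j _; rewrite expr0n mulr0. Qed.

Lemma P6_lip (a b : R) : 0 <= a -> a <= b -> b <= 1 ->
  0 <= P6 b - P6 a /\ P6 b - P6 a <= 6 * (b - a).
Proof.
move=> a0 ab b1.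
have b0 := le_trans a0 ab; have a1 := le_trans ab b1.
have key (j : nat) : 0 <= b ^+ j.+1 - a ^+ j.+1 <= j.+1%:R * (b - a).
  rewrite subr_ge0 lerXn2r ?nnegrE//= subrXX mulrC ler_wpM2r ?subr_ge0//.
  rewrite -[leRHS]mulr1 mulr_natl -[X in _ *+ X]card_ord -sumr_const.
  apply: ler_sum => i _; rewrite -[leRHS]mulr1.
  by apply: ler_pM; rewrite ?exprn_ge0// exprn_ile1.
have key2 (j : nat) : 0 <= j.+1%:R^-1 * (b ^+ j.+1 - a ^+ j.+1) <= b - a.
  have /andP[h1 h2] := key j.
  by rewrite mulr_ge0 ?invr_ge0//= mulrC ler_pdivrMr ?ltr0n// mulrC.
have -> : P6 b - P6 a = \sum_(j < 6) j.+1%:R^-1 * (b ^+ j.+1 - a ^+ j.+1).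
  by rewrite -sumrB; apply: eq_bigr => j _; rewrite mulrBr.
split; first by apply: sumr_ge0 => j _; have /andP[] := key2 j.
apply: (@le_trans _ _ (\sum_(j < 6) (b - a))).
  by apply: ler_sum => j _; have /andP[] := key2 j.
by rewrite sumr_const card_ord mulr_natl.
Qed.

(* [Th t s] is [ln (t / s)] near [s = 0], vanishes for [s >= t] and is six
   times differentiable in between; at [s = 0] it takes the junk value [- P6 1]. *)
Definition Th (t s : R) : R :=
  - ln (Num.min (s / t) 1) - P6 (1 - Num.min (s / t) 1).

Lemma Th_out (t s : R) : 0 < t -> t <= s -> Th t s = 0.
Proof.
move=> t0 ts; rewrite /Th min_r; last by rewrite ler_pdivlMr// mul1r.
by rewrite ln1 oppr0 subrr P6_0 subr0.
Qed.

Lemma Th_in (t s : R) : 0 < s -> s < t -> Th t s = ln t - ln s - P6 (1 - s / t).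
Proof.
move=> s0 st; have t0 := lt_trans s0 st.
rewrite /Th min_l; last by rewrite ler_pdivrMr// mul1r ltW.
by rewrite ln_div ?posrE// opprB.
Qed.

Lemma Th0 (t : R) : Th t 0 = - P6 1.
Proof. by rewrite /Th mul0r min_l// ln0// subr0 oppr0 sub0r. Qed.

Lemma ln_sub_ge (a b : R) : 0 < a -> a <= b -> b <= 1 -> b - a <= ln b - ln a.
Proof.
move=> a0 ab b1; have b0 := lt_le_trans a0 ab.
have h : ln (a / b) <= a / b - 1.
  have := @le_ln1Dx R (a / b - 1); rewrite [1 + _]addrC subrK; apply.
  by rewrite ltrBrDr addNr divr_gt0.
rewrite ln_div ?posrE// in h.
have : b - a <= (b - a) / b.
  by rewrite ler_pdivlMr// ler_piMr// subr_ge0.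
rewrite mulrBl divff ?gt_eqF//; lra.
Qed.

(** The point is that the bound is free of t, which yields a dominating function as t tends to
    infinity. Truncating s/t at 1 only decreases differences of logarithms; [P6] is 6-Lipschitz on
    [0, 1], and increments of ln on (0, 1] are at least those of its argument. *)
Lemma Th_lip (t a b : R) : 0 < t -> 0 < a -> 0 < b ->
  `|Th t a - Th t b| <= 6 * `|ln b - ln a|.
Proof.
move=> t0; wlog ab : a b / a <= b.
  move=> H a0 b0; have [ab|/ltW ba] := leP a b; first exact: H.
  by rewrite distrC [X in _ * X]distrC; exact: H.
move=> a0 b0; rewrite /Th.
set al := Num.min (a / t) 1; set be := Num.min (b / t) 1.
have al0 : 0 < al by rewrite lt_min divr_gt0//=.
have albe : al <= be.
  by rewrite le_min !ge_min lexx orbT andbT ler_pM2r ?invr_gt0// ab.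
have be1 : be <= 1 by rewrite ge_min lexx orbT.
have h1 := ln_sub_ge al0 albe be1.
have [h2 h3] : 0 <= P6 (1 - al) - P6 (1 - be) /\
    P6 (1 - al) - P6 (1 - be) <= 6 * ((1 - al) - (1 - be)).
  by apply: P6_lip; lra.
have h4 : ln be - ln al <= ln b - ln a.
  have be0 := lt_le_trans al0 albe.
  suff : ln (be / al) <= ln (b / a) by rewrite !ln_div ?posrE.
  rewrite ler_ln ?posrE ?divr_gt0//.
  have [h|h] := leP (a / t) 1; last first.
    have -> : al = 1 by rewrite /al min_r// ltW.
    by rewrite divr1 (le_trans be1)// ler_pdivlMr// mul1r.
  have -> : al = a / t by rewrite /al min_l.
  rewrite ler_pdivrMr ?divr_gt0// mulrA divfK ?gt_eqF//.
  by rewrite ge_min lexx.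
have h5 : ln al <= ln be by rewrite ler_ln ?posrE// (lt_le_trans al0).
have h6 : 0 <= ln b - ln a by apply: le_trans h4; rewrite subr_ge0.
rewrite (ger0_norm h6) ler_norml; apply/andP; split; lra.
Qed.

(** For 0 < s < t the derivative of ln t - P6(1 - s/t) in t is (1 - s/t)^6 / t. The junction t = s
    is settled by the squeeze lemma; at s = 0 the function of t is constant, hence the
    conditional. *)
Lemma is_derive_Th (t s : R) : 0 < t -> 0 <= s ->
  is_derive t 1 (fun t => Th t s) (if 0 < s then t ^- 7 * pp 6 (t - s) else 0).
Proof.
move=> t0; rewrite le_eqVlt => /predU1P[<-|s0].
  by rewrite ltxx; under eq_fun do rewrite Th0; exact: is_derive_cst.
rewrite s0.
pose g (t : R) := ln t - ln s - P6 (1 - s / t).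
have dg (w : R) : 0 < w -> is_derive w 1 g (w ^- 7 * (w - s) ^+ 6).
  move=> w0; have w1 : w != 0 by rewrite gt_eqF.
  have d1 := is_derive1_ln w0.
  have d2 : is_derive w 1 (fun w : R => 1 - s / w) (s * w ^- 2).
    have := is_deriveB (@is_derive_cst _ R R (1 : R) w 1)
      (@is_deriveZ _ _ _ (fun t : R => t ^- 1) s w 1 _ (is_derive_invX 1 w0)).
    congr (is_derive _ _ _ _).
    by rewrite /GRing.scale /=; ring.
  have d3 := is_derive_dircomp d2 (is_derive_P6 _).
  have := is_deriveB (is_deriveB d1 (@is_derive_cst _ R R (ln s) w 1)) d3.
  congr (is_derive _ _ _ _).
  by rewrite !big_ord_recr big_ord0 /=; field.
have [st|ts|st] := ltgtP s t.
- rewrite pp_gt0E; last by rewrite subr_ge0 ltW.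
  apply: (@near_eq_is_derive R R R g); last exact: dg.
  have : \forall y \near t, s < y by exact: lt_nbhsr.
  by apply: filterS => y sy; rewrite Th_in.
- rewrite pp_le0E; last by rewrite subr_le0 ltW.
  rewrite mulr0; apply: (@near_eq_is_derive R R R (cst 0)).
  have n1 : \forall y \near t, y < s by exact: lt_nbhsl.
  have n2 : \forall y \near t, 0 < y by exact: lt_nbhsr.
  by apply: filterS2 n1 n2 => y y1 y2; rewrite Th_out// ltW.
- rewrite st subrr pp_le0E// mulr0; rewrite st in g dg *.
  have gt0 : g t = 0 by rewrite /g divff ?gt_eqF// !subrr P6_0 subr0.
  apply: (@is_derive_squeeze0 R _ g) => //.
  + by rewrite Th_out.
  + have n2 : \forall y \near t, 0 < y by exact: lt_nbhsr.
    apply: filterS n2 => y y0; have [ty|yt] := leP y t.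
      by rewrite Th_out// normr0.
    by rewrite Th_in.
  + by have := dg t t0; rewrite subrr expr0n mulr0.
Qed.

Lemma measurable_Th (t : R) (x : R4) : meas4 (fun y => Th t (sqn (x - y))).
Proof.
have cs : continuous (fun y : R4 => sqn (x - y)).
  move=> y; exact: (@continuous_comp _ _ _ (fun y : R4 => x - y) (@sqn R) y
    (@continuous_subl R x y) (@continuous_sqn R _)).
have ms : meas4 (fun y => Num.min (sqn (x - y) / t) 1).
  apply: measurable_minr; last exact: measurable_cst.
  apply: measurable_funM; last exact: measurable_cst.
  exact: (continuous_meas4 cs).
apply: measurable_funB.
  apply: measurableT_comp => //; exact: (measurableT_comp (@measurable_ln R) ms).
apply: (measurableT_comp (_ : measurable_fun setT P6)).
  apply: continuous_measurable_fun; exact: (is_derive_continuous is_derive_P6).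
by apply: measurable_funB => //; exact: measurable_cst.
Qed.

(** For 0 < |w|^2 < t this is [Th_lip] compared with the point t, where [Th] vanishes; the summand 6
    covers the default value at w = 0. *)
Lemma Th_ell (t : R) (w : R4) : 0 < t ->
  `|Th t (sqn w)| <= 6 * ln (1 + t) + 12 * ell w + 6.
Proof.
move=> t0; have l0 := ell_ge0 w.
have lt0 : 0 <= ln (1 + t) by apply: ln_ge0; rewrite lerDl ltW.
have [->|w0] := eqVneq w 0.
  rewrite -sqr_enorm enorm0 expr0n Th0 normrN.
  have [h1 h2] := @P6_lip 0 1 (lexx 0) ler01 (lexx 1).
  rewrite P6_0 !subr0 in h1 h2; rewrite ger0_norm//.
  by have := ell_ge0 (0 : R4); lra.
have e0 := enorm_gt0 w0; have s0 : 0 < sqn w by rewrite -sqr_enorm exprn_gt0.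
have [st|ts] := ltP (sqn w) t; last first.
  by rewrite Th_out// normr0; lra.
have := Th_lip t0 s0 t0; rewrite (@Th_out t t)// subr0 => /le_trans; apply.
have h : ln (sqn w) <= ln t by rewrite ler_ln ?posrE// ltW.
rewrite ger0_norm ?subr_ge0//.
have h1 : ln t <= ln (1 + t) by rewrite ler_ln ?posrE//; lra.
have h2 : - ln (sqn w) <= 2 * ell w.
  have h3 : - ln (enorm w) <= ell w.
    rewrite /ell -lnV ?posrE// ler_ln ?posrE ?invr_gt0// ?lerDr//.
    by rewrite addr_gt0// invr_gt0.
  rewrite -sqr_enorm lnXn// mulr2n; lra.
lra.
Qed.

End truncated_log.

(** * The representation formula *)

Section representation.
Variable R : realType.
Notation R4 := 'rV[R]_4.

(** The coefficients are solved from [Q_bilaplacian]: as Q 3 and Q 4 have t-derivatives 3 Q 2 and 4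
    Q 3, this is an antiderivative in t of t^-7 Q 6 applied to the bilaplacian. *)
Definition A (t : R) (x : R4) (g : R4 -> R) : R :=
  1920 * t ^- 5 * Q 3 t x g - 3360 * t ^- 6 * Q 4 t x g.

Definition L (t : R) (x : R4) (f : R4 -> R) : R :=
  integral4 (fun y => Th t (sqn (x - y)) * f y).

Lemma integral4_0 : integral4 (fun _ : R4 => 0 : R) = 0.
Proof. exact: (congr1 fine (integral0 (lb4 R) setT)). Qed.

Lemma CkS (k : nat) (f : R4 -> R) : Ck k.+1 f -> Ck k f.
Proof.
elim: k f => [|k IH] f; first by case.
by case=> [cf [df Cf]]; split => //; split => // i; apply: IH; exact: Cf.
Qed.

Lemma Q_bilaplacian (t : R) (x : R4) (u : R4 -> R) : Ck 4 u ->
  Q 6 t x (bilaplacian u) =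
  5760 * t ^+ 2 * Q 2 t x u - 23040 * t * Q 3 t x u + 20160 * Q 4 t x u.
Proof.
move=> Cu; have C2 : Ck 2 u by do 2 apply: CkS.
rewrite /bilaplacian green_qq; last exact: (Ck_laplacian (k := 2)).
rewrite !green_qq//; ring.
Qed.

Lemma is_derive_A (t : R) (x : R4) (u : R4 -> R) : 0 < t -> Ck 4 u ->
  is_derive t 1 (fun t => A t x u) (t ^- 7 * Q 6 t x (bilaplacian u)).
Proof.
move=> t0 Cu; have cu := Ck_continuous Cu.
have d3 := is_derive_Q 1 t x cu.
have d4 := is_derive_Q 2 t x cu.
have i5 := @is_deriveZ _ _ _ (fun t : R => t ^- 5) 1920 t 1 _ (is_derive_invX 5 t0).
have i6 := @is_deriveZ _ _ _ (fun t : R => t ^- 6) 3360 t 1 _ (is_derive_invX 6 t0).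
have := is_deriveB (is_deriveM i5 d3) (is_deriveM i6 d4).
have tn0 : t != 0 by rewrite gt_eqF.
congr (is_derive _ _ _ _); rewrite Q_bilaplacian// /GRing.scale /=.
by rewrite /GRing.scale /=; field.
Qed.

Lemma integrable_Th (t : R) (x : R4) (f : R4 -> R) : 0 < t -> continuous f ->
  integrable4 f -> integrable4 (fun y => Th t (sqn (x - y)) * f y).
Proof.
move=> t0 cf fi.
apply: (@le_integrable4 _ _
  (fun y => (6 * ln (1 + t) + 6) * `|f y| + 12 * (ell (x - y) * `|f y|))).
- by apply: measurable_funM; [exact: measurable_Th|exact: integrable4_meas].
- apply: integrable4D; first exact/integrable4Z/integrable4_norm.
  exact/integrable4Z/integrable_ell.
- move=> y; rewrite normrM.
  rewrite (_ : _ + _ = (6 * ln (1 + t) + 12 * ell (x - y) + 6) * `|f y|); last by ring.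
  by rewrite ler_wpM2r// Th_ell.
Qed.

Lemma is_derive_L (t : R) (x : R4) (f : R4 -> R) : 0 < t -> continuous f ->
  integrable4 f -> is_derive t 1 (fun t => L t x f) (t ^- 7 * Q 6 t x f).
Proof.
move=> t0 cf fi.
(* At y = x the function [Th t 0] is constant in t, so the true derivative there is 0 and not the
   value of the cutoff kernel. The two agree off the null set {x}. *)
pose k (t : R) (y : R4) := (if 0 < sqn (x - y) then t ^- 7 * pp 6 (t - sqn (x - y)) else 0) * f y.
have -> : t ^- 7 * Q 6 t x f = integral4 (k t).
  rewrite /Q -integral4Z; last exact: integrable_qq.
  have mq : meas4 (fun y => t ^- 7 * (qq 6 t x y * f y)).
    apply: integrable4_meas; apply: integrable4Z; exact: integrable_qq.
  apply: (@ae_integral4 _ _ _ x) => //.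
    rewrite /k; apply: measurable_funM; last exact: integrable4_meas.
    have cs : continuous (fun y : R4 => sqn (x - y)).
      move=> y; exact: (@continuous_comp _ _ _ (fun y : R4 => x - y) (@sqn R) y
        (@continuous_subl R x y) (@continuous_sqn R _)).
    apply: measurable_fun_ifT.
    - apply: measurable_fun_ltr; first exact: measurable_cst.
      exact: (continuous_meas4 cs).
    - apply: measurable_funM; first exact: measurable_cst.
      exact: (continuous_meas4 (@continuous_qq R 6 t x)).
    - exact: measurable_cst.
  move=> y yx; rewrite /k ifT; first by rewrite mulrA.
  rewrite -sqr_enorm exprn_gt0// enorm_gt0// subr_eq0 eq_sym //.
(* Between t/2 and 2t the derivative s^-7 max(s - |x - y|^2, 0)^6 is at most 1/s <= 2/t, which gives
   the dominating function. *)
apply: (@is_derive_integral4 _ (fun t y => Th t (sqn (x - y)) * f y) k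
  (fun y => (2 / t) * `|f y|) t (t / 2) (t * 2)).
- by rewrite in_itv /=; apply/andP; split; lra.
- move=> s; rewrite in_itv /= => /andP[s1 s2]; apply: integrable_Th => //; lra.
- move=> s y; rewrite in_itv /= => /andP[s1 s2].
  have s0 : 0 < s by lra.
  have d := is_derive_Th s0 (sqn_ge0 (x - y)).
  have := @is_deriveZ _ _ _ (fun t : R => Th t (sqn (x - y))) (f y) s 1 _ d.
  congr (is_derive _ _ _ _); last by rewrite /GRing.scale /= /k mulrC.
  by apply/funext => v; rewrite /= mulrC.
- exact/integrable4Z/integrable4_norm.
- move=> s y; rewrite in_itv /= => /andP[s1 s2].
  have s0 : 0 < s by lra.
  rewrite normrM ler_wpM2r//; case: ifPn => _; last first.
    by rewrite normr0 mulr_ge0// invr_ge0 ltW.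
  have s7 : 0 <= s ^- 7 by rewrite invr_ge0 exprn_ge0// ltW.
  rewrite ger0_norm; last by rewrite mulr_ge0// pp_ge0.
  have h : pp 6 (s - sqn (x - y)) <= s ^+ 6.
    by apply: pp_le; [rewrite gerBl sqn_ge0|exact: ltW].
  apply: (le_trans (ler_wpM2l s7 h)).
  have -> : s ^- 7 * s ^+ 6 = s^-1 by field; rewrite gt_eqF.
  have -> : 2 / t = (t / 2)^-1 by field; rewrite gt_eqF.
  by rewrite lef_pV2 ?posrE//; lra.
Qed.

Lemma L_sub_A_cst (x : R4) (u : R4 -> R) : Ck 4 u -> continuous (bilaplacian u) ->
  integrable4 (bilaplacian u) ->
  forall s t, 0 < s -> 0 < t ->
  L s x (bilaplacian u) - A s x u = L t x (bilaplacian u) - A t x u.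
Proof.
move=> Cu cf fi; apply: (@cst_on_pos R (fun s => L s x (bilaplacian u) - A s x u)) => t t0.
have := is_deriveB (is_derive_L x t0 cf fi) (is_derive_A x t0 Cu).
by rewrite subrr.
Qed.

Lemma AE (t : R) (x : R4) (g : R4 -> R) : continuous g ->
  A t x g = integral4 (fun y =>
    (1920 * t ^- 5 * qq 3 t x y - 3360 * t ^- 6 * qq 4 t x y) * g y) /\
  integrable4 (fun y =>
    (1920 * t ^- 5 * qq 3 t x y - 3360 * t ^- 6 * qq 4 t x y) * g y).
Proof.
move=> cg; have i3 := @integrable_qq R 2 t x g cg.
have i4 := @integrable_qq R 3 t x g cg.
rewrite /A /Q -(integral4Z _ i3) -(integral4Z _ i4).
rewrite -(integral4B (integrable4Z _ i3) (integrable4Z _ i4)).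
have E : (fun y => (1920 * t ^- 5 * qq 3 t x y - 3360 * t ^- 6 * qq 4 t x y) * g y) =
  (fun y => 1920 * t ^- 5 * (qq 3 t x y * g y) - 3360 * t ^- 6 * (qq 4 t x y * g y)).
  by apply/funext => y; ring.
by rewrite E; split => //; apply: integrable4B; exact: integrable4Z.
Qed.

(** The kernel is at most (1920 + 3360) t^-2 and is supported in a cube of volume 16 t^2, so the
    powers of t cancel. *)
Lemma A_le (t : R) (x : R4) (g : R4 -> R) (C : R) : 0 < t -> continuous g ->
  (forall y : R4, (forall i, `|y 0 i - x 0 i| <= Num.sqrt t) -> `|g y| <= C) ->
  `|A t x g| <= (16 * 5280) * C.
Proof.
move=> t0 cg gC; have [-> ig] := AE t x cg.
have st0 : 0 < Num.sqrt t by rewrite sqrtr_gt0.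
have st2 : Num.sqrt t ^+ 2 = t by rewrite sqr_sqrtr// ltW.
have C0 : 0 <= C by apply: le_trans (gC x _) => // i; rewrite subrr normr0 ltW.
have := @integral4_bnd _ _ x (Num.sqrt t) (5280 * t ^- 2 * C) st0 (integrable4_meas ig).
have -> : 5280 * t ^- 2 * C * (2 * Num.sqrt t) ^+ 4 = (16 * 5280) * C.
  rewrite (_ : (2 * _) ^+ 4 = 16 * (Num.sqrt t ^+ 2) ^+ 2); last by ring.
  by rewrite st2; field; rewrite gt_eqF.
apply.
- move=> y yb; rewrite normrM ler_pM//; last exact: gC.
  have p5 : 0 <= t ^- 5 by rewrite invr_ge0 exprn_ge0// ltW.
  have p6 : 0 <= t ^- 6 by rewrite invr_ge0 exprn_ge0// ltW.
  have q3 := qq_le 3 x y (ltW t0); have q4 := qq_le 4 x y (ltW t0).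
  have q3' := qq_ge0 3 t x y; have q4' := qq_ge0 4 t x y.
  have e3 : t ^- 5 * t ^+ 3 = t ^- 2 by field; rewrite gt_eqF.
  have e4 : t ^- 6 * t ^+ 4 = t ^- 2 by field; rewrite gt_eqF.
  have h3 := ler_wpM2l p5 q3; have h4 := ler_wpM2l p6 q4.
  have h3' := mulr_ge0 p5 q3'; have h4' := mulr_ge0 p6 q4'.
  rewrite e3 in h3; rewrite e4 in h4; rewrite ler_norml -!mulrA; apply/andP; split; lra.
- move=> y yb; rewrite !(@qq_support _ _ _ (Num.sqrt t)) ?st2// ?ltW//.
  by rewrite !mulr0 subr0 mul0r.
Qed.

Lemma A_bound : exists2 K : R, 0 < K & forall (t : R) (x : R4) (g : R4 -> R) (C : R),
  0 < t -> continuous g ->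
  (forall y : R4, (forall i, `|y 0 i - x 0 i| <= Num.sqrt t) -> `|g y| <= C) ->
  `|A t x g| <= K * C.
Proof.
exists (16 * 5280); last exact: A_le.
lra.
Qed.

Lemma bilaplacian_cst (c : R) : bilaplacian (fun _ : R4 => c) = fun=> 0.
Proof.
have h (d : R) : laplacian (fun _ : R4 => d) = fun=> 0.
  apply/funext => x; rewrite /laplacian big1// => i _.
  have -> : partial i (fun=> d) = fun=> 0.
    by apply/funext => y; rewrite /partial derive_cst.
  by rewrite /partial derive_cst.
by rewrite /bilaplacian !h.
Qed.

(** Constants are biharmonic, so the t-derivative given by [is_derive_A] vanishes. *)
Lemma A_cst (t : R) (x : R4) : 0 < t -> A t x (fun=> 1) = A 1 x (fun=> 1).
Proof.
move=> t0.
have dN (s : R) : 0 < s -> is_derive s 1 (fun t => A t x (fun=> 1)) 0.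
  move=> s0; have := is_derive_A x s0 (@Ck_cst R 4 1).
  congr (is_derive _ _ _ _); rewrite bilaplacian_cst /Q.
  by rewrite (eq_integral4 (g := fun=> 0)) ?integral4_0 ?mulr0// => y; rewrite mulr0.
exact: (cst_on_pos dN t0 ltr01).
Qed.

(** The kernels have supports shrinking to x, the same total integral for every t, and a bound whose
    constant is independent of t: up to that total integral they form an approximate identity. *)
Lemma cvg_A (x : R4) (u : R4 -> R) : continuous u ->
  A n.+1%:R^-1 x u @[n --> \oo] --> u x * A 1 x (fun=> 1).
Proof.
move=> cu; have [K K0 KP] := A_bound.
apply/cvgrPdist_le => e e0.
have e1 : 0 < e / K by rewrite divr_gt0.
have [d d0 dP] : exists2 d, 0 < d & forall y : R4,
    (forall i, `|y 0 i - x 0 i| < d) -> `|u y - u x| <= e / K.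
  have /nbhs_ballP[d /= d0 dP] : nbhs x [set y | `|u x - u y| <= e / K].
    by have /cvgrPdist_le := cu x; apply.
  exists d => // y yd; rewrite distrC; apply: dP; split => // i j.
  by rewrite (ord1 i) -ball_normE /= distrC.
have d20 : 0 < d ^+ 2 by rewrite exprn_gt0.
near=> n.
have n0 : 0 < n.+1%:R^-1 :> R by rewrite invr_gt0 ltr0n.
have nd : n.+1%:R^-1 < d ^+ 2 by near: n; exact: (near_infty_natSinv_lt (PosNum d20)).
set t := n.+1%:R^-1 in n0 nd *.
rewrite -(A_cst x n0) distrC.
have c1 : continuous (fun _ : R4 => 1 : R) by exact: cst_continuous.
have [E1 i1] := AE t x cu; have [E2 i2] := AE t x c1.
have -> : A t x u - u x * A t x (fun=> 1) = A t x (fun y => u y - u x).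
  have cd : continuous (fun y => u y - u x) by move=> y; exact: (cvgB (cu y) (cvg_cst _)).
  have [-> _] := AE t x cd.
  rewrite E1 E2 -integral4Z// -integral4B//; last exact: integrable4Z.
  by apply: eq_integral4 => y; ring.
rewrite (_ : e = K * (e / K)); last by (rewrite mulrC divfK ?gt_eqF).
apply: KP => //; first by move=> y; exact: (cvgB (cu y) (cvg_cst _)).
move=> y yt; apply: dP => i; apply: (le_lt_trans (yt i)).
rewrite -(@ltr_pXn2r _ 2) ?nnegrE ?sqrtr_ge0 ?(ltW d0)//.
by rewrite sqr_sqrtr// ltW.
Unshelve. all: by end_near. Qed.

Lemma cvg_L (x : R4) (f : R4 -> R) : continuous f -> integrable4 f ->
  L n.+1%:R^-1 x f @[n --> \oo] --> 0.
Proof.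
move=> cf fi.
have n0 n : 0 < n.+1%:R^-1 :> R by rewrite invr_gt0 ltr0n.
have [] := @dominated_cvg4 R (fun n y => Th n.+1%:R^-1 (sqn (x - y)) * f y) (fun=> 0)
  (fun y => (6 * ln 2 + 6) * `|f y| + 12 * (ell (x - y) * `|f y|)).
- by move=> n; exact: (integrable4_meas (integrable_Th x (n0 n) cf fi)).
- exact: integrable4_meas (integrable4_0 R).
- apply: (ae4S _ (ae_neq x)) => z zx.
  have s0 : 0 < sqn (x - of_coords z).
    by rewrite -sqr_enorm exprn_gt0// enorm_gt0// subr_eq0 eq_sym.
  apply: cvg_near_cst; near=> n; rewrite Th_out ?mul0r//; apply: ltW.
  by near: n; exact: (near_infty_natSinv_lt (PosNum s0)).
- apply: integrable4D; first exact/integrable4Z/integrable4_norm.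
  exact/integrable4Z/integrable_ell.
- apply: aeW => z n; rewrite normrM.
  rewrite (_ : _ + _ = (6 * ln 2 + 12 * ell (x - of_coords z) + 6) * `|f (of_coords z)|); last by ring.
  rewrite ler_wpM2r// (le_trans (Th_ell _ (n0 n)))// lerD2r lerD2r ler_pM2l//.
  have i1 : n.+1%:R^-1 <= 1 :> R by rewrite invf_le1// ler1n.
  have := n0 n; move: i1; generalize (n.+1%:R^-1 : R) => v v1 v0.
  by rewrite ler_ln ?posrE; lra.
by rewrite integral4_0.
Unshelve. all: by end_near. Qed.

(** The difference of [L] and [A] is constant in t, and its value is read off as t tends to 0, where
    [L] disappears and [A] concentrates at x. *)
Lemma L_sub_A (t : R) (x : R4) (u : R4 -> R) : 0 < t -> Ck 4 u ->
  continuous (bilaplacian u) -> integrable4 (bilaplacian u) ->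
  L t x (bilaplacian u) = A t x u - u x * A 1 x (fun=> 1).
Proof.
move=> t0 Cu cf fi.
suff <- : L t x (bilaplacian u) - A t x u = - (u x * A 1 x (fun=> 1)) by rewrite addrC subrK.
have h : (L n.+1%:R^-1 x (bilaplacian u) - A n.+1%:R^-1 x u) @[n --> \oo] -->
    0 - u x * A 1 x (fun=> 1).
  exact: (cvgB (cvg_L x cf fi) (@cvg_A x u (Ck_continuous Cu))).
rewrite sub0r in h; apply: (cvg_unique _ _ h) => //.
apply: cvg_near_cst; apply: nearW => n.
apply: (L_sub_A_cst x Cu cf fi) => //.
Qed.

End representation.

(** * Evaluation of the constant by Gaussian integrals *)

Section constant.
Variable R : realType.
Notation R4 := 'rV[R]_4.
Notation mT := (measurableTypeR R).
Notation lb := (@lebesgue_measure R).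

(** [A] is itself t^2 times a t-derivative, now of a multiple of Q 4 alone, whose kernel is
    nonnegative. With u = 1 this determines the constant; for general u it turns bounds on [A] into
    bounds on averages of u. *)
Lemma is_derive_E (t : R) (x : R4) (u : R4 -> R) : 0 < t -> continuous u ->
  is_derive t 1 (fun t => 480 * t ^- 7 * Q 4 t x u) (t ^- 2 * A t x u).
Proof.
move=> t0 cu.
have d4 := is_derive_Q 2 t x cu.
have i7 := @is_deriveZ _ _ _ (fun t : R => t ^- 7) 480 t 1 _ (is_derive_invX 7 t0).
have := is_deriveM i7 d4.
have tn0 : t != 0 by rewrite gt_eqF.
congr (is_derive _ _ _ _); rewrite /A /GRing.scale /= /GRing.scale /=.
by field.
Qed.

(** By [is_derive_E] the function N(t) = 480 t^-7 Q 4 + c0 / t has derivative 0, because [A] of 1 is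
    the constant c0. Both of its terms are O(1/t), so N vanishes. *)
Lemma Q4_cst (t : R) (x : R4) : 0 < t ->
  480 * Q 4 t x (fun=> 1) = - A 1 x (fun=> 1) * t ^+ 6.
Proof.
set c0 := A 1 x (fun=> 1).
have c1 : continuous (fun _ : R4 => 1 : R) by exact: cst_continuous.
pose N (t : R) := 480 * t ^- 7 * Q 4 t x (fun=> 1) + c0 * t ^- 1.
have dN (s : R) : 0 < s -> is_derive s 1 N 0.
  move=> s0.
  have := is_deriveD (is_derive_E x s0 c1)
    (@is_deriveZ _ _ _ (fun t : R => t ^- 1) c0 s 1 _ (is_derive_invX 1 s0)).
  congr (is_derive _ _ _ _); rewrite (A_cst x s0) -/c0 /GRing.scale /=; ring.
have Nc := cst_on_pos dN.
have Qle (s : R) : 0 < s -> `|480 * s ^- 7 * Q 4 s x (fun=> 1)| <= 480 * 16 * s^-1.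
  move=> s0; have ss0 : 0 < Num.sqrt s by rewrite sqrtr_gt0.
  have ss2 : Num.sqrt s ^+ 2 = s by rewrite sqr_sqrtr// ltW.
  have iq := @integrable_qq R 3 s x _ c1.
  have := @integral4_bnd _ _ x (Num.sqrt s) (s ^+ 4) ss0 (integrable4_meas iq).
  have -> : s ^+ 4 * (2 * Num.sqrt s) ^+ 4 = 16 * s ^+ 6.
    rewrite (_ : (2 * _) ^+ 4 = 16 * (Num.sqrt s ^+ 2) ^+ 2); last by ring.
    by rewrite ss2; ring.
  move=> H; have {H} : `|Q 4 s x (fun=> 1)| <= 16 * s ^+ 6.
    apply: H => y yb.
      by rewrite mulr1 ger0_norm ?qq_ge0// qq_le// ltW.
    by rewrite (@qq_support _ _ _ (Num.sqrt s)) ?ss2// ?mul0r// ltW.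
  have s7 : 0 <= 480 * s ^- 7.
    by apply: mulr_ge0; [lra|rewrite invr_ge0 exprn_ge0// ltW].
  rewrite normrM (ger0_norm s7) => /(ler_wpM2l s7) /le_trans; apply.
  rewrite le_eqVlt; apply/orP; left; apply/eqP; field; rewrite gt_eqF//.
have N0 (s : R) : 0 < s -> N s = 0.
  move=> s0; apply/eqP; rewrite -normr_le0 leNgt; apply/negP => Ns.
  set C := 480 * 16 + `|c0|.
  have C0 : 0 < C by rewrite /C; have := normr_ge0 c0; lra.
  pose T := 2 * C / `|N s|.
  have T0 : 0 < T by apply: divr_gt0 => //; lra.
  have : `|N s| <= C * T^-1.
    rewrite (Nc s T s0 T0) /N (le_trans (ler_normD _ _))// [leRHS]mulrDl; apply: lerD.
      exact: Qle.
    by rewrite normrM expr1 (ger0_norm (x := T^-1))// invr_ge0 ltW.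
  have -> : C * T^-1 = `|N s| / 2 by rewrite /T; field; rewrite !gt_eqF.
  lra.
move=> t0; have := N0 t t0; rewrite /N => h.
have tn0 : t != 0 by rewrite gt_eqF.
have {h} := congr1 (fun v => v * t ^+ 7) h; rewrite mul0r => h.
have E : (480 * t ^- 7 * Q 4 t x (fun=> 1) + c0 * t ^- 1) * t ^+ 7 =
  480 * Q 4 t x (fun=> 1) + c0 * t ^+ 6 by field.
by move: h; rewrite E mulNr => /eqP; rewrite addr_eq0 => /eqP.
Qed.

(** This is n! times the n-th partial sum of the exponential series; -exp(-s) [gpol n s] is an
    antiderivative of exp(-s) s^n. *)
Fixpoint gpol (n : nat) (s : R) : R :=
  if n is m.+1 then s ^+ n + n%:R * gpol m s else 1.

Lemma is_derive_gpol (n : nat) (s : R) : is_derive s 1 (gpol n) (gpol n s - s ^+ n).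
Proof.
elim: n => [|n IH] /=; first by rewrite expr0 subrr; exact: is_derive_cst.
have := is_deriveD (is_derive_expr n.+1 s) (@is_deriveZ _ _ _ (gpol n) n.+1%:R s 1 _ IH).
by congr (is_derive _ _ _ _); rewrite /GRing.scale /=; ring.
Qed.

Lemma gpol0 (n : nat) : gpol n 0 = n`!%:R.
Proof. by elim: n => [|n IH] //=; rewrite expr0n add0r IH factS natrM. Qed.

Lemma cvg_pow_expR (n : nat) : (fun s : R => expR (- s) * s ^+ n) s @[s --> +oo] --> 0.
Proof.
apply/cvgrPdist_le => e e0; near=> s.
have s0 : 0 < s by near: s; exact: nbhs_pinfty_gt.
have h := expR_ge1Dxn n (ltW s0).
have f0 : 0 < n.+1`!%:R :> R by rewrite ltr0n fact_gt0.
have : s ^+ n.+1 <= n.+1`!%:R * expR s.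
  by rewrite -ler_pdivrMl// mulrC (le_trans _ h)// lerDr.
rewrite sub0r normrN ger0_norm; last by rewrite mulr_ge0 ?expR_ge0 ?exprn_ge0 ?ltW.
move=> h2; rewrite expRN -(ler_pM2l (expR_gt0 s)) mulrA mulfV ?gt_eqF ?expR_gt0// mul1r.
rewrite -(ler_pM2l s0) -exprS (le_trans h2)// mulrA mulrAC ler_pM2r ?expR_gt0//.
rewrite -ler_pdivrMr//; near: s; exact: nbhs_pinfty_ge.
Unshelve. all: by end_near. Qed.

Lemma cvg_gpol (n : nat) : (fun s : R => expR (- s) * gpol n s) s @[s --> +oo] --> 0.
Proof.
elim: n => [|n IH] /=.
  by have := cvg_pow_expR 0; under eq_fun do rewrite expr0.
have -> : (fun s : R => expR (- s) * (s ^+ n.+1 + n.+1%:R * gpol n s)) =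
    (fun s => expR (- s) * s ^+ n.+1 + n.+1%:R * (expR (- s) * gpol n s)).
  by apply/funext => s /=; rewrite mulrDr [X in _ + X]mulrCA.
have := cvgD (cvg_pow_expR n.+1) (cvgM (cvg_cst (n.+1%:R : R)) IH).
rewrite mulr0 addr0; apply; exact: _.
Qed.

Lemma integral_pp_exp (n : nat) (s : R) :
  (\int[lb]_t (expR (- t) * pp n.+1 (t - s))%:E = (expR (- s) * n.+1`!%:R)%:E)%E.
Proof.
have dsub (t : R) : is_derive t 1 (fun t => t - s) 1.
  have := is_deriveB (@is_derive_id _ _ t 1) (@is_derive_cst _ R R s t 1).
  by rewrite subr0.
have dexp (t : R) : is_derive t 1 (fun t => - expR (- t)) (expR (- t)).
  have := is_deriveN (is_derive_dircomp (is_deriveN (@is_derive_id _ _ t 1)) (is_derive_expR _)).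
  by rewrite mulrN1 opprK.
pose F (t : R) := - expR (- t) * gpol n.+1 (t - s).
have dF (t : R) : is_derive t 1 F (expR (- t) * (t - s) ^+ n.+1).
  have := is_deriveM (dexp t) (is_derive_dircomp (dsub t) (is_derive_gpol n.+1 (t - s))).
  by congr (is_derive _ _ _ _); rewrite /GRing.scale /= /F; ring.
have cf : continuous (fun t : R => expR (- t) * (t - s) ^+ n.+1).
  move=> t; apply: cvgM.
    by apply: (@continuous_comp _ _ _ -%R expR); [exact: opp_continuous|exact: continuous_expR].
  apply: (@continuous_comp _ _ _ (fun t => t - s) (fun v : R => v ^+ n.+1)).
    exact: (cvgB (@cvg_id _ _) (cvg_cst _)).
  exact: exprn_continuous.
have FE : F = (fun t => - expR (- s) * (fun v : R => expR (- v) * gpol n.+1 v) (t - s)).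
  apply/funext => t; rewrite /F /= mulrA; congr (_ * _).
  by rewrite mulNr -expRD; congr (- expR _); ring.
have -> : (\int[lb]_t (expR (- t) * pp n.+1 (t - s))%:E =
    \int[lb]_(t in `[s, +oo[) (expR (- t) * (t - s) ^+ n.+1)%:E)%E.
  rewrite [RHS]integral_mkcond; apply: eq_integral => t _.
  rewrite patchE; case: ifPn => [|/negP h].
    by rewrite inE /= in_itv /= andbT => st; rewrite pp_gt0E// subr_ge0.
  rewrite pp_le0E ?mulr0// subr_le0 leNgt; apply/negP => ts; apply: h.
  by rewrite inE /= in_itv /= andbT ltW.
rewrite (@ge0_continuous_FTC2y _ _ F _ 0).
- by rewrite /F subrr gpol0 -EFinB sub0r mulNr opprK.
- by move=> t st; rewrite mulr_ge0 ?expR_ge0// exprn_ge0// subr_ge0.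
- exact: continuous_subspaceT.
- rewrite FE -[X in _ --> X](mulr0 (- expR (- s))); apply: cvgM; first exact: cvg_cst.
  apply: (@cvg_comp _ _ _ (fun t : R => t - s) _ _ _ _ _ (@cvg_gpol n.+1)).
  exact: cvg_addrr.
- by move=> t _; have [] := dF t.
- by apply: cvg_at_right_filter; exact: (is_derive_continuous dF).
- by move=> t _; rewrite derive1E; have [_ ->] := dF t.
Qed.

Lemma integral_gauss_shift (c : R) :
  (\int[lb]_s (expR (- (c - s) ^+ 2))%:E = (Num.sqrt pi)%:E)%E.
Proof.
have dF (s : R) : is_derive s 1 (fun s => s - c) 1.
  have := is_deriveB (@is_derive_id _ _ s 1) (@is_derive_cst _ R R c s 1).
  by rewrite subr0.
have F1 : derive1 (fun s : R => s - c) = fun _ : R => 1 : R.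
  by apply/funext => s; rewrite derive1E; have [_ ->] := dF s.
have := @increasing_ge0_integration_by_substitutionT R (fun s => s - c) (@gauss_fun R).
rewrite F1 integralT_gauss => ->//.
- apply: eq_integral => s _; rewrite fctE /= mulr1 /gauss_fun; congr (expR _)%:E.
  by rewrite -sqrrN opprB.
- by move=> a b ab; rewrite ltrD2r.
- by move=> s; exact: cvg_cst.
- exact: is_cvg_cst.
- exact: is_cvg_cst.
- exact: cvg_addrr_Ny.
- exact: cvg_addrr.
- exact: continuous_gauss_fun.
- by move=> s; exact: gauss_fun_ge0.
Qed.

(** The function exp(-t) max(t - |x - y|^2, 0)^4 is integrated in both orders. Integrating t first
    leaves 4! exp(-|x - y|^2), hence 24 pi^2; integrating y first leaves exp(-t) times -c0 t^6 / 480
    by [Q4_cst], hence -c0 * 6! / 480. *)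
Lemma A_cstE (x : R4) : A 1 x (fun=> 1) = - (16 * pi ^+ 2).
Proof.
set c0 := A 1 x (fun=> 1).
have c1 : continuous (fun _ : R4 => 1 : R) by exact: cst_continuous.
have G4 : (\int[lb4 R]_z (expR (- sqn (x - of_coords z)))%:E = (pi ^+ 2)%:E)%E.
  have E z : expR (- sqn (x - of_coords z)) =
      \prod_(i < 4) expR (- (x 0 i - (of_coords z : R4) 0 i) ^+ 2).
    rewrite -expR_sum /sqn sumrN; congr (expR (- _)).
    by apply: eq_bigr => i _; rewrite !mxE.
  under eq_integral do rewrite E.
  rewrite (@integral4_prod R (fun i s => expR (- (x 0 i - s) ^+ 2))).
  - under eq_bigr do rewrite integral_gauss_shift.
    rewrite prodEFin prodr_const card_ord; congr EFin.
    by rewrite (exprM _ 2 2) sqr_sqrtr// pi_ge0.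
  - move=> i; apply: continuous_measurable_fun => s.
    apply: (@continuous_comp _ _ _ (fun s => - (x 0 i - s) ^+ 2) expR); last exact: continuous_expR.
    apply: cvgN; apply: (@continuous_comp _ _ _ (fun s => x 0 i - s) (fun v : R => v ^+ 2)).
      exact: (cvgB (cvg_cst _) (@cvg_id _ _)).
    exact: exprn_continuous.
  - by move=> i s; exact: expR_ge0.
have cs : continuous (fun y : R4 => sqn (x - y)).
  move=> y; exact: (@continuous_comp _ _ _ (fun y : R4 => x - y) (@sqn R) y
    (@continuous_subl R x y) (@continuous_sqn R _)).
have mexp : measurable_fun (setT : set mT) (fun t : mT => expR (- t)).
  apply: continuous_measurable_fun => t.
  by apply: (@continuous_comp _ _ _ -%R expR); [exact: opp_continuous|exact: continuous_expR].
have mpp j : measurable_fun (setT : set R) (@pp R j).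
  by apply: continuous_measurable_fun; exact: continuous_pp.
pose f (z : mT * ((mT * mT) * (mT * mT))) : \bar R :=
  (expR (- z.1) * pp 4 (z.1 - sqn (x - of_coords z.2)))%:E.
have mf : measurable_fun setT f.
  apply/measurable_EFinP; apply: measurable_funM.
    exact: (measurableT_comp mexp measurable_fst).
  apply: (measurableT_comp (mpp 4)).
  apply: measurable_funB; first exact: measurable_fst.
  exact: (measurableT_comp (continuous_meas4 cs) measurable_snd).
have f0 z : (0 <= f z)%E by rewrite lee_fin mulr_ge0 ?expR_ge0 ?pp_ge0.
have := @fubini_tonelli _ _ _ _ R lb (lb4 R) f mf f0.
rewrite /fubini_F /fubini_G /f /=.
under [X in _ = X -> _]eq_integral do rewrite integral_pp_exp.
have -> : (\int[lb4 R]_z (expR (- sqn (x - of_coords z)) * 4`!%:R)%:E = (24 * pi ^+ 2)%:E)%E.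
  under eq_integral do rewrite EFinM.
  rewrite ge0_integralZr//.
  - by rewrite G4 -EFinM mulrC.
  - by apply/measurable_EFinP; exact: (measurableT_comp mexp (continuous_meas4 cs)).
have iq t := @integrable_qq R 3 t x _ c1.
have inner t : (\int[lb4 R]_z (expR (- t) * pp 4 (t - sqn (x - of_coords z)))%:E =
    (- c0 / 480)%:E * (expR (- t) * pp 6 (t - 0))%:E)%E.
  rewrite subr0; have [t0|t0] := leP t 0.
    rewrite (pp_le0E 5 t0) mulr0 mule0.
    under eq_integral => z _.
      rewrite pp_le0E ?mulr0; last by have := sqn_ge0 (x - of_coords z); lra.
      over.
    exact: (integral0 (lb4 R) setT).
  have -> : (\int[lb4 R]_z (expR (- t) * pp 4 (t - sqn (x - of_coords z)))%:E =
     (expR (- t))%:E * (Q 4 t x (fun=> 1))%:E)%E.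
    rewrite /Q /integral4 fineK; last exact: (integrable_fin_num (mu := lb4 R) measurableT (iq t)).
    rewrite -(integralZl (mu := lb4 R) measurableT (iq t)).
    by apply: eq_integral => z _; rewrite mulr1 EFinM.
  rewrite -!EFinM; congr EFin; rewrite pp_gt0E; last exact: ltW.
  have h := Q4_cst x t0; rewrite -/c0 in h.
  have -> : Q 4 t x (fun=> 1) = - c0 * t ^+ 6 / 480 by rewrite -h; field.
  by field.
under eq_integral do rewrite inner.
have m6 : measurable_fun (setT : set mT) (fun t : mT => expR (- t) * pp 6 (t - 0)).
  apply: measurable_funM.
    exact: mexp.
  apply: (measurableT_comp (mpp 6)).
  exact: measurable_funB.
have i6 : lb.-integrable setT (EFin \o (fun t => expR (- t) * pp 6 (t - 0))).
  apply/integrableP; split; first exact/measurable_EFinP.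
  apply: (@le_lt_trans _ _ (\int[lb]_t (expR (- t) * pp 6 (t - 0))%:E)%E).
    rewrite le_eqVlt; apply/orP; left; apply/eqP.
    by apply: eq_integral => t _ /=; rewrite ger0_norm// mulr_ge0 ?expR_ge0 ?pp_ge0.
  by rewrite integral_pp_exp ltry.
rewrite (integralZl (mu := lb) measurableT i6) integral_pp_exp -EFinM => h'.
have {h'} h := congr1 fine h'; rewrite /= oppr0 expR0 mul1r in h.
have h720 : 6`!%:R = 720 :> R by [].
have : - c0 / 480 * 720 = 24 * pi ^+ 2 by rewrite -h720.
lra.
Qed.

End constant.

(** * Growth of the averages of u *)

Section growth.
Variable R : realType.
Notation R4 := 'rV[R]_4.

Lemma L_rep (t : R) (x : R4) (u : R4 -> R) : 0 < t -> Ck 4 u ->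
  integrable4 (bilaplacian u) ->
  L t x (bilaplacian u) = A t x u + 16 * pi ^+ 2 * u x.
Proof.
move=> t0 Cu fi; rewrite L_sub_A// ?A_cstE; first by ring.
exact: Ck_continuous (Ck_laplacian (k := 0) (Ck_laplacian (k := 2) Cu)).
Qed.

Lemma bilaplacian_continuous (u : R4 -> R) : Ck 4 u -> continuous (bilaplacian u).
Proof.
by move=> Cu; exact: Ck_continuous (Ck_laplacian (k := 0) (Ck_laplacian (k := 2) Cu)).
Qed.

Lemma L_log_growth (f : R4 -> R) : continuous f -> integrable4 f ->
  exists2 C, 0 <= C & forall t, 1 <= t -> `|L t 0 f| <= C * (1 + ln t).
Proof.
move=> cf fi.
set I1 := integral4 (fun y => `|f y|); set I2 := integral4 (fun y => ell (0 - y) * `|f y|).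
have i1 := integrable4_norm fi; have i2 := integrable_ell 0 cf fi.
have I10 : 0 <= I1 by apply: integral4_ge0.
have I20 : 0 <= I2 by apply: integral4_ge0 => y; rewrite mulr_ge0// ell_ge0.
exists (12 * I1 + 12 * I2); first by rewrite addr_ge0 ?mulr_ge0.
move=> t t1; have t0 : 0 < t by lra.
have lt0 : 0 <= ln t by apply: ln_ge0.
have l1t : ln (1 + t) <= 1 + ln t.
  have h : ln (1 + t) <= ln (2 * t) by rewrite ler_ln ?posrE; lra.
  rewrite (le_trans h)// lnM ?posrE// lerD2r.
  by have := @ln_pow2_le R 1; rewrite expr1.
rewrite /L (le_trans (le_normr_integral4 (integrable_Th 0 t0 cf fi)))//.
apply: (@le_trans _ _ (integral4 (fun y : R4 => (6 * (1 + ln t) + 6) * `|f y| + 12 * (ell (0 - y) * `|f y|)))).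
  apply: le_integral4; first exact/integrable4_norm/integrable_Th.
    by apply: integrable4D; exact: integrable4Z.
  move=> y; rewrite normrM mulrA -mulrDl ler_wpM2r//.
  have := Th_ell (0 - y) t0; lra.
rewrite integral4D ?integral4Z//; try exact: integrable4Z.
rewrite -/I1 -/I2; nra.
Qed.

(** The representation at 0 and the logarithmic growth of [L] give A >= -B (1 + ln t). Divided by
    t^2 this lower bound is integrable at infinity, so the antiderivative E of t^-2 A cannot tend to
    -oo. *)
Lemma E_lower_bound (u : R4 -> R) : Ck 4 u -> integrable4 (bilaplacian u) ->
  exists C, forall t, 1 <= t -> - C <= 480 * t ^- 7 * Q 4 t 0 u.
Proof.
move=> Cu fi; have cu := Ck_continuous Cu.
have [C0 C00 C0P] := L_log_growth (bilaplacian_continuous Cu) fi.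
set B := C0 + `|16 * pi ^+ 2 * u 0|.
have B0 : 0 <= B by rewrite addr_ge0.
pose E (t : R) := 480 * t ^- 7 * Q 4 t 0 u.
(* The derivative of (ln t + 2)/t is -(1 + ln t)/t^2, exactly what makes N nondecreasing on t >=
   1. *)
pose N (t : R) := E t - B * ((ln t + 2) * t ^- 1).
pose dNf (t : R) := t ^- 2 * A t 0 u + B * ((1 + ln t) * t ^- 2).
have dN (t : R) : 0 < t -> is_derive t 1 N (dNf t).
  move=> t0; have dE := is_derive_E 0 t0 cu.
  have d2 := is_deriveD (is_derive1_ln t0) (@is_derive_cst _ R R 2 t 1).
  have d3 := @is_deriveZ _ _ _ _ B t 1 _ (is_deriveM d2 (is_derive_invX 1 t0)).
  have := is_deriveB dE d3.
  have tn0 : t != 0 by rewrite gt_eqF.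
  by congr (is_derive _ _ _ _); rewrite /dNf addrfctE /GRing.scale /= /cst; field.
exists (`|E 1| + 2 * B) => t t1.
have t0 : 0 < t by lra.
have lt0 : 0 <= ln t by apply: ln_ge0.
have [->|tn1] := eqVneq t 1.
  by rewrite -/(E 1); have := ler_norm (- E 1); rewrite normrN; lra.
have t1' : 1 < t by rewrite lt_neqAle eq_sym tn1.
have [| |c] := @MVT R N dNf 1 t t1'.
- by move=> c; rewrite in_itv /= => /andP[c1 _]; apply: dN; exact: lt_trans c1.
- apply: derivable_within_continuous => c; rewrite in_itv /= => /andP[c1 _].
  by have [] := dN c (lt_le_trans ltr01 c1).
rewrite in_itv /= => /andP[c1 ct] Nt.
have c0 : 0 < c := lt_trans ltr01 c1.
have c2 : 0 <= c ^- 2 by rewrite invr_ge0 exprn_ge0// ltW.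
have lc0 : 0 <= ln c by apply: ln_ge0; exact: ltW.
have hA : - (B * (1 + ln c)) <= A c 0 u.
  have := C0P c (ltW c1); rewrite (L_rep 0 c0 Cu fi).
  have := ler_norm (16 * pi ^+ 2 * u 0).
  move: B0; rewrite /B; set v := 16 * pi ^+ 2 * u 0 => B0 hv.
  rewrite ler_norml => /andP[h1 h2].
  by have := normr_ge0 v; nra.
have : 0 <= N t - N 1.
  rewrite Nt mulr_ge0//; last lra.
  have -> : dNf c = c ^- 2 * (A c 0 u + B * (1 + ln c)) by rewrite /dNf; ring.
  by rewrite mulr_ge0//; lra.
rewrite /N ln1 expr1 invr1 mulr1 add0r -/(E t) => h.
have : 0 <= B * ((ln t + 2) * t ^- 1).
  by rewrite mulr_ge0// mulr_ge0 ?addr_ge0// invr_ge0 ltW.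
have := ler_norm (- E 1); rewrite normrN; lra.
Qed.

Lemma expR_ge_self (v : R) : Num.max v 0 <= expR (4 * v).
Proof.
have h := expR_ge1Dx (4 * v); have := expR_ge0 (4 * v).
rewrite /Num.max; case: ltP; lra.
Qed.

(** Write |u| = 2 max(u, 0) - u. The positive part is at most e^{4u}, which contributes t^4, and the
    term -u is bounded by [E_lower_bound], which contributes t^7. *)
Lemma Q4_norm_growth (u : R4 -> R) : Ck 4 u -> integrable4 (bilaplacian u) ->
  integrable4 (fun y => expR (4 * u y)) ->
  exists2 C, 0 <= C & forall t, 1 <= t -> Q 4 t 0 (fun y => `|u y|) <= C * t ^+ 7.
Proof.
move=> Cu fi ei; have cu := Ck_continuous Cu.
have [C1 C1P] := E_lower_bound Cu fi.
set I := integral4 (fun y => expR (4 * u y)).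
have I0 : 0 <= I by apply: integral4_ge0 => y; exact: expR_ge0.
exists (2 * I + `|C1|); first by rewrite addr_ge0// mulr_ge0.
move=> t t1; have t0 : 0 < t by lra.
have cp : continuous (fun y => Num.max (u y) 0).
  rewrite (_ : (fun y => _) = (fun y => pp 1 (u y))) => [y|]; last first.
    by apply/funext => y; rewrite /pp expr1.
  exact: (@continuous_comp _ _ _ u (@pp R 1) y (cu y) (@continuous_pp R 1 _)).
have ip := @integrable_qq R 3 t 0 _ cp; have iu := @integrable_qq R 3 t 0 _ cu.
have -> : Q 4 t 0 (fun y => `|u y|) = 2 * Q 4 t 0 (fun y => Num.max (u y) 0) - Q 4 t 0 u.
  rewrite /Q -integral4Z// -integral4B//; last exact: integrable4Z.
  apply: eq_integral4 => y; rewrite /Num.max; case: ltP => h.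
    by rewrite ltr0_norm//; ring.
  by rewrite ger0_norm//; ring.
have h1 : Q 4 t 0 (fun y => Num.max (u y) 0) <= t ^+ 4 * I.
  rewrite /Q /I -integral4Z//; apply: le_integral4 => //; first exact: integrable4Z.
  move=> y; apply: ler_pM; rewrite ?qq_ge0 ?le_max ?lexx ?orbT//.
    by apply: qq_le; exact: ltW.
  exact: expR_ge_self.
have h2 : - Q 4 t 0 u <= `|C1| * t ^+ 7.
  have h := C1P t t1.
  have t7 : 0 < t ^+ 7 by rewrite exprn_gt0.
  have h3 := ler_wpM2r (ltW t7) h.
  have e : 480 * t ^- 7 * Q 4 t 0 u * t ^+ 7 = 480 * Q 4 t 0 u by field; rewrite gt_eqF.
  rewrite e in h3; have h4 := ler_wpM2r (ltW t7) (ler_norm C1).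
  have := mulr_ge0 (normr_ge0 C1) (ltW t7); lra.
have h5 : t ^+ 4 <= t ^+ 7 by apply: ler_weXn2l.
have := ler_wpM2l I0 h5; lra.
Qed.

End growth.

(** * Convergence to the logarithmic potential *)

Section log_potential.
Variable R : realType.
Notation R4 := 'rV[R]_4.

Definition V (f : R4 -> R) (x : R4) : R :=
  integral4 (fun y => ln (enorm y / enorm (x - y)) * f y).

Lemma measurable_log_kernel (x : R4) : meas4 (fun y => ln (enorm y / enorm (x - y))).
Proof.
apply: (measurableT_comp (@measurable_ln R)); apply: measurable_funM.
  have := measurable_enorm (0 : R4); rewrite /meas4.
  by under eq_fun do rewrite sub0r enormN.
apply: measurable_inv_nneg; first exact: measurable_enorm.
by move=> z; exact: enorm_ge0.
Qed.

Lemma integrable_log_kernel (x : R4) (f : R4 -> R) : continuous f -> integrable4 f ->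
  integrable4 (fun y => (ln (1 + enorm x) + ell y + ell (x - y)) * `|f y|) /\
  integrable4 (fun y => ln (enorm y / enorm (x - y)) * f y).
Proof.
move=> cf fi.
have i1 := integrable4_norm fi; have i2 := integrable_ell 0 cf fi.
have i3 := integrable_ell x cf fi.
have I : integrable4 (fun y => (ln (1 + enorm x) + ell y + ell (x - y)) * `|f y|).
  apply: integrable4_eq (integrable4D (integrable4Z (ln (1 + enorm x)) i1) (integrable4D i2 i3)).
  by move=> y; rewrite sub0r /ell enormN; ring.
split => //; apply: (le_integrable4 _ I).
  by apply: measurable_funM; [exact: measurable_log_kernel|exact: integrable4_meas].
by move=> y; rewrite normrM ler_wpM2r// log_kernel_le.
Qed.

(** The truncation parameters run through squares, so that the associated radii are the integers n +
    1 and the remainder estimate, stated for t^2, applies without square roots. *)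
Definition Tn (n : nat) : R := n.+1%:R ^+ 2.

Lemma Tn_gt0 n : 0 < Tn n. Proof. by rewrite exprn_gt0// ltr0n. Qed.

Lemma cvg_invTn (s : R) : s / Tn n @[n --> \oo] --> 0.
Proof.
have h : n.+1%:R^-1 @[n --> \oo] --> (0 : R) by exact: cvg_harmonic.
have := cvgM (cvgM h h) (cvg_cst s); rewrite mulr0 mul0r.
rewrite (_ : (fun n => s / Tn n) = (fun n : nat => n.+1%:R^-1 * n.+1%:R^-1 * s)) => [H|]; last first.
  by apply/funext => n; rewrite /Tn expr2 invfM mulrC.
apply: H; exact: _.
Qed.

Lemma near_Tn (s : R) : \forall n \near \oo, s < Tn n.
Proof.
have [s0|s0] := leP s 0; first by apply: nearW => n; exact: (le_lt_trans s0 (Tn_gt0 n)).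
have /cvgrPdist_lt /(_ _ ltr01) := cvg_invTn s; apply: filterS => n.
rewrite sub0r normrN ger0_norm ?divr_ge0 ?(ltW s0) ?(ltW (Tn_gt0 n))//.
by rewrite ltr_pdivrMr ?Tn_gt0// mul1r.
Qed.

Lemma cvg_P6 (s : R) : P6 (1 - s / Tn n) @[n --> \oo] --> P6 1.
Proof.
have h : (1 - s / Tn n) @[n --> \oo] --> (1 - 0 : R).
  exact: (cvgB (cvg_cst _) (cvg_invTn s)).
rewrite subr0 in h.
have c : P6 s' @[s' --> (1 : R)] --> P6 1 by exact: (is_derive_continuous (@is_derive_P6 R)).
exact: (@cvg_comp _ _ _ (fun n => 1 - s / Tn n) (@P6 R) \oo (nbhs (1 : R)) _ h c).
Qed.

(** Neither term converges in general, since each contains ln t times the integral of f; in the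
    difference ln t cancels and the two [P6] terms have the same limit. The factor 2 comes from the
    squared norms, and [Th_lip] supplies the domination. *)
Lemma cvg_L_sub (x : R4) (f : R4 -> R) : continuous f -> integrable4 f ->
  L (Tn n) x f - L (Tn n) 0 f @[n --> \oo] --> 2 * V f x.
Proof.
move=> cf fi.
have iL n y : integrable4 (fun z => Th (Tn n) (sqn (y - z)) * f z).
  exact: integrable_Th (Tn_gt0 n) cf fi.
have [iG iV] := integrable_log_kernel x cf fi.
pose g n y := Th (Tn n) (sqn (x - y)) * f y - Th (Tn n) (sqn (0 - y)) * f y.
have gE : (fun n => L (Tn n) x f - L (Tn n) 0 f) = (fun n => integral4 (g n)).
  by apply/funext => n; rewrite /g integral4B.
rewrite gE /V -integral4Z//.
have ae2 := ae4I (ae_neq x) (ae_neq (0 : R4)).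
have pos (z : R4) : z != x -> z != 0 -> 0 < sqn (x - z) /\ 0 < sqn (0 - z).
  move=> zx z0; split; rewrite -sqr_enorm exprn_gt0// enorm_gt0//.
    by rewrite subr_eq0 eq_sym.
  by rewrite sub0r oppr_eq0.
have lnE (z : R4) : z != x -> z != 0 ->
   ln (sqn (0 - z)) - ln (sqn (x - z)) = 2 * ln (enorm z / enorm (x - z)).
  move=> zx z0; have z1 := enorm_gt0 z0.
  have z2 : 0 < enorm (x - z) by rewrite enorm_gt0// subr_eq0 eq_sym.
  rewrite -!sqr_enorm sub0r enormN !lnXn// ln_div ?posrE// mulr2n; lra.
have [] := @dominated_cvg4 R g (fun y => 2 * (ln (enorm y / enorm (x - y)) * f y))
  (fun y => 12 * ((ln (1 + enorm x) + ell y + ell (x - y)) * `|f y|)) => //.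
- by move=> n; exact: (integrable4_meas (integrable4B (iL n x) (iL n 0))).
- exact: (integrable4_meas (integrable4Z 2 iV)).
- apply: (ae4S _ ae2) => z [zx z0]; have [s1 s2] := pos _ zx z0.
  set y := (of_coords z : R4) in zx z0 s1 s2 *.
  have h : (ln (sqn (0 - y)) - ln (sqn (x - y)) - (P6 (1 - sqn (x - y) / Tn n) -
      P6 (1 - sqn (0 - y) / Tn n))) * f y @[n --> \oo] -->
      (ln (sqn (0 - y)) - ln (sqn (x - y)) - (P6 1 - P6 1)) * f y.
    apply: cvgM; last exact: cvg_cst.
    exact: (cvgB (cvg_cst _) (cvgB (cvg_P6 _) (cvg_P6 _))).
  rewrite subrr subr0 lnE// -mulrA in h.
  apply: cvg_trans h; apply: near_eq_cvg.
  have n1 := near_Tn (sqn (x - y)); have n2 := near_Tn (sqn (0 - y)).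
  by apply: filterS2 n1 n2 => n h1 h2; rewrite /g !Th_in// -lnE//; ring.
- exact: integrable4Z.
- apply: (ae4S _ ae2) => z [zx z0] n; have [s1 s2] := pos _ zx z0.
  rewrite /g -mulrBl normrM mulrA; apply: ler_wpM2r => //.
  apply: (le_trans (Th_lip (Tn_gt0 n) s1 s2)).
  rewrite lnE// normrM ger0_norm// mulrA.
  have := @log_kernel_le R (enorm x) x (of_coords z) (lexx _); lra.
Qed.

Lemma cvg_A_sub (x : R4) (u : R4 -> R) : Ck 4 u -> integrable4 (bilaplacian u) ->
  A (Tn n) x u - A (Tn n) 0 u @[n --> \oo] -->
  2 * V (bilaplacian u) x - 16 * pi ^+ 2 * (u x - u 0).
Proof.
move=> Cu fi; have cf := bilaplacian_continuous Cu.
have := cvgB (@cvg_L_sub x _ cf fi) (cvg_cst (16 * pi ^+ 2 * (u x - u 0))).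
have E n : L (Tn n) x (bilaplacian u) - L (Tn n) 0 (bilaplacian u) -
    16 * pi ^+ 2 * (u x - u 0) = A (Tn n) x u - A (Tn n) 0 u.
  by rewrite !(L_rep _ (Tn_gt0 n) Cu fi); ring.
rewrite -(funext E) => H; apply: H; exact: _.
Qed.

End log_potential.

(** * Second order Taylor expansion of truncated powers *)

Section taylor.
Variable R : realType.
Notation R4 := 'rV[R]_4.

(** The second derivative of max(a, 0)^3 is 6 max(a, 0), which is 6-Lipschitz, so the remainder is
    at most 6 |d|^3 / 3!. The proof goes through the signs of a and a + d instead. *)
Lemma pp3_taylor (a d : R) :
  `|pp 3 (a + d) - (pp 3 a + 3 * pp 2 a * d + 3 * pp 1 a * d ^+ 2)| <= `|d| ^+ 3.
Proof.
have [a0|a0] := leP 0 a; have [s0|s0] := leP 0 (a + d).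
- rewrite !pp_gt0E// -normrX (_ : _ - _ = d ^+ 3)//; ring.
- rewrite (pp_le0E 2 (ltW s0)) !pp_gt0E// -normrX.
  have -> : 0 - (a ^+ 3 + 3 * a ^+ 2 * d + 3 * a ^+ 1 * d ^+ 2) = - ((a + d) ^+ 3 - d ^+ 3) by ring.
  have d0 : d < 0 by lra.
  have h1 : (a + d) ^+ 3 <= 0 by rewrite exprSr mulr_ge0_le0 ?sqr_ge0// ltW.
  have h2 : d ^+ 3 <= (a + d) ^+ 3.
    rewrite -subr_ge0 (_ : _ - _ = a * (a ^+ 2 + 3 * a * d + 3 * d ^+ 2)); last by ring.
    by apply: mulr_ge0 => //; nra.
  rewrite normrN ger0_norm ?subr_ge0// ler0_norm ?(le_trans h2)//; lra.
- rewrite !(pp_le0E _ (ltW a0)) pp_gt0E// !mulr0 !mul0r !addr0 subr0 ger0_norm ?exprn_ge0//.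
  apply: lerXn2r; rewrite ?nnegrE//; have := ler_norm d; lra.
- by rewrite !pp_le0E ?(ltW a0) ?(ltW s0)// !mulr0 !mul0r !addr0 subrr normr0 exprn_ge0.
Qed.

Lemma pp4_taylor (a d : R) :
  `|pp 4 (a + d) - (pp 4 a + 4 * pp 3 a * d + 6 * pp 2 a * d ^+ 2)| <=
  `|d| ^+ 3 * (4 * `|a| + 2 * `|d|).
Proof.
have ad := mulr_ge0 (normr_ge0 a) (exprn_ge0 3 (normr_ge0 d)).
have d4 := exprn_ge0 4 (normr_ge0 d).
have E : `|d| ^+ 3 * (4 * `|a| + 2 * `|d|) = 4 * (`|a| * `|d| ^+ 3) + 2 * `|d| ^+ 4 by ring.
rewrite E -normrX.
have [a0|a0] := leP 0 a; have [s0|s0] := leP 0 (a + d).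
- rewrite !pp_gt0E//.
  have -> : (a + d) ^+ 4 - (a ^+ 4 + 4 * a ^+ 3 * d + 6 * a ^+ 2 * d ^+ 2) =
     4 * (a * d ^+ 3) + d ^+ 4 by ring.
  rewrite (le_trans (ler_normD _ _))// normrM (normrM a) -!normrX.
  rewrite (ger0_norm (_ : 0 <= 4))// in d4 *.
  by move: d4; rewrite -normrX; set v := `|d ^+ 4|; lra.
- rewrite (pp_le0E 3 (ltW s0)) !pp_gt0E//.
  have -> : 0 - (a ^+ 4 + 4 * a ^+ 3 * d + 6 * a ^+ 2 * d ^+ 2) =
    4 * (a * d ^+ 3) + d ^+ 4 - (a + d) ^+ 4 by ring.
  have h : `|a + d| ^+ 4 <= `|d| ^+ 4.
    by apply: lerXn2r; rewrite ?nnegrE// ltr0_norm// ltr0_norm; lra.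
  rewrite (le_trans (ler_normB _ _))// (le_trans (lerD (ler_normD _ _) (lexx _)))//.
  rewrite normrM (normrM a) -!normrX in h *; rewrite (ger0_norm (_ : 0 <= 4))//.
  rewrite !normrX in h *; lra.
- rewrite !(pp_le0E _ (ltW a0)) pp_gt0E// !mulr0 !mul0r !addr0 subr0 ger0_norm ?exprn_ge0//.
  have : (a + d) ^+ 4 <= `|d| ^+ 4.
    by apply: lerXn2r; rewrite ?nnegrE//; have := ler_norm d; lra.
  rewrite normrX in ad *; lra.
- rewrite !pp_le0E ?(ltW a0) ?(ltW s0)// !mulr0 !mul0r !addr0 subrr normr0 normrX in ad *; lra.
Qed.

(** To be read with r >= |x|, a = t^2 - |y|^2, X = 2 x.y and s = |x|^2. The second order term has
    X^2 in place of (X - s)^2, dropping what has degree 3 or 4 in x. From |X - s| <= 5rt and |(X -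
    s)^2 - X^2| <= 9 r^3 t one gets 152 = 5^3 + 3 * 9 and 2804 = 5^3 * 22 + 6 * 9. *)
Lemma kernel_remainder (t r a X s : R) : 1 <= r -> r <= t ->
  - (3 * t ^+ 2) <= a -> a <= t ^+ 2 -> `|X| <= 4 * r * t -> 0 <= s -> s <= r ^+ 2 ->
  `|pp 3 (a + (X - s)) - (pp 3 a + 3 * pp 2 a * (X - s) + 3 * pp 1 a * X ^+ 2)|
    <= 152 * (r ^+ 3 * t ^+ 3) /\
  `|pp 4 (a + (X - s)) - (pp 4 a + 4 * pp 3 a * (X - s) + 6 * pp 2 a * X ^+ 2)|
    <= 2804 * (r ^+ 3 * t ^+ 5).
Proof.
move=> r1 rt al au Xb s0 sr.
have r0 : 0 <= r by lra.
have t0 : 0 <= t by lra.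
have rr : r ^+ 2 <= r * t by rewrite expr2 ler_wpM2l.
have rt0 : 0 <= r * t := mulr_ge0 r0 t0.
set d := X - s.
have db : `|d| <= 5 * (r * t).
  by rewrite (le_trans (ler_normB _ _))// (ger0_norm s0); lra.
have d3 : `|d| ^+ 3 <= 125 * (r ^+ 3 * t ^+ 3).
  rewrite (_ : 125 * _ = (5 * (r * t)) ^+ 3); last by ring.
  by apply: lerXn2r; rewrite ?nnegrE//; lra.
have dX : `|d ^+ 2 - X ^+ 2| <= 9 * (r ^+ 3 * t).
  rewrite (_ : _ - _ = s * (s - 2 * X)); last by rewrite /d; ring.
  rewrite normrM (ger0_norm s0).
  have h1 : `|s - 2 * X| <= 9 * (r * t).
    by rewrite (le_trans (ler_normB _ _))// normrM (ger0_norm s0) (ger0_norm (_ : 0 <= 2))//; lra.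
  have := ler_pM s0 (normr_ge0 _) sr h1.
  by rewrite (_ : r ^+ 2 * _ = 9 * (r ^+ 3 * t))//; ring.
have t2 : 0 <= t ^+ 2 by rewrite sqr_ge0.
have p1 : pp 1 a <= t ^+ 2 by have := pp_le 1 au t2; rewrite expr1.
have p2 : pp 2 a <= t ^+ 4 by have := pp_le 2 au t2; rewrite -exprM.
have p10 := pp_ge0 1 a; have p20 := pp_ge0 2 a.
have rt3 : 0 <= r ^+ 3 * t by rewrite mulr_ge0// exprn_ge0.
split.
- have -> : pp 3 (a + d) - (pp 3 a + 3 * pp 2 a * d + 3 * pp 1 a * X ^+ 2) =
    pp 3 (a + d) - (pp 3 a + 3 * pp 2 a * d + 3 * pp 1 a * d ^+ 2) +
    3 * (pp 1 a * (d ^+ 2 - X ^+ 2)) by ring.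
  rewrite (le_trans (ler_normD _ _))//.
  have h1 := le_trans (pp3_taylor a d) d3.
  have h2 : `|pp 1 a * (d ^+ 2 - X ^+ 2)| <= 9 * (r ^+ 3 * t ^+ 3).
    rewrite normrM (ger0_norm p10).
    have := ler_pM p10 (normr_ge0 _) p1 dX.
    by rewrite (_ : t ^+ 2 * _ = 9 * (r ^+ 3 * t ^+ 3))//; ring.
  rewrite (normrM 3) (ger0_norm (_ : 0 <= 3))//; lra.
- have -> : pp 4 (a + d) - (pp 4 a + 4 * pp 3 a * d + 6 * pp 2 a * X ^+ 2) =
    pp 4 (a + d) - (pp 4 a + 4 * pp 3 a * d + 6 * pp 2 a * d ^+ 2) +
    6 * (pp 2 a * (d ^+ 2 - X ^+ 2)) by ring.
  rewrite (le_trans (ler_normD _ _))//.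
  have ab : `|a| <= 3 * t ^+ 2 by rewrite ler_norml; apply/andP; split; lra.
  have rt2 : r * t <= t ^+ 2 by rewrite expr2 ler_wpM2r.
  have h0 : 4 * `|a| + 2 * `|d| <= 22 * t ^+ 2 by lra.
  have h00 : 0 <= 4 * `|a| + 2 * `|d| by rewrite addr_ge0// mulr_ge0.
  have h1 := le_trans (pp4_taylor a d) (ler_pM (exprn_ge0 3 (normr_ge0 d)) h00 d3 h0).
  rewrite (_ : 125 * _ * _ = 2750 * (r ^+ 3 * t ^+ 5)) in h1; last by ring.
  have h2 : `|pp 2 a * (d ^+ 2 - X ^+ 2)| <= 9 * (r ^+ 3 * t ^+ 5).
    rewrite normrM (ger0_norm p20).
    have := ler_pM p20 (normr_ge0 _) p2 dX.
    by rewrite (_ : t ^+ 4 * _ = 9 * (r ^+ 3 * t ^+ 5))//; ring.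
  rewrite (normrM 6) (ger0_norm (_ : 0 <= 6))//; lra.
Qed.

End taylor.

(** * Stability of the polynomials of degree at most 2 *)

Section polynomials.
Variable R : realType.
Notation R4 := 'rV[R]_4.

Lemma sum_mul_e4 (b : 'I_4 -> R) (i : 'I_4) : \sum_(k < 4) b k * e4 R i 0 k = b i.
Proof.
rewrite (bigD1 i)//= big1 ?addr0 ?mxE ?eqxx ?mulr1// => k ki.
by rewrite mxE eqxx (negbTE ki) mulr0.
Qed.

(* Reading the coefficients off finitely many values makes the space of
   polynomials of degree at most 2 stable under integrals and pointwise limits. *)
Definition interpolated (P : R4 -> R) := forall x : R4,
  P x = P 0 + \sum_(i < 4) ((P (e4 R i) - P (- e4 R i)) / 2) * x 0 i
    + \sum_(i < 4) \sum_(j < 4)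
        ((P (e4 R i + e4 R j) - P (e4 R i) - P (e4 R j) + P 0) / 2) * x 0 i * x 0 j.

Lemma poly_deg_le2P (P : R4 -> R) : poly_deg_le2 P <-> interpolated P.
Proof.
split=> [[c [b [a Pe]]] x|h]; last first.
  exists (P 0), (fun i => (P (e4 R i) - P (- e4 R i)) / 2),
    (fun i j => (P (e4 R i + e4 R j) - P (e4 R i) - P (e4 R j) + P 0) / 2); exact: h.
pose l (w : R4) := \sum_(i < 4) b i * w 0 i.
pose q (w z : R4) := \sum_(i < 4) \sum_(j < 4) a i j * w 0 i * z 0 j.
have PE w : P w = c + l w + q w w by exact: Pe.
have lD w z : l (w + z) = l w + l z.
  by rewrite /l -big_split /=; apply: eq_bigr => i _; rewrite mxE mulrDr.
have lN w : l (- w) = - l w.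
  by rewrite /l -sumrN; apply: eq_bigr => i _; rewrite mxE mulrN.
have qDl w w' z : q (w + w') z = q w z + q w' z.
  rewrite /q -big_split /=; apply: eq_bigr => i _.
  by rewrite -big_split /=; apply: eq_bigr => j _; rewrite mxE; ring.
have qDr w z z' : q w (z + z') = q w z + q w z'.
  rewrite /q -big_split /=; apply: eq_bigr => i _.
  by rewrite -big_split /=; apply: eq_bigr => j _; rewrite mxE; ring.
have qNN w : q (- w) (- w) = q w w.
  by rewrite /q; apply: eq_bigr => i _; apply: eq_bigr => j _; rewrite !mxE; ring.
have le i : l (e4 R i) = b i by exact: sum_mul_e4.
have qe i j : q (e4 R i) (e4 R j) = a i j.
  rewrite /q; under eq_bigr => k _ do rewrite (sum_mul_e4 (fun j => a k j * e4 R i 0 k)).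
  exact: (sum_mul_e4 (fun k => a k j)).
have l0 : l 0 = 0 by rewrite /l big1// => i _; rewrite mxE mulr0.
have q0 : q 0 0 = 0.
  by rewrite /q big1// => i _; rewrite big1// => j _; rewrite !mxE mulr0.
have E1 i : (P (e4 R i) - P (- e4 R i)) / 2 = b i.
  by rewrite !PE lN qNN le; field.
have E2 i j : (P (e4 R i + e4 R j) - P (e4 R i) - P (e4 R j) + P 0) / 2 =
    (a i j + a j i) / 2.
  by rewrite !PE lD qDl !qDr !le !qe l0 q0; field.
under eq_bigr => i _ do rewrite E1.
under [X in _ = _ + X]eq_bigr => i _ do under eq_bigr => j _ do rewrite E2.
rewrite (PE 0) l0 q0 !addr0 PE; congr (_ + _).
(* Interpolation recovers only the symmetrised coefficients (a_ij + a_ji)/2, so the quadratic form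
   is compared with the mean of itself and its transpose. *)
have qT : q x x = \sum_(i < 4) \sum_(j < 4) a j i * x 0 i * x 0 j.
  by rewrite /q exchange_big /=; apply: eq_bigr => i _; apply: eq_bigr => j _; ring.
have -> : q x x = (q x x + q x x) / 2 by field.
rewrite {2}qT /q -big_split /= mulr_suml; apply: eq_bigr => i _.
rewrite -big_split /= mulr_suml; apply: eq_bigr => j _; by field.
Qed.

Lemma poly_deg_le2_integral (F : R4 -> R4 -> R) :
  (forall x, integrable4 (F x)) -> (forall y, poly_deg_le2 (F^~ y)) ->
  poly_deg_le2 (fun x => integral4 (F x)).
Proof.
move=> iF pF; apply/poly_deg_le2P => x /=.
pose b i y := (F (e4 R i) y - F (- e4 R i) y) / 2 * x 0 i.
pose a i j y := (F (e4 R i + e4 R j) y - F (e4 R i) y - F (e4 R j) y + F 0 y) / 2 * x 0 i * x 0 j.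
have ib i : integrable4 (b i).
  apply: integrable4_eq (integrable4Z (x 0 i / 2) (integrable4B (iF (e4 R i)) (iF (- e4 R i)))).
  by move=> y /=; rewrite /b; ring.
have ia i j : integrable4 (a i j).
  apply: integrable4_eq (integrable4Z (x 0 i * x 0 j / 2) (integrable4D (integrable4B (integrable4B (iF (e4 R i + e4 R j)) (iF (e4 R i))) (iF (e4 R j))) (iF 0))).
  by move=> y /=; rewrite /a; ring.
have -> : integral4 (F x) = integral4 (fun y => F 0 y + \sum_(i < 4) b i y +
    \sum_(i < 4) \sum_(j < 4) a i j y).
  by apply: eq_integral4 => y; exact: ((poly_deg_le2P (F^~ y)).1 (pF y) x).
have ia1 i := integrable4_sum (ia i).
rewrite integral4D; last 2 first.
- by apply: integrable4D => //; exact: integrable4_sum.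
- exact: (integrable4_sum ia1).
rewrite integral4D//; last exact: integrable4_sum.
rewrite (integral4_sum ib) (integral4_sum ia1); congr (_ + _ + _).
- apply: eq_bigr => i _.
  rewrite (eq_integral4 (g := fun y => x 0 i / 2 * (F (e4 R i) y - F (- e4 R i) y))); last first.
    by move=> y; rewrite /b; ring.
  by rewrite integral4Z ?integral4B//; [ring|exact: integrable4B].
- apply: eq_bigr => i _; rewrite (integral4_sum (ia i)); apply: eq_bigr => j _.
  rewrite (eq_integral4 (g := fun y => x 0 i * x 0 j / 2 * (F (e4 R i + e4 R j) y - F (e4 R i) y - F (e4 R j) y + F 0 y))); last first.
    by move=> y; rewrite /a; ring.
  have i1 := integrable4B (iF (e4 R i + e4 R j)) (iF (e4 R i)).
  have i2 := integrable4B i1 (iF (e4 R j)).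
  by rewrite integral4Z ?(integral4D i2)// ?(integral4B i1)// ?integral4B//; [ring|exact: integrable4D].
Qed.

Lemma cvg_ord_sum (n : nat) (f : 'I_n -> nat -> R) (l : 'I_n -> R) :
  (forall i, f i k @[k --> \oo] --> l i) ->
  \sum_(i < n) f i k @[k --> \oo] --> \sum_(i < n) l i.
Proof.
elim: n f l => [|n IH] f l h.
  under eq_fun do rewrite big_ord0; rewrite big_ord0; exact: cvg_cst.
under eq_fun do rewrite big_ord_recr; rewrite big_ord_recr /=.
by apply: cvgD; [exact: IH|exact: h].
Qed.

Lemma poly_deg_le2_lim (F : nat -> R4 -> R) (P : R4 -> R) :
  (forall n, poly_deg_le2 (F n)) -> (forall x, F n x @[n --> \oo] --> P x) ->
  poly_deg_le2 P.
Proof.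
move=> pF cF; apply/poly_deg_le2P => x.
set p := (X in _ = X).
suff H : F n x @[n --> \oo] --> p by rewrite -(cvg_lim _ (cF x))// (cvg_lim _ H).
rewrite {}/p; have -> : F^~ x = fun n => F n 0 + \sum_(i < 4) ((F n (e4 R i) - F n (- e4 R i)) / 2) * x 0 i
    + \sum_(i < 4) \sum_(j < 4)
        ((F n (e4 R i + e4 R j) - F n (e4 R i) - F n (e4 R j) + F n 0) / 2) * x 0 i * x 0 j.
  by apply/funext => n; exact: ((poly_deg_le2P (F n)).1 (pF n) x).
apply: cvgD.
  apply: cvgD => //; apply: (@cvg_ord_sum 4) => i.
  by apply: cvgMl; apply: cvgMl; apply: cvgB.
apply: (@cvg_ord_sum 4) => i; apply: (@cvg_ord_sum 4) => j.
by do 3 apply: cvgMl; apply: cvgD => //; apply: cvgB => //; apply: cvgB.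
Qed.

End polynomials.

(** * The quadratic part of the kernel and the polynomial [u - v] *)

Section quadratic.
Variable R : realType.
Notation R4 := 'rV[R]_4.

(** The Taylor polynomial in x of the kernel of [A] at x = 0. Here sqn y - sqn(x - y) is 2 x.y -
    |x|^2, the increment of the argument of the cutoff, and sqn y + sqn x - sqn(x - y) is 2 x.y;
    using the latter in the squares keeps the degree in x at 2. *)
Definition ksecond (T : R) (x y : R4) : R :=
  1920 * T ^- 5 * (qq 3 T 0 y + 3 * qq 2 T 0 y * (sqn y - sqn (x - y))
                   + 3 * qq 1 T 0 y * (sqn y + sqn x - sqn (x - y)) ^+ 2)
  - 3360 * T ^- 6 * (qq 4 T 0 y + 4 * qq 3 T 0 y * (sqn y - sqn (x - y))
                   + 6 * qq 2 T 0 y * (sqn y + sqn x - sqn (x - y)) ^+ 2).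

Lemma sqnN (w : R4) : sqn (- w) = sqn w.
Proof. by apply: eq_bigr => i _; rewrite mxE sqrrN. Qed.

Lemma sqnB (x y : R4) : sqn (x - y) = sqn x - 2 * (\sum_(i < 4) x 0 i * y 0 i) + sqn y.
Proof.
rewrite sqnD sqnN; congr (_ + _ + _); rewrite -mulrN -sumrN; congr (_ * _).
by apply: eq_bigr => i _; rewrite mxE mulrN.
Qed.

Lemma poly_quadratic_kernel (c b a : R) (y : R4) :
  poly_deg_le2 (fun x : R4 => c + b * (sqn y - sqn (x - y))
     + a * (sqn y + sqn x - sqn (x - y)) ^+ 2).
Proof.
exists c, (fun i => 2 * b * y 0 i), (fun i j => 4 * a * y 0 i * y 0 j - (i == j)%:R * b) => x.
have -> : \sum_(i < 4) \sum_(j < 4) (4 * a * y 0 i * y 0 j - (i == j)%:R * b) * x 0 i * x 0 j =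
    4 * a * (\sum_(i < 4) x 0 i * y 0 i) ^+ 2 - b * sqn x.
  rewrite expr2 mulr_suml !mulr_sumr -sumrB; apply: eq_bigr => i _.
  have -> : - (b * x 0 i ^+ 2) = \sum_(j < 4) - ((i == j)%:R * b) * x 0 i * x 0 j.
    rewrite (bigD1 i)//= eqxx big1 ?addr0 ?mulr1n; first by ring.
    by move=> j ji; rewrite eq_sym (negbTE ji) mulr0n; ring.
  rewrite !mulr_sumr -big_split /=; apply: eq_bigr => j _; ring.
have -> : \sum_(i < 4) 2 * b * y 0 i * x 0 i = 2 * b * \sum_(i < 4) x 0 i * y 0 i.
  by rewrite mulr_sumr; apply: eq_bigr => i _; ring.
by rewrite sqnB; ring.
Qed.

Lemma integrable_ksecond (T : R) (x : R4) (u : R4 -> R) : continuous u ->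
  integrable4 (fun y => ksecond T x y * u y).
Proof.
move=> cu.
have cs : continuous (fun y : R4 => sqn (x - y)).
  move=> y; rewrite (_ : (fun y => sqn (x - y)) = @sqn R \o (fun y => x - y))//.
  by apply: continuous_comp; [exact: continuous_subl|exact: continuous_sqn].
have cd : continuous (fun y : R4 => sqn y - sqn (x - y)).
  by move=> y; exact: (cvgB (@continuous_sqn R y) (cs y)).
have cX : continuous (fun y : R4 => (sqn y + sqn x - sqn (x - y)) ^+ 2).
  move=> y; have h : {for y, continuous (fun y : R4 => sqn y + sqn x - sqn (x - y))}.
    exact: (cvgB (cvgD (@continuous_sqn R y) (cvg_cst _)) (cs y)).
  exact: (cvgM h h).
have cdu : continuous (fun y : R4 => (sqn y - sqn (x - y)) * u y).
  by move=> y; exact: (cvgM (cd y) (cu y)).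
have cXu : continuous (fun y : R4 => (sqn y + sqn x - sqn (x - y)) ^+ 2 * u y).
  by move=> y; exact: (cvgM (cX y) (cu y)).
have i1 := integrable4Z (1920 * T ^- 5) (integrable4D (integrable4D (integrable_qq 2 T 0 cu)
  (integrable4Z 3 (integrable_qq 1 T 0 cdu))) (integrable4Z 3 (integrable_qq 0 T 0 cXu))).
have i2 := integrable4Z (3360 * T ^- 6) (integrable4D (integrable4D (integrable_qq 3 T 0 cu)
  (integrable4Z 4 (integrable_qq 2 T 0 cdu))) (integrable4Z 6 (integrable_qq 1 T 0 cXu))).
apply: integrable4_eq (integrable4B i1 i2) => y /=; rewrite /ksecond; ring.
Qed.

Definition A2 (T : R) (x : R4) (u : R4 -> R) := integral4 (fun y => ksecond T x y * u y).

Lemma poly_A2 (T : R) (u : R4 -> R) : continuous u ->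
  poly_deg_le2 (fun x => A2 T x u).
Proof.
move=> cu; apply: poly_deg_le2_integral => [x|y]; first exact: integrable_ksecond.
have := poly_quadratic_kernel
  ((1920 * T ^- 5 * qq 3 T 0 y - 3360 * T ^- 6 * qq 4 T 0 y) * u y)
  ((1920 * T ^- 5 * 3 * qq 2 T 0 y - 3360 * T ^- 6 * 4 * qq 3 T 0 y) * u y)
  ((1920 * T ^- 5 * 3 * qq 1 T 0 y - 3360 * T ^- 6 * 6 * qq 2 T 0 y) * u y) y.
congr poly_deg_le2; apply/funext => x; rewrite /ksecond; ring.
Qed.

(** The constant is specified by an equation and not by its value, so that it enters the estimates
    as a variable rather than as a large numeral. *)
Definition remainder_constant (K : R) :=
  forall w : R, 1920 * (152 * w) + 3360 * (2804 * w) = K * w.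

(** The remainders r^3 t^3 and r^3 t^5 meet the factors t^-10 and t^-12, giving r^3 t^-7 in both
    cases. The last factor dominates the indicator of |y| <= 2t by a multiple of a cutoff of
    exponent 4, the form in which the growth of |u| is known. *)
Lemma ksecond_remainder : exists2 K : R, 0 < K & forall (t r : R) (x y : R4),
  1 <= r -> r <= t -> enorm x <= r ->
  `|1920 * (t ^+ 2) ^- 5 * qq 3 (t ^+ 2) x y - 3360 * (t ^+ 2) ^- 6 * qq 4 (t ^+ 2) x y
    - ksecond (t ^+ 2) x y| <=
  K * r ^+ 3 * t ^- 7 * ((4 * t ^+ 2) ^- 4 * qq 4 (8 * t ^+ 2) 0 y).
Proof.
have [K [K0 KE]] : exists K : R, 0 < K /\ remainder_constant K.
  exists (1920 * 152 + 3360 * 2804); split; [lra|move=> w; ring].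
exists K => // t r x y r1 rt xr.
have r0 : 0 < r by lra.
have t0 : 0 < t by lra.
have t20 : 0 < t ^+ 2 by rewrite exprn_gt0.
have ex0 := enorm_ge0 x; have ey0 := enorm_ge0 y.
have sx : sqn x <= r ^+ 2 by rewrite -sqr_enorm; apply: lerXn2r; rewrite ?nnegrE// ltW.
have sq0 : sqn (0 - y) = sqn y by rewrite sub0r sqnN.
have Kr0 : 0 <= K * r ^+ 3 * t ^- 7.
  by rewrite !mulr_ge0 ?invr_ge0 ?exprn_ge0 ?(ltW K0)// ltW.
have G0 : 0 <= (4 * t ^+ 2) ^- 4 * qq 4 (8 * t ^+ 2) 0 y.
  by rewrite mulr_ge0 ?qq_ge0// invr_ge0 exprn_ge0// mulr_ge0// ltW.
(* For |y| > 2t one has |x - y| > t because |x| <= r <= t, so every cutoff vanishes. *)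
have [h|h] := leP (sqn y) (4 * t ^+ 2); last first.
  have ey : 2 * t < enorm y.
    rewrite -(@ltr_pXn2r _ 2)// ?nnegrE//; last by lra.
    by rewrite sqr_enorm exprMn; lra.
  have sxy : t ^+ 2 <= sqn (x - y).
    rewrite -sqr_enorm; apply: lerXn2r; rewrite ?nnegrE ?enorm_ge0//; first by lra.
    by have := enorm_trig y x; lra.
  have z : t ^+ 2 <= sqn (0 - y) by lra.
  rewrite /ksecond !(qq_out _ sxy) !(qq_out _ z) !(mulr0, mul0r, addr0, subr0) normr0.
  exact: mulr_ge0.
have ey : enorm y <= 2 * t.
  rewrite -(@ler_pXn2r _ 2)// ?nnegrE//; last by lra.
  by rewrite sqr_enorm exprMn; lra.
have cs : `|2 * \sum_(i < 4) x 0 i * y 0 i| <= 4 * r * t.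
  have h1 := cauchy_schwarz4 x y.
  have h2 := cauchy_schwarz4 x (- y); rewrite enormN in h2.
  have h3 : \sum_(i < 4) x 0 i * (- y) 0 i = - \sum_(i < 4) x 0 i * y 0 i.
    by rewrite -sumrN; apply: eq_bigr => i _; rewrite mxE mulrN.
  rewrite h3 in h2; have h4 := ler_pM ex0 ey0 xr ey.
  rewrite normrM (ger0_norm (_ : 0 <= 2))//.
  have : `|\sum_(i < 4) x 0 i * y 0 i| <= r * (2 * t).
    by rewrite ler_norml; apply/andP; split; lra.
  by lra.
set X := 2 * \sum_(i < 4) x 0 i * y 0 i in cs.
have aE : t ^+ 2 - sqn (x - y) = (t ^+ 2 - sqn y) + (X - sqn x).
  by rewrite sqnB -/X; ring.
have [k3 k4] : _ /\ _ := @kernel_remainder R t r (t ^+ 2 - sqn y) X (sqn x) r1 rt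
  ltac:(lra) ltac:(have := sqn_ge0 y; lra) cs (sqn_ge0 x) sx.
rewrite -aE in k3 k4.
(* On |y|^2 <= 4t^2 the cutoff of parameter 8t^2 is at least (4t^2)^4, hence the normalisation. *)
have G1 : 1 <= (4 * t ^+ 2) ^- 4 * qq 4 (8 * t ^+ 2) 0 y.
  rewrite /qq sq0 pp_gt0E; last by lra.
  rewrite mulrC ler_pdivlMr ?exprn_gt0//; last by lra.
  by rewrite mul1r; apply: lerXn2r; rewrite ?nnegrE; lra.
apply: (@le_trans _ _ (K * r ^+ 3 * t ^- 7)); last by rewrite ler_peMr.
have tn5 : 0 < (t ^+ 2) ^- 5 by rewrite invr_gt0 exprn_gt0.
have tn6 : 0 < (t ^+ 2) ^- 6 by rewrite invr_gt0 exprn_gt0.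
rewrite /ksecond.
have -> : sqn y + sqn x - sqn (x - y) = X by rewrite sqnB -/X; ring.
have -> : sqn y - sqn (x - y) = X - sqn x by rewrite sqnB -/X; ring.
rewrite /qq sq0.
set a := t ^+ 2 - sqn y in k3 k4 *; set d := X - sqn x in k3 k4 *.
set b := t ^+ 2 - sqn (x - y) in k3 k4 *.
have -> (c1 c2 p3 p4 q3 q4 : R) : c1 * p3 - c2 * p4 - (c1 * q3 - c2 * q4) =
  c1 * (p3 - q3) - c2 * (p4 - q4) by ring.
rewrite (le_trans (ler_normB _ _))//.
rewrite [X in X + _ <= _]normrM [X in _ + X <= _]normrM.
rewrite (ger0_norm (_ : 0 <= 1920 * (t ^+ 2) ^- 5)); last by lra.
rewrite (ger0_norm (_ : 0 <= 3360 * (t ^+ 2) ^- 6)); last by lra.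
have j3 := ler_wpM2l (ltW tn5) k3; have j4 := ler_wpM2l (ltW tn6) k4.
have e3 : (t ^+ 2) ^- 5 * (152 * (r ^+ 3 * t ^+ 3)) = 152 * (r ^+ 3 * t ^- 7).
  by field; lra.
have e4 : (t ^+ 2) ^- 6 * (2804 * (r ^+ 3 * t ^+ 5)) = 2804 * (r ^+ 3 * t ^- 7).
  by field; lra.
rewrite e3 in j3; rewrite e4 in j4.
rewrite -[X in _ <= X]mulrA -(KE : remainder_constant K); lra.
Qed.

(** The powers combine as t^-7 (4t^2)^-4 (8t^2)^7 = 8192 / t: the growth t^7 of the averages leaves
    exactly one negative power of t. *)
Lemma A_sub_A2 (u : R4 -> R) (C : R) : continuous u ->
  (forall t, 1 <= t -> Q 4 t 0 (fun y => `|u y|) <= C * t ^+ 7) ->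
  exists K : R, forall (t r : R) (x : R4), 1 <= r -> r <= t -> enorm x <= r ->
  `|A (t ^+ 2) x u - A2 (t ^+ 2) x u| <= K * r ^+ 3 / t.
Proof.
move=> cu QC; have [K0 K00 rem] := ksecond_remainder.
exists (K0 * 8192 * C) => t r x r1 rt xr.
have t1 : 1 <= t by lra.
have t0 : 0 < t by lra.
have [-> ig] := AE (t ^+ 2) x cu.
have ik := integrable_ksecond (t ^+ 2) x cu.
rewrite /A2 -integral4B// (le_trans (le_normr_integral4 (integrable4B ig ik)))//.
set K := K0 * r ^+ 3.
have cnu : continuous (fun y => `|u y|) by move=> y; exact: (cvg_norm (cu y)).
have iq := integrable_qq 3 (8 * t ^+ 2) 0 cnu.
have t20 : 1 <= t ^+ 2 by rewrite exprn_ege1.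
have Q8 : Q 4 (8 * t ^+ 2) 0 (fun y => `|u y|) <= C * (8 * t ^+ 2) ^+ 7 by apply: QC; lra.
apply: (@le_trans _ _ (K * t ^- 7 * (4 * t ^+ 2) ^- 4 * Q 4 (8 * t ^+ 2) 0 (fun y => `|u y|))).
  rewrite /Q -integral4Z//; apply: le_integral4.
  - exact: integrable4_norm (integrable4B ig ik).
  - exact: integrable4Z.
  - move=> y; rewrite -mulrBl normrM.
    have := ler_wpM2r (normr_ge0 (u y)) (rem t r x y r1 rt xr).
    by rewrite !mulrA.
have r0 : 0 < r by lra.
have K1 : 0 < K by rewrite /K mulr_gt0 ?exprn_gt0.
have c0 : 0 < K * t ^- 7 * (4 * t ^+ 2) ^- 4.
  have h1 : 0 < (4 * t ^+ 2) ^- 4 by rewrite invr_gt0 exprn_gt0//; lra.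
  by apply: mulr_gt0 h1; rewrite mulr_gt0// invr_gt0 exprn_gt0.
have := ler_wpM2l (ltW c0) Q8.
suff -> : K * t ^- 7 * (4 * t ^+ 2) ^- 4 * (C * (8 * t ^+ 2) ^+ 7) = K0 * 8192 * C * r ^+ 3 / t by [].
rewrite /K; field; lra.
Qed.

Lemma poly_sub (P : R4 -> R) (c : R) : poly_deg_le2 P -> poly_deg_le2 (fun x => c - P x).
Proof.
move=> [d [b [a h]]]; exists (c - d), (fun i => - b i), (fun i j => - a i j) => x.
rewrite h !opprD !addrA -!sumrN; congr (_ + _ + _); apply: eq_bigr => i _; first by rewrite mulNr.
by rewrite -sumrN; apply: eq_bigr => j _; rewrite !mulNr.
Qed.

Lemma poly_scale (P : R4 -> R) (c : R) : poly_deg_le2 P -> poly_deg_le2 (fun x => c * P x).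
Proof.
move=> [d [b [a h]]]; exists (c * d), (fun i => c * b i), (fun i j => c * a i j) => x.
rewrite h !mulrDr !mulr_sumr; congr (_ + _ + _); apply: eq_bigr => i _; first by rewrite mulrA.
by rewrite mulr_sumr; apply: eq_bigr => j _; rewrite !mulrA.
Qed.

Lemma u_sub_V_poly (u : R4 -> R) : Ck 4 u -> integrable4 (bilaplacian u) ->
  integrable4 (fun y => expR (4 * u y)) ->
  poly_deg_le2 (fun x => u x - (8 * pi ^+ 2)^-1 * V (bilaplacian u) x).
Proof.
move=> Cu fi ei; have cu := Ck_continuous Cu.
have [C C0 CP] := Q4_norm_growth Cu fi ei.
have [K0 K0P] := A_sub_A2 cu CP.
have err (x : R4) : A (Tn R n) x u - A2 (Tn R n) x u @[n --> \oo] --> (0 : R).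
  pose r := Num.max 1 (enorm x).
  have r1 : 1 <= r by rewrite /r le_max lexx.
  have xr : enorm x <= r by rewrite /r le_max lexx orbT.
  pose K := K0 * r ^+ 3.
  have h0 : K * n.+1%:R^-1 @[n --> \oo] --> (0 : R).
    rewrite -[0 in X in _ --> X](mulr0 K).
    by exact: (cvgM (cvg_cst K) (@cvg_harmonic R)).
  apply/cvgrPdist_le => e e0.
  have hn : \forall n \near \oo, r <= n.+1%:R.
    have := near_Tn (r ^+ 2); apply: filterS => n; rewrite /Tn => /ltW.
    by rewrite ler_pXn2r ?nnegrE ?ler0n// (le_trans ler01).
  move/cvgrPdist_le : h0 => /(_ e e0) h1; apply: (filterS _ (filterI hn h1)) => n [rn] /=.
  rewrite !sub0r !normrN; apply: le_trans.
  rewrite (le_trans (K0P _ _ _ r1 rn xr))//; exact: ler_norm.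
(* Up to errors tending to 0 at x and at 0, this polynomial equals A(0) - A(x), whose limit is
   known; u - v is then u(0) plus the limit divided by 16 pi^2. *)
pose F n x := A2 (Tn R n) 0 u - A2 (Tn R n) x u.
have cF (x : R4) : F n x @[n --> \oo] -->
    16 * pi ^+ 2 * (u x - u 0) - 2 * V (bilaplacian u) x.
  have h := cvgB (cvgB (err x) (err 0)) (@cvg_A_sub R x u Cu fi).
  have -> : 16 * pi ^+ 2 * (u x - u 0) - 2 * V (bilaplacian u) x =
    0 - 0 - (2 * V (bilaplacian u) x - 16 * pi ^+ 2 * (u x - u 0)) by ring.
  have -> : F^~ x = (fun n => A (Tn R n) x u - A2 (Tn R n) x u
     - (A (Tn R n) 0 u - A2 (Tn R n) 0 u) - (A (Tn R n) x u - A (Tn R n) 0 u)).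
    by apply/funext => n; rewrite /F; ring.
  by apply: h; exact: _.
have pF n : poly_deg_le2 (F n) by apply: poly_sub; exact: poly_A2.
have pP := poly_deg_le2_lim pF cF.
have pi0 : 0 < pi :> R := pi_gt0 R.
have := poly_sub (u 0) (poly_scale (- (16 * pi ^+ 2)^-1) pP).
congr poly_deg_le2; apply/funext => x; field; lra.
Qed.

End quadratic.

(** * Averages over unit cubes and a logarithmic upper bound *)

Section average.
Variable R : realType.
Notation R4 := 'rV[R]_4.
Notation mT := (measurableTypeR R).

(** The density degenerates only near |y| = 1. Where |y|^p >= 2 its factor has modulus at least 1,
    and on the cube of half side 2^(1/p) the function e^{4u} is bounded by continuity. *)
Lemma integrable_expR (p : R) (u : R4 -> R) : 0 < p -> continuous u ->
  integrable4 (fun y => (1 - enorm y `^ p) * expR (4 * u y)) ->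
  integrable4 (fun y => expR (4 * u y)).
Proof.
move=> p0 cu fi.
have ce : continuous (fun y => expR (4 * u y)).
  move=> y; apply: (@continuous_comp _ _ _ (fun y => 4 * u y) expR); last exact: continuous_expR.
  exact: (cvgM (cvg_cst _) (cu y)).
pose r : R := 2 `^ p^-1.
have r0 : 0 < r by rewrite powR_gt0.
have rp : r `^ p = 2 by rewrite -powRrM mulVf ?gt_eqF// powRr1.
have [C C0 CP] := continuous_bounded_box 0 ce (ltW r0).
apply: (@le_integrable4 _ _ (fun y => `|(1 - enorm y `^ p) * expR (4 * u y)| + C * box 0 r y)).
- exact: continuous_meas4.
- by apply: integrable4D; [exact: integrable4_norm|apply: integrable4Z; exact: integrable4_box].
move=> y; have [h|h] := pselect (forall i, `|y 0 i - (0 : R4) 0 i| <= r).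
  by rewrite box_in// mulr1 (le_trans (CP y h))// lerDr.
rewrite box_out// mulr0 addr0 normrM ler_peMl//.
move/existsNP : h => [i /negP]; rewrite -ltNge mxE subr0 => h.
have ry : r <= enorm y by rewrite ltW// (lt_le_trans h)// coord_le_enorm.
have : 2 <= enorm y `^ p.
  by rewrite -rp; apply: ge0_ler_powR; rewrite ?nnegrE ?(ltW r0) ?(ltW p0) ?enorm_ge0.
by move=> H; rewrite ler0_norm; lra.
Qed.

Lemma measurable_ell2 : measurable_fun setT
  (fun z : ((mT * mT) * (mT * mT)) * ((mT * mT) * (mT * mT)) =>
    ell ((of_coords z.1 : R4) - of_coords z.2)).
Proof.
rewrite /ell; apply: (measurableT_comp (@measurable_ln R)).
apply: measurable_funD; first exact: measurable_cst.
apply: measurable_inv_nneg; last by move=> z; exact: enorm_ge0.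
rewrite /enorm; apply: (measurableT_comp (continuous_measurable_fun (@sqrt_continuous R))).
apply: measurable_sum => i; apply: measurable_funX.
rewrite [X in measurable_fun _ X](_ : _ = fun z => (of_coords z.1 : R4) 0 i - (of_coords z.2 : R4) 0 i).
  by apply: measurable_funB; [exact: (measurableT_comp (measurable_coord i) measurable_fst)|
    exact: (measurableT_comp (measurable_coord i) measurable_snd)].
by apply/funext => z; rewrite !mxE.
Qed.

Lemma box_ell_le (z w : R4) (r : R) : 0 < r ->
  integrable4 (fun y => box z r y * ell (y - w)) /\
  integral4 (fun y => box z r y * ell (y - w)) <= (2 * r) ^+ 4 + 256.
Proof.
move=> r0.
have [i1 e1] := ell_box w (@ltr01 R) (lexx 1).
rewrite expr1n mulr1 in e1.
have ib := integrable4_box z r0.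
have m : meas4 (fun y : R4 => box z r y * ell (y - w)).
  apply: measurable_funM; first exact: measurable_box.
  by under eq_fun do rewrite ellBC; exact: measurable_ell.
have le y : box z r y * ell (y - w) <= box z r y + ell (w - y) * box w 1 y.
  have b1 : box z r y <= 1.
    rewrite /box; apply: prodr_ile1 => i _ /=; rewrite indicE; by case: (_ \in _); rewrite ?ler01 ?lexx.
  have [h|h] := pselect (forall i, `|y 0 i - w 0 i| <= 1).
    rewrite (box_in h) mulr1 (ellBC y) -[X in X <= _]add0r lerD ?box_ge0//.
    by rewrite ler_piMl// ell_ge0.
  by rewrite (box_out h) mulr0 addr0 ellBC ler_piMr ?box_ge0// ell_far.
have iM := integrable4D ib i1.
have i0 : integrable4 (fun y => box z r y * ell (y - w)).
  apply: (le_integrable4 m iM) => y.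
  by rewrite ger0_norm ?mulr_ge0 ?box_ge0 ?ell_ge0.
split => //; apply: (le_trans (le_integral4 i0 iM le)).
by rewrite integral4D// integral4_box//; lra.
Qed.

Lemma integral4_tonelli_le (k : R4 -> R4 -> R) (g : R4 -> R) :
  measurable_fun setT (fun z : ((mT * mT) * (mT * mT)) * ((mT * mT) * (mT * mT)) =>
    k (of_coords z.1) (of_coords z.2)) ->
  (forall y w, 0 <= k y w) -> (forall y, integrable4 (k y)) ->
  (forall w, integrable4 (k^~ w)) -> integrable4 g ->
  (forall w, integral4 (k^~ w) <= g w) ->
  integrable4 (fun y => integral4 (k y)) /\
  integral4 (fun y => integral4 (k y)) <= integral4 g.
Proof.
move=> mk k0 ik1 ik2 ig kg.
have toE (h : R4 -> R) : integrable4 h -> (\int[lb4 R]_s (h (of_coords s))%:E = (integral4 h)%:E)%E.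
  by move=> ih; rewrite /integral4 fineK//; exact: (integrable_fin_num (mu := lb4 R) measurableT ih).
set K := (fun z : ((mT * mT) * (mT * mT)) * ((mT * mT) * (mT * mT)) =>
    (k (of_coords z.1) (of_coords z.2))%:E).
have mK : measurable_fun setT K by apply/measurable_EFinP.
have K0 s : (0 <= K s)%E by rewrite lee_fin.
have fub := fubini_tonelli (m1 := lb4 R) (m2 := lb4 R) K mK K0.
have mF := measurable_fun_fubini_tonelli_F (m2 := lb4 R) K mK K0.
have mG := measurable_fun_fubini_tonelli_G (m1 := lb4 R) K mK K0.
have E1 y : (\int[lb4 R]_w K (y, w) = (integral4 (k (of_coords y)))%:E)%E by exact: toE.
have E2 w : (\int[lb4 R]_y K (y, w) = (integral4 (k^~ (of_coords w)))%:E)%E.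
  exact: (toE (k^~ (of_coords w))).
have mI : meas4 (fun y => integral4 (k y)).
  apply/measurable_EFinP; move: mF.
  by congr measurable_fun; apply/funext => y; rewrite /fubini_F E1.
have mJ : measurable_fun setT (fun w => (integral4 (k^~ (of_coords w)))%:E).
  by move: mG; congr measurable_fun; apply/funext => y; rewrite /fubini_G E2.
have H : (\int[lb4 R]_y (integral4 (k (of_coords y)))%:E <= (integral4 g)%:E)%E.
  under eq_integral do rewrite -E1.
  rewrite fub -(toE _ ig); under eq_integral do rewrite E2.
  apply: (ge0_le_integral (lb4 R) measurableT _ mJ).
  - by move=> w _; rewrite lee_fin integral4_ge0.
  - by apply/measurable_EFinP; exact: (integrable4_meas ig).
  - by move=> w _; rewrite lee_fin.
have I0 y : 0 <= integral4 (k y) by apply: integral4_ge0.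
have iI : integrable4 (fun y => integral4 (k y)).
  by apply: (integrable4_ge0 mI I0); exact: (le_lt_trans H (ltry _)).
by split; [exact: iI|rewrite -lee_fin -(toE _ iI)].
Qed.

(** The part of the bound on [V f y] that comes from the singularity at y. It has no pointwise bound
    in y at this stage, only a bound on its averages over cubes. *)
Definition W (f : R4 -> R) (y : R4) : R := integral4 (fun w => ell (y - w) * `|f w|).

(** Tonelli moves the average onto [ell], where it is bounded uniformly in the centre z; this
    uniformity is what makes the averaging argument work at every point. *)
Lemma integrable_box_W (f : R4 -> R) (z : R4) (r : R) : continuous f -> integrable4 f ->
  0 < r ->
  integrable4 (fun y => box z r y * W f y) /\
  integral4 (fun y => box z r y * W f y) <=
    ((2 * r) ^+ 4 + 256) * integral4 (fun y => `|f y|).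
Proof.
move=> cf fi r0.
pose k (y w : R4) := box z r y * (ell (y - w) * `|f w|).
have mk : measurable_fun setT (fun z : ((mT * mT) * (mT * mT)) * ((mT * mT) * (mT * mT)) =>
    k (of_coords z.1) (of_coords z.2)).
  apply: measurable_funM.
    exact: (measurableT_comp (measurable_box z r) measurable_fst).
  apply: measurable_funM; first exact: measurable_ell2.
  apply: (measurableT_comp (@normr_measurable R setT)).
  exact: (measurableT_comp (integrable4_meas fi) measurable_snd).
have k0 y w : 0 <= k y w by rewrite /k !mulr_ge0 ?box_ge0 ?ell_ge0.
have ik1 y : integrable4 (k y) by apply: integrable4Z; exact: integrable_ell.
have ik2 w : integrable4 (k^~ w).
  apply: integrable4_eq (integrable4Z `|f w| (box_ell_le z w r0).1) => y /=; rewrite /k; ring.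
have ia := integrable4Z ((2 * r) ^+ 4 + 256) (integrable4_norm fi).
have kg w : integral4 (k^~ w) <= ((2 * r) ^+ 4 + 256) * `|f w|.
  have [i1 e1] := box_ell_le z w r0.
  rewrite (eq_integral4 (g := fun y => `|f w| * (box z r y * ell (y - w)))).
    by rewrite integral4Z// mulrC ler_wpM2r.
  move=> y; rewrite /k; ring.
have E y : integral4 (k y) = box z r y * W f y.
  by rewrite /k integral4Z//; exact: integrable_ell.
have [iW] := integral4_tonelli_le mk k0 ik1 ik2 ia kg.
rewrite (eq_integral4 E) (integral4Z _ (integrable4_norm fi)) => eW; split => //.
exact: integrable4_eq E iW.
Qed.

Lemma V_le (f : R4 -> R) (y : R4) (rho : R) : continuous f -> integrable4 f ->
  enorm y <= rho ->
  `|V f y| <= ln (1 + rho) * integral4 (fun w => `|f w|) + W f 0 + W f y.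
Proof.
move=> cf fi yr.
have [_ ik] := integrable_log_kernel y cf fi.
have ia := integrable4_norm fi.
have i0 := integrable_ell 0 cf fi; have iy := integrable_ell y cf fi.
have iz := integrable4Z (ln (1 + rho)) ia.
have iS := integrable4D (integrable4D iz i0) iy.
rewrite /V (le_trans (le_normr_integral4 ik))// /W -(integral4Z _ ia).
rewrite -(integral4D iz i0) -(integral4D (integrable4D iz i0) iy).
apply: le_integral4 => //; first exact: integrable4_norm.
move=> w; rewrite normrM.
have := ler_wpM2r (normr_ge0 (f w)) (log_kernel_le w yr).
by rewrite sub0r /ell enormN -/(ell w) -/(ell (y - w)); lra.
Qed.

(** On a suitable unit cube P exceeds P(x) - m, so u = cV + P and u <= e^{4u} bound P(x) - m by
    e^{4u} plus c|V|. Integration over the cube replaces the singular part of V by its average. *)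
Lemma poly_log_upper (u f P : R4 -> R) (c : R) : continuous u -> continuous f ->
  integrable4 f -> integrable4 (fun y => expR (4 * u y)) -> 0 <= c -> poly_deg_le2 P ->
  (forall x, u x = c * V f x + P x) ->
  exists C1 C2 : R, 0 <= C1 /\ forall x, P x <= C1 * (C2 + ln (3 + enorm x)).
Proof.
move=> cu cf fi ei c0 [d [b [a PE]]] uE.
pose m := \sum_(i < 4) \sum_(j < 4) `|a i j|.
set I0 := integral4 (fun y => expR (4 * u y)).
set I1 := integral4 (fun y => `|f y|).
have I10 : 0 <= I1 by apply: integral4_ge0.
(* The number 257 is the volume 1 of the cube plus the 256 of [box_ell_le]. *)
have main x : P x <= I0 + m + c * (ln (3 + enorm x) * I1 + W f 0 + 257 * I1).
  pose g i := b i + \sum_(j < 4) (a i j + a j i) * x 0 j.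
  have PD (h : R4) : P (x + h) = P x + \sum_(i < 4) g i * h 0 i +
      \sum_(i < 4) \sum_(j < 4) a i j * h 0 i * h 0 j.
    rewrite !PE.
    have -> : \sum_(i < 4) b i * (x + h) 0 i = \sum_(i < 4) b i * x 0 i + \sum_(i < 4) b i * h 0 i.
      by rewrite -big_split; apply: eq_bigr => i _; rewrite mxE /=; ring.
    have -> : \sum_(i < 4) g i * h 0 i = \sum_(i < 4) b i * h 0 i +
        \sum_(i < 4) \sum_(j < 4) a i j * x 0 j * h 0 i +
        \sum_(i < 4) \sum_(j < 4) a i j * x 0 i * h 0 j.
      rewrite [X in _ = _ + X]exchange_big -!big_split /=; apply: eq_bigr => i _.
      rewrite /g mulrDl -addrA; congr (_ + _).
      by rewrite mulr_suml -big_split /=; apply: eq_bigr => j _; ring.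
    have -> : \sum_(i < 4) \sum_(j < 4) a i j * (x + h) 0 i * (x + h) 0 j =
        \sum_(i < 4) \sum_(j < 4) a i j * x 0 i * x 0 j +
        \sum_(i < 4) \sum_(j < 4) a i j * x 0 j * h 0 i +
        \sum_(i < 4) \sum_(j < 4) a i j * x 0 i * h 0 j +
        \sum_(i < 4) \sum_(j < 4) a i j * h 0 i * h 0 j.
      rewrite -!big_split; apply: eq_bigr => i _; rewrite -!big_split /=.
      by apply: eq_bigr => j _; rewrite !mxE; ring.
    ring.
  (* The cube has x as a vertex and extends in the direction in which the linear part of P at x,
     with gradient g, increases: h_i runs over [0, 1] or [-1, 0] according to the sign of g i. Only
     the quadratic part, at most m in modulus, can then lower P. *)
  pose z : R4 := \row_i (x 0 i + (if 0 <= g i then 2^-1 else - 2^-1)).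
  have Q1 (y : R4) : (forall i, `|y 0 i - z 0 i| <= 2^-1) ->
      P x - m <= P y /\ enorm y <= 2 + enorm x.
    move=> hy; pose h := y - x.
    have hi i : 0 <= g i * h 0 i /\ `|h 0 i| <= 1.
      have := hy i; rewrite /h !mxE ler_distl => /andP[].
      case: (leP 0 (g i)) => gi l1 l2; split; rewrite ?ler_norml; try (apply/andP; split); try lra.
        by rewrite mulr_ge0//; lra.
      by rewrite mulr_le0 ?(ltW gi)//; lra.
    have yE : y = x + h by rewrite /h addrC subrK.
    have qm : `|\sum_(i < 4) \sum_(j < 4) a i j * h 0 i * h 0 j| <= m.
      rewrite (le_trans (ler_norm_sum _ _ _))//; apply: ler_sum => i _.
      rewrite (le_trans (ler_norm_sum _ _ _))//; apply: ler_sum => j _.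
      rewrite !normrM -mulrA ler_piMr// mulr_ile1//; by case: (hi i) (hi j) => _ ? [].
    split.
      have g0 : 0 <= \sum_(i < 4) g i * h 0 i by apply: sumr_ge0 => i _; case: (hi i).
      rewrite [in leRHS]yE PD; move: qm; rewrite ler_norml => /andP[]; lra.
    rewrite yE (le_trans (enormD _ _))// addrC lerD2r.
    rewrite -(@ler_pXn2r _ 2)// ?nnegrE ?enorm_ge0// sqr_enorm /sqn.
    apply: (@le_trans _ _ (\sum_(i < 4) 1)); last by rewrite sumr_const card_ord; lra.
    apply: ler_sum => i _; rewrite -real_normK ?num_real//; apply: exprn_ile1 => //.
    by case: (hi i).
  have r0 : 0 < 2^-1 :> R by lra.
  have [iW eW] := integrable_box_W z cf fi r0.
  have b1 : (2 * 2^-1 : R) ^+ 4 = 1 by rewrite mulfV ?expr1n// pnatr_eq0.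
  rewrite b1 -/I1 in eW.
  (* On the cube u is at least k - c W f y. *)
  pose k := P x - m - c * (ln (3 + enorm x) * I1 + W f 0).
  have ib := integrable4_box z r0.
  have pw y : k * box z 2^-1 y - c * (box z 2^-1 y * W f y) <= expR (4 * u y).
    have [h|h] := pselect (forall i, `|y 0 i - z 0 i| <= 2^-1); last first.
      by rewrite (box_out h) mul0r !mulr0 subr0 expR_ge0.
    rewrite (box_in h) mulr1 mul1r.
    have [h1 h2] := Q1 y h.
    have h3 := V_le cf fi h2; rewrite addrA (_ : 1 + 2 = 3) in h3; last by lra.
    rewrite -/I1 in h3.
    have h4 : - V f y <= ln (3 + enorm x) * I1 + W f 0 + W f y.
      by rewrite (le_trans _ h3)// -normrN ler_norm.
    have h5 := ler_wpM2l c0 h4.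
    have h6 := expR_ge_self (u y); rewrite ge_max in h6; case/andP: h6 => h6 _.
    apply: le_trans h6; rewrite uE /k; move: h1 h5.
    move: (V f y) (W f y) (W f 0) (ln _) => v w w0 l; clear; lra.
  have := le_integral4 (integrable4B (integrable4Z k ib) (integrable4Z c iW)) ei pw.
  rewrite integral4B ?(integral4Z _ ib) ?(integral4Z _ iW)//; try exact: integrable4Z.
  rewrite integral4_box// b1 mulr1 -/I0.
  have := ler_wpM2l c0 eW; rewrite /k; lra.
exists (`|I0| + m + c * W f 0 + c * 257 * I1 + c * I1), 1.
have m0 : 0 <= m by apply: sumr_ge0 => i _; apply: sumr_ge0.
have W0 : 0 <= W f 0 by apply: integral4_ge0 => w; rewrite mulr_ge0 ?ell_ge0.
have C0 : 0 <= `|I0| + m + c * W f 0 + c * 257 * I1 by rewrite !(addr_ge0, mulr_ge0, normr_ge0, ler0n).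
have C1 : 0 <= c * I1 by rewrite mulr_ge0.
split=> [|x]; first exact: addr_ge0.
have l0 : 0 <= ln (3 + enorm x) by apply: ln_ge0; have := enorm_ge0 x; lra.
rewrite (le_trans (main x))//.
have := ler_norm I0; have := mulr_ge0 C0 l0; lra.
Qed.

End average.

(** * Quadratic polynomials with a logarithmic upper bound *)

Section bounded_above.
Variable R : realType.
Notation R4 := 'rV[R]_4.

(** This is a quadratic polynomial on the ray through d, at the point t^2 d. With this
    parametrisation a logarithm is at most linear in t, and a positive leading coefficient, of t^4
    or else of t^2, outgrows it. *)
Lemma quartic_growth (c b q A B : R) :
  (forall t, 1 <= t -> c + t ^+ 2 * b + t ^+ 4 * q <= A + B * t) ->
  q <= 0 /\ (q = 0 -> b <= 0).
Proof.
move=> h.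
pose M := `|A| + `|B| + `|c| + `|b|.
have M0 : 0 <= M by rewrite /M !addr_ge0.
have [nA nB nc nb] : [/\ A <= `|A|, B <= `|B|, - c <= `|c| & - b <= `|b|].
  by split; rewrite ?ler_norm// -normrN ler_norm.
have key t : 1 <= t -> A + B * t - c <= (`|A| + `|B| + `|c|) * t.
  move=> t1; have t0 : 0 <= t by lra.
  have h1 := ler_wpM2r t0 nB.
  have h2 := ler_peMr (normr_ge0 A) t1; have h3 := ler_peMr (normr_ge0 c) t1.
  lra.
split=> [|q0]; rewrite leNgt; apply/negP => pos.
- pose t := 1 + M / q.
  have t1 : 1 <= t by rewrite /t lerDl divr_ge0// ltW.
  have t0 : 0 <= t by lra.
  have tq : t * q = q + M by rewrite /t; field; lra.
  have k := key t t1; have ht := h t t1.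
  have tt : t <= t ^+ 2 by rewrite expr2 ler_peMr.
  have h4 : (`|A| + `|B| + `|c|) * t <= (`|A| + `|B| + `|c|) * t ^+ 2.
    by rewrite ler_wpM2l// !addr_ge0.
  have h5 := ler_wpM2r (sqr_ge0 t) nb.
  have h6 : t ^+ 2 * (t ^+ 2 * q) <= t ^+ 2 * M by rewrite /M; lra.
  have t20 : 0 < t ^+ 2 by rewrite exprn_gt0//; lra.
  rewrite (ler_pM2l t20) in h6.
  have h7 := ler_wpM2r (ltW pos) tt; lra.
- pose t := 1 + M / b.
  have t1 : 1 <= t by rewrite /t lerDl divr_ge0// ltW.
  have t0 : 0 <= t by lra.
  have tb : t * b = b + M by rewrite /t; field; lra.
  have k := key t t1; have ht := h t t1; rewrite q0 mulr0 addr0 in ht.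
  have h6 : t * (t * b) <= t * (`|A| + `|B| + `|c|) by lra.
  have tp : 0 < t by lra.
  rewrite (ler_pM2l tp) in h6.
  by have := normr_ge0 b; rewrite /M in tb; lra.
Qed.

(** Rays show that S is negative semidefinite and, applied to d and -d, that b vanishes on the
    kernel of S. For symmetric S this puts b in the range of S, and the square can be completed. *)
Lemma quadratic_bounded_above (c : R) (b : R4) (S : 'M[R]_4) (A B : R) : S^T = S ->
  (forall x : R4, c + (b *m x^T) 0 0 + (x *m S *m x^T) 0 0 <= A * (B + ln (3 + enorm x))) ->
  0 <= A ->
  exists M, forall x : R4, c + (b *m x^T) 0 0 + (x *m S *m x^T) 0 0 <= M.
Proof.
move=> ST h A0.
have line (d : R4) : (d *m S *m d^T) 0 0 <= 0 /\
    ((d *m S *m d^T) 0 0 = 0 -> (b *m d^T) 0 0 <= 0).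
  apply: (@quartic_growth c _ _ (A * (B + 4)) (A * (2 * (1 + enorm d)))) => t t1.
  have t0 : 0 <= t by lra.
  have := h (t ^+ 2 *: d); rewrite linearZ /= -!scalemxAl -!scalemxAr !mxE.
  have -> : enorm (t ^+ 2 *: d) = t ^+ 2 * enorm d.
    rewrite enormE (_ : sqn _ = (t ^+ 2) ^+ 2 * sqn d); last first.
      by rewrite /sqn mulr_sumr; apply: eq_bigr => i _; rewrite mxE exprMn.
    by rewrite sqrtrM ?sqr_ge0// sqrtr_sqr ger0_norm ?sqr_ge0// enormE.
  have d0 := enorm_ge0 d.
  set D := enorm d in d0 *.
  have tD : 0 <= t * D by rewrite mulr_ge0.
  have l1 : ln (3 + t ^+ 2 * D) <= ln ((3 + t * (1 + D)) ^+ 2).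
    have h1 : 0 <= (t * D) ^+ 2 by rewrite sqr_ge0.
    have h2 : 0 <= t ^+ 2 * D by rewrite mulr_ge0 ?sqr_ge0.
    have h3 : 0 <= t ^+ 2 by rewrite sqr_ge0.
    by rewrite ler_ln ?posrE//; lra.
  have p0 : 0 < 3 + t * (1 + D) by lra.
  have l2 : ln ((3 + t * (1 + D)) ^+ 2) <= 2 * (2 + t * (1 + D)).
    rewrite lnXn// mulr2n; have := @le_ln1Dx R (2 + t * (1 + D)).
    by rewrite addrA => H; have := H ltac:(lra); lra.
  have l3 : A * (B + ln (3 + t ^+ 2 * D)) <= A * (B + 2 * (2 + t * (1 + D))).
    by rewrite ler_wpM2l//; lra.
  move=> hx; have := le_trans hx l3; rewrite -!/(t ^+ 2); lra.
have bS : (b <= S)%MS.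
  rewrite submxE; apply/eqP/matrixP => i j; rewrite mxE.
  (* The columns of the cokernel matrix are annihilated by S; b being orthogonal to each of them is
     the criterion for b to lie in the row space. *)
  pose d : R4 := (col j (cokermx S))^T.
  have Sd : S *m d^T = 0.
    apply/matrixP => k l; have /matrixP/(_ k j) := mulmx_coker S.
    by rewrite !mxE => H; rewrite -[RHS]H; apply: eq_bigr => n _; rewrite !mxE.
  have dd : (d *m S *m d^T) 0 0 = 0 by rewrite -mulmxA Sd mulmx0 mxE.
  have [_ /(_ dd) h1] := line d.
  have ddN : (- d *m S *m (- d)^T) 0 0 = 0 by rewrite linearN /= mulmxN !mulNmx opprK.
  have [_ /(_ ddN) h2] := line (- d).
  have -> : \sum_(k < 4) b i k * cokermx S k j = (b *m d^T) 0 0.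
    by rewrite mxE ord1; apply: eq_bigr => k _; rewrite !mxE.
  by move: h2; rewrite linearN /= mulmxN mxE [RHS]mxE; lra.
have [y yb] := submxP bS.
(* With b = y S and S symmetric, the cross terms of the form at x + z are 2 z S x = b x, so the
   polynomial is the form at x + z plus the constant c - z S z. *)
pose z := 2^-1 *: y.
exists (c - (z *m S *m z^T) 0 0) => x.
have [+ _] := line (x + z).
have xz : (z *m S *m x^T) 0 0 = (x *m S *m z^T) 0 0.
  have -> : x *m S *m z^T = (z *m S *m x^T)^T by rewrite !trmx_mul trmxK ST mulmxA.
  by rewrite [in RHS]mxE.
have bE : (b *m x^T) 0 0 = 2 * (z *m S *m x^T) 0 0.
  by rewrite yb /z -!scalemxAl [in RHS]mxE mulrA mulfV ?mul1r// pnatr_eq0.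
rewrite bE linearD /= !mulmxDl !mulmxDr !mxE in xz *; lra.
Qed.

Lemma poly_bounded_above (P : R4 -> R) (A B : R) : poly_deg_le2 P -> 0 <= A ->
  (forall x, P x <= A * (B + ln (3 + enorm x))) -> exists M, forall x, P x <= M.
Proof.
move=> [c [b [a Pe]]] A0 h.
pose S : 'M[R]_4 := \matrix_(i, j) ((a i j + a j i) / 2).
have PE x : P x = c + ((\row_i b i) *m x^T) 0 0 + (x *m S *m x^T) 0 0.
  rewrite Pe; congr (_ + _ + _).
    by rewrite mxE; apply: eq_bigr => i _; rewrite !mxE.
  have -> : (x *m S *m x^T) 0 0 = \sum_(i < 4) \sum_(j < 4) (a i j + a j i) / 2 * x 0 i * x 0 j.
    rewrite -mulmxA mxE; apply: eq_bigr => i _; rewrite mxE mulr_sumr.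
    by apply: eq_bigr => j _; rewrite !mxE; ring.
  set q := LHS; have qT : q = \sum_(i < 4) \sum_(j < 4) a j i * x 0 i * x 0 j.
    by rewrite /q exchange_big /=; apply: eq_bigr => i _; apply: eq_bigr => j _; ring.
  have -> : q = (q + q) / 2 by field.
  rewrite {2}qT /q -big_split /= mulr_suml; apply: eq_bigr => i _.
  rewrite -big_split /= mulr_suml; apply: eq_bigr => j _; by field.
have ST : S^T = S by apply/matrixP => i j; rewrite !mxE addrC.
have [M HM] : exists M, forall x : R4, c + ((\row_i b i) *m x^T) 0 0 + (x *m S *m x^T) 0 0 <= M.
  by apply: (@quadratic_bounded_above _ _ _ A B) => // x; rewrite -PE.
by exists M => x; rewrite PE.
Qed.

End bounded_above.

(** * Behaviour of the potential at infinity *)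

Section asymptotics.
Variable R : realType.
Notation R4 := 'rV[R]_4.

(** The singularity at z = y has a favourable sign and leaves no [ell (y - z)]. Where f > 0, |z| <=
    1 <= |y - z| makes the kernel nonpositive; where f <= 0 only a lower bound on the kernel is
    needed, given by |y - z| <= |z| (1 + |y|)(1 + 1/|z|). *)
Lemma V_upper (f : R4 -> R) (y : R4) : continuous f -> integrable4 f ->
  (forall z, 0 < f z -> enorm z <= 1) -> 2 <= enorm y ->
  V f y <= ln (1 + enorm y) * integral4 (fun z => `|f z|) +
           integral4 (fun z => ell (0 - z) * `|f z|).
Proof.
move=> cf fi fpos y2.
have ia := integrable4_norm fi.
have iz := integrable4Z (ln (1 + enorm y)) ia.
have i0 := integrable_ell 0 cf fi.
have [_ ik] := integrable_log_kernel y cf fi.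
rewrite -(integral4Z _ ia) -(integral4D iz i0).
apply: le_integral4 => //; first exact: integrable4D.
move=> z; rewrite -mulrDl sub0r {1}/ell enormN -/(ell z).
have l0 : 0 <= ln (1 + enorm y) by apply: ln_ge0; lra.
have e0 := ell_ge0 z; have ez := enorm_ge0 z.
have R0 : 0 <= (ln (1 + enorm y) + ell z) * `|f z| by rewrite mulr_ge0// addr_ge0.
have [fz|fz] := ltP 0 (f z).
  have z1 := fpos z fz.
  have yz : 1 <= enorm (y - z) by have := enorm_trig y z; rewrite (enormBC z); lra.
  apply: le_trans R0; rewrite pmulr_lle0//; apply: ln_le0.
  by rewrite ler_pdivrMr; lra.
rewrite (ler0_norm fz) mulrN -mulNr ler_wnM2r// lerNl.
(* At z = 0 and z = y the kernel is ln 0 = 0 by convention, and the bound is nonnegative. *)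
have [z0|z0] := eqVneq z 0.
  by rewrite z0 enorm0 mul0r ln0//; rewrite z0 in e0; lra.
have [yz|yz] := eqVneq (y - z) 0; first by rewrite yz enorm0 invr0 mulr0 ln0//; lra.
have zp := enorm_gt0 z0; have yzp := enorm_gt0 yz.
rewrite lnM ?posrE ?invr_gt0// lnV ?posrE// /ell.
have h : enorm (y - z) <= enorm y + enorm z by rewrite -(enormN z); exact: enormD.
have zi : 0 < (enorm z)^-1 by rewrite invr_gt0.
have h2 : enorm (y - z) <= enorm z * ((1 + enorm y) * (1 + (enorm z)^-1)).
  have -> : enorm z * ((1 + enorm y) * (1 + (enorm z)^-1)) =
    enorm z + enorm z * enorm y + 1 + enorm y by field; lra.
  by have := mulr_ge0 ez (enorm_ge0 y); lra.
have := h2; rewrite -ler_ln ?posrE//; last by rewrite !mulr_gt0//; lra.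
by rewrite !lnM ?posrE ?mulr_gt0//; lra.
Qed.

Lemma ln_le_pow (n : nat) (s t : R) : 0 < s -> s <= n%:R -> 1 <= t -> expR (s * ln t) <= t ^+ n.
Proof.
move=> s0 sn t1; have t0 : 0 < t by lra.
rewrite -[leRHS]lnK ?posrE ?exprn_gt0// lnXn// ler_expR -mulr_natl.
by rewrite ler_wpM2r// ln_ge0.
Qed.

(** The upper bounds on V and P bound e^{4u} by a constant times (1 + |y|)^(4 c I1); the factor 1 -
    |y|^p adds p to the exponent, and n is an integer above the sum. *)
Lemma density_growth (p c M : R) (u P : R4 -> R)
    (f := fun y => (1 - enorm y `^ p) * expR (4 * u y)) :
  0 < p -> 0 <= c -> continuous f -> integrable4 f ->
  (forall x, u x = c * V f x + P x) -> (forall x, P x <= M) ->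
  exists (n : nat) (B : R), 0 <= B /\
    forall y, 2 <= enorm y -> `|f y| <= B * (1 + enorm y) ^+ n.
Proof.
move=> p0 c0 cf fi uE PM.
pose I1 := integral4 (fun z => `|f z|).
pose I2 := integral4 (fun z => ell (0 - z) * `|f z|).
have I10 : 0 <= I1 by apply: integral4_ge0.
have fpos z : 0 < f z -> enorm z <= 1.
  rewrite /f pmulr_lgt0 ?expR_gt0// leNgt => h; apply/negP => z1.
  have : 1 <= enorm z `^ p.
    rewrite -[leLHS](_ : 1 `^ p = 1); last by rewrite /powR oner_eq0 ln1 mulr0 expR0.
    by apply: ge0_ler_powR; rewrite ?nnegrE ?enorm_ge0 ?(ltW p0)// ltW.
  by lra.
pose s := p + 4 * c * I1.
have s0 : 0 < s by rewrite /s ltr_pwDl// !mulr_ge0.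
pose n := (Num.truncn s).+1.
have sn : s <= n%:R by case/andP: (truncn_itv (ltW s0)) => _ /ltW.
exists n, (2 * expR (4 * (c * I2 + M))); split; first by rewrite mulr_ge0 ?expR_ge0.
move=> y y2; have Vy := V_upper cf fi fpos y2; rewrite -/I1 -/I2 in Vy.
have cV := ler_wpM2l c0 Vy.
have uy : 4 * u y <= 4 * (c * I2 + M) + 4 * c * I1 * ln (1 + enorm y).
  by rewrite uE; have := PM y; lra.
have y1 : 1 <= 1 + enorm y by lra.
have l0 : 0 <= ln (1 + enorm y) by apply: ln_ge0.
have yp : enorm y `^ p <= expR (p * ln (1 + enorm y)).
  have -> : expR (p * ln (1 + enorm y)) = (1 + enorm y) `^ p by rewrite /powR gt_eqF//; lra.
  by apply: ge0_ler_powR; rewrite ?nnegrE ?enorm_ge0 ?(ltW p0)//; lra.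
have e1 : 1 <= expR (p * ln (1 + enorm y)).
  by rewrite -[leLHS]expR0 ler_expR mulr_ge0// ltW.
have yp0 := powR_ge0 (enorm y) p.
have b1 : `|1 - enorm y `^ p| <= 2 * expR (p * ln (1 + enorm y)).
  by rewrite ler_norml; apply/andP; split; lra.
have b2 : expR (4 * u y) <= expR (4 * (c * I2 + M)) * expR (4 * c * I1 * ln (1 + enorm y)).
  by rewrite -expRD ler_expR.
rewrite /f normrM (ger0_norm (expR_ge0 _)).
apply: (le_trans (ler_pM (normr_ge0 _) (expR_ge0 _) b1 b2)).
have -> : 2 * expR (p * ln (1 + enorm y)) *
    (expR (4 * (c * I2 + M)) * expR (4 * c * I1 * ln (1 + enorm y))) =
    2 * expR (4 * (c * I2 + M)) * expR (s * ln (1 + enorm y)).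
  rewrite [s * _](_ : _ = p * ln (1 + enorm y) + 4 * c * I1 * ln (1 + enorm y)); last by rewrite /s; ring.
  by rewrite expRD; ring.
rewrite ler_wpM2l ?mulr_ge0 ?expR_ge0//; exact: ln_le_pow.
Qed.

Lemma enorm_box (x y : R4) (d : R) : 0 <= d -> (forall i, `|y 0 i - x 0 i| <= d) ->
  enorm (y - x) <= 2 * d.
Proof.
move=> d0 h; rewrite -(@ler_pXn2r _ 2)// ?nnegrE ?enorm_ge0 ?mulr_ge0// sqr_enorm /sqn.
apply: (@le_trans _ _ (\sum_(i < 4) d ^+ 2)); last by rewrite sumr_const card_ord -mulr_natl exprMn; lra.
apply: ler_sum => i _; rewrite -real_normK ?num_real//; apply: lerXn2r; rewrite ?nnegrE//.
by rewrite !mxE.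
Qed.

(** Adding ln |x| absorbs the expected leading term into the integrand; what remains is, for fixed
    nonzero y, bounded as |x| tends to infinity. *)
Definition shifted_kernel (x y : R4) : R := ln (enorm y / enorm (x - y)) + ln (enorm x).

Lemma shifted_kernel_le (x y : R4) : 4 <= enorm x ->
  `|shifted_kernel x y| <= 3 * ln (enorm x) + ell y + ell (x - y).
Proof.
move=> x4; have l0 : 0 <= ln (enorm x) by apply: ln_ge0; lra.
rewrite (le_trans (ler_normD _ _))// (ger0_norm l0).
have := log_kernel_le y (lexx (enorm x)).
have : ln (1 + enorm x) <= 2 * ln (enorm x).
  rewrite mulr_natl -lnXn; last by lra.
  rewrite ler_ln ?posrE ?exprn_gt0//; try lra.
  by have := ler_wpM2r (enorm_ge0 x) x4; rewrite -expr2; lra.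
by lra.
Qed.

Lemma ell_off_box (x y : R4) (N : nat) : 4 <= enorm x ->
  ~ (forall i, `|y 0 i - x 0 i| <= enorm x ^- N) ->
  ell (x - y) <= N.+1%:R * ln (enorm x).
Proof.
move=> x4 /existsNP[i /negP]; rewrite -ltNge => h.
have x0 : 0 < enorm x by lra.
have xN : 0 < enorm x ^+ N by rewrite exprn_gt0.
have xN1 : 1 <= enorm x ^+ N by rewrite exprn_ege1//; lra.
have h1 : enorm x ^- N < enorm (x - y).
  by apply: (lt_le_trans h); rewrite (le_trans _ (coord_le_enorm _ i))// !mxE distrC.
have e0 : 0 < enorm (x - y) by apply: lt_trans h1; rewrite invr_gt0.
rewrite mulr_natl -lnXn// /ell ler_ln ?posrE ?exprn_gt0//; last by rewrite addr_gt0 ?invr_gt0.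
have h2 : (enorm (x - y))^-1 <= enorm x ^+ N.
  by rewrite -[leRHS]invrK lef_pV2 ?posrE ?invr_gt0// ltW.
have := ler_wpM2r (ltW xN) x4; rewrite -exprS; lra.
Qed.

(** Once |x_n| >= 2|y|, the ratio of |x_n| to |x_n - y| lies between 1/2 and 2, so the numerator
    stays bounded while ln |x_n| is at least n + 1. *)
Lemma cvg_shifted_kernel (x_ : nat -> R4) (y : R4) :
  (forall n, expR n.+1%:R + 4 <= enorm (x_ n)) -> y != 0 ->
  `|shifted_kernel (x_ n) y| / ln (enorm (x_ n)) @[n --> \oo] --> (0 : R).
Proof.
move=> hx y0; have yp := enorm_gt0 y0.
pose C := `|ln (enorm y)| + ln 2.
have C0 : 0 <= C by rewrite /C addr_ge0// ln_ge0//; lra.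
have h0 : C * n.+1%:R^-1 @[n --> \oo] --> (0 : R).
  rewrite -[0 in X in _ --> X](mulr0 C).
  by exact: (cvgM (cvg_cst C) (@cvg_harmonic R)).
apply: (@squeeze_cvgr _ _ _ _ (fun=> 0) (fun n => C * n.+1%:R^-1)) => //; last exact: cvg_cst.
have hn := near_Tn (2 * enorm y).
have hn2 : \forall n \near \oo, 2 * enorm y < Tn R n by exact: hn.
have [N _ hN] := near_Tn (4 * enorm y ^+ 2 : R).
exists N => // n /hN /= hn1.
have ny : 2 * enorm y <= n.+1%:R.
  rewrite -(@ler_pXn2r _ 2)// ?nnegrE ?ler0n ?mulr_ge0 ?(ltW yp)//.
  by move: hn1; rewrite /Tn exprMn => /ltW; rewrite (_ : 2 ^+ 2 = 4)//; lra.
have en := expR_ge1Dx (n.+1%:R : R).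
have nx : 2 * enorm y <= enorm (x_ n) by have := hx n; lra.
have xp : 0 < enorm (x_ n) by lra.
have lx : n.+1%:R <= ln (enorm (x_ n)).
  by rewrite -[leLHS]expRK ler_ln ?posrE ?expR_gt0//; have := hx n; lra.
have n0 : 0 < n.+1%:R :> R by rewrite ltr0n.
have lx0 : 0 < ln (enorm (x_ n)) by lra.
apply/andP; split; first by rewrite divr_ge0// ltW.
have t1 := enorm_trig (x_ n) y; have t2 := enormD (x_ n) (- y).
rewrite enormN in t2; rewrite enormBC in t1.
have xyp : 0 < enorm (x_ n - y) by lra.
have kb : `|shifted_kernel (x_ n) y| <= C.
  rewrite /shifted_kernel lnM ?posrE ?invr_gt0// lnV ?posrE//.
  rewrite -addrA (le_trans (ler_normD _ _))// /C lerD2l.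
  have l1 : ln (enorm (x_ n - y)) <= ln 2 + ln (enorm (x_ n)).
    by rewrite -lnM ?posrE// ler_ln ?posrE ?mulr_gt0//; lra.
  have l2 : ln (enorm (x_ n)) <= ln 2 + ln (enorm (x_ n - y)).
    by rewrite -lnM ?posrE// ler_ln ?posrE ?mulr_gt0//; lra.
  by rewrite ler_norml; apply/andP; split; lra.
apply: ler_pM => //; first by rewrite invr_ge0 ltW.
by rewrite lef_pV2 ?posrE.
Qed.

(** With X = |x|, on the cube 1 + |y| <= X + 3 <= X^2, so |f| <= B X^(2n). The kernel integrates to
    at most 320 d ln X, where 320 = 4 * 16 + 256, and the half side d = X^-(2n+1) is chosen to leave
    one factor 1/X. *)
Lemma near_box_bound (f : R4 -> R) (n : nat) (B : R) (x : R4) : continuous f -> integrable4 f ->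
  0 <= B -> (forall y, 2 <= enorm y -> `|f y| <= B * (1 + enorm y) ^+ n) ->
  4 <= enorm x -> 1 <= ln (enorm x) ->
  integral4 (fun y => box x (enorm x ^- (2 * n).+1) y * (`|shifted_kernel x y| * `|f y|))
    <= 320 * B / enorm x * ln (enorm x).
Proof.
move=> cf fi B0 fB x4 lx.
set N := (2 * n).+1; set d := enorm x ^- N; set X := enorm x in x4 lx d *.
have X0 : 0 < X by lra.
have d0 : 0 < d by rewrite invr_gt0 exprn_gt0.
have d1 : d <= 1 by rewrite invf_le1 ?exprn_gt0// exprn_ege1//; lra.
have [i1 e1] := ell_box x d0 d1.
have ib := integrable4_box x d0.
set c := B * X ^+ (2 * n).
have c0 : 0 <= c by rewrite mulr_ge0// exprn_ge0// ltW.
have i2 := integrable4Z c (integrable4D (integrable4Z (3 * ln X + 1) ib) i1).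
have pw y : box x d y * (`|shifted_kernel x y| * `|f y|) <=
    c * ((3 * ln X + 1) * box x d y + ell (x - y) * box x d y).
  have [h|h] := pselect (forall i, `|y 0 i - x 0 i| <= d); last first.
    by rewrite (box_out h) mul0r !mulr0 addr0 mulr0.
  rewrite (box_in h) mul1r !mulr1 mulrC.
  have yx := enorm_box (ltW d0) h.
  have t1 := enorm_trig x y; rewrite -/X enormBC (enormBC x) in t1.
  have t2 := enorm_trig y x; rewrite -/X enormBC in t2.
  have y2 : 2 <= enorm y by lra.
  have ey : ell y <= 1.
    rewrite /ell (le_trans (@le_ln1Dx R (enorm y)^-1 _))//.
      by rewrite (lt_le_trans (ltrN10 R))// invr_ge0; lra.
    by rewrite invf_le1; lra.
  have k := shifted_kernel_le y x4; rewrite -/X in k.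
  apply: ler_pM => //; last by lra.
  rewrite (le_trans (fB y y2))// /c ler_wpM2l// exprM; apply: lerXn2r; rewrite ?nnegrE; try lra.
    by rewrite sqr_ge0.
  by have := ler_wpM2r (ltW X0) x4; rewrite -expr2; lra.
have m : meas4 (fun y => box x d y * (`|shifted_kernel x y| * `|f y|)).
  apply: measurable_funM; first exact: measurable_box.
  apply: measurable_funM; last exact: (integrable4_meas (integrable4_norm fi)).
  apply: (measurableT_comp (@normr_measurable R setT)).
  by apply: measurable_funD; [exact: measurable_log_kernel|exact: measurable_cst].
have i0 : integrable4 (fun y => box x d y * (`|shifted_kernel x y| * `|f y|)).
  apply: (le_integrable4 m i2) => y; rewrite ger0_norm//.
  by rewrite !mulr_ge0// box_ge0.
apply: (le_trans (le_integral4 i0 i2 pw)).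
rewrite (integral4Z _ (integrable4D (integrable4Z (3 * ln X + 1) ib) i1)).
rewrite (integral4D (integrable4Z (3 * ln X + 1) ib) i1) (integral4Z _ ib) integral4_box//.
have cd : c * d = B / X by rewrite /c /d /N exprS; field; rewrite expf_neq0 ?gt_eqF//.
have d2 : d ^+ 2 <= 1 by rewrite exprn_ile1// ltW.
have d3 : d ^+ 3 <= d by rewrite exprS ler_piMr// ltW.
have d4 : (2 * d) ^+ 4 <= 16 * d.
  have -> : (2 * d) ^+ 4 = 16 * (d * d ^+ 3) by ring.
  have : d * d ^+ 3 <= d * 1 by rewrite ler_wpM2l ?(ltW d0)//; lra.
  by lra.
have h3 : (3 * ln X + 1) * (2 * d) ^+ 4 + integral4 (fun y => ell (x - y) * box x d y) <=
   320 * (d * ln X).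
  have l4 : 3 * ln X + 1 <= 4 * ln X by lra.
  have q0 : 0 <= (2 * d) ^+ 4 by rewrite exprn_ge0// mulr_ge0// ltW.
  have h4 : (3 * ln X + 1) * (2 * d) ^+ 4 <= 4 * ln X * (16 * d) by apply: ler_pM => //; lra.
  have h5 : d <= d * ln X by rewrite ler_peMr// ltW.
  lra.
apply: (le_trans (ler_wpM2l c0 h3)).
have -> : c * (320 * (d * ln X)) = 320 * (c * d) * ln X by ring.
by rewrite cd !mulrA.
Qed.

(** Dominated convergence is sequential, so the estimate is refuted along a sequence x_k violating
    it. Since |x_k| exceeds exp(k + 1), ln |x_k| >= k + 1 and both the part off the small cubes and
    the part on them tend to 0 after division by ln |x_k|. *)
Lemma V_asymptotics (f : R4 -> R) (n : nat) (B : R) : continuous f -> integrable4 f ->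
  0 <= B -> (forall y, 2 <= enorm y -> `|f y| <= B * (1 + enorm y) ^+ n) ->
  forall e, 0 < e -> exists r : R, forall x : R4, r < enorm x ->
    `|V f x + integral4 f * ln (enorm x)| <= e * ln (enorm x).
Proof.
move=> cf fi B0 fB e e0.
apply/not_existsP => H.
have /choice[x_ hx] : forall k : nat, exists x : R4, expR k.+1%:R + 4 <= enorm x /\
    e * ln (enorm x) < `|V f x + integral4 f * ln (enorm x)|.
  move=> k; have /existsNP[x /not_implyP[xr /negP]] := H (expR k.+1%:R + 4).
  by rewrite -ltNge => h; exists x; split => //; exact: ltW.
have hx1 k := (hx k).1.
pose N := (2 * n).+1.
have x4 k : 4 <= enorm (x_ k) by have := hx1 k; have := expR_ge0 (k.+1%:R : R); lra.
have x0 k : 0 < enorm (x_ k) by have := x4 k; lra.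
have lk k : k.+1%:R <= ln (enorm (x_ k)).
  by rewrite -[leLHS]expRK ler_ln ?posrE ?expR_gt0//; have := hx1 k; lra.
have k1 k : 1 <= k.+1%:R :> R by rewrite ler1n.
have l1 k : 1 <= ln (enorm (x_ k)) by rewrite (le_trans (k1 k)).
have l0 k : 0 < ln (enorm (x_ k)) by rewrite (lt_le_trans ltr01).
pose b k y := box (x_ k) (enorm (x_ k) ^- N) y.
have b1 k y : 0 <= 1 - b k y.
  rewrite subr_ge0 /b /box; apply: prodr_ile1 => i _ /=.
  by rewrite indicE; case: (_ \in _); rewrite ?ler01 ?lexx.
have mk k : meas4 (fun y => `|shifted_kernel (x_ k) y| * `|f y|).
  apply: measurable_funM; last exact: (integrable4_meas (integrable4_norm fi)).
  apply: (measurableT_comp (@normr_measurable R setT)).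
  by apply: measurable_funD; [exact: measurable_log_kernel|exact: measurable_cst].
pose g k y := (1 - b k y) * (`|shifted_kernel (x_ k) y| / ln (enorm (x_ k)) * `|f y|).
have gE k y : g k y = (1 - b k y) * (`|shifted_kernel (x_ k) y| * `|f y|) / ln (enorm (x_ k)).
  by rewrite /g -!mulrA; congr (_ * (_ * _)); rewrite mulrC.
have mg k : meas4 (g k).
  rewrite (_ : g k = fun y => (1 - b k y) * (`|shifted_kernel (x_ k) y| * `|f y|) / ln (enorm (x_ k))).
    apply: measurable_funM; last exact: measurable_cst.
    apply: measurable_funM; last exact: mk.
    by apply: measurable_funB; [exact: measurable_cst|exact: measurable_box].
  by apply/funext => y; exact: gE.
(* Off the cube the singular term contributes N + 1 times ln |x_k| by [ell_off_box], and the
   remaining part of the kernel 3 ln |x_k|, hence N + 4 after division. *)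
pose G y := (N.+4)%:R * `|f y| + ell (0 - y) * `|f y|.
have iG : integrable4 G.
  by apply: integrable4D; [apply: integrable4Z; exact: integrable4_norm|exact: integrable_ell].
have gG k y : `|g k y| <= G y.
  rewrite /g /G -mulrDl normrM (ger0_norm (b1 k y)) [X in _ * X]normrM normr_id mulrA ler_wpM2r//.
  have e0' : ell (0 - y) = ell y by rewrite /ell sub0r enormN.
  rewrite e0'; have ey := ell_ge0 y.
  have G0 : 0 <= N.+4%:R + ell y :> R by rewrite addr_ge0.
  have [h|h] := pselect (forall i, `|y 0 i - x_ k 0 i| <= enorm (x_ k) ^- N).
    by rewrite /b (box_in h) subrr mul0r.
  rewrite /b (box_out h) subr0 mul1r normrM normr_id (ger0_norm (_ : 0 <= (ln _)^-1)) ?invr_ge0 ?(ltW (l0 k))//.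
  rewrite ler_pdivrMr//.
  have h1 := shifted_kernel_le y (x4 k); have h2 := ell_off_box (x4 k) h.
  have h3 : ell y <= ell y * ln (enorm (x_ k)) by rewrite ler_peMr.
  have -> : N.+4%:R = N.+1%:R + 3 :> R by rewrite -natrD addn3.
  lra.
have cg y : y != 0 -> g k y @[k --> \oo] --> (0 : R).
  move=> y0; have h := cvg_shifted_kernel hx1 y0.
  have h1 : (`|shifted_kernel (x_ k) y| / ln (enorm (x_ k))) * `|f y| @[k --> \oo] --> (0 : R).
    rewrite -[0 in X in _ --> X](mul0r `|f y|).
    by exact: (cvgM h (cvg_cst _)).
  apply: (@squeeze_cvgr _ _ _ _ (fun=> 0) (fun k => (`|shifted_kernel (x_ k) y| / ln (enorm (x_ k))) * `|f y|)) => //; last exact: cvg_cst.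
  apply: nearW => k.
  have p0 : 0 <= `|shifted_kernel (x_ k) y| / ln (enorm (x_ k)) * `|f y|.
    by rewrite mulr_ge0// divr_ge0// ltW.
  rewrite /g mulr_ge0//= ler_piMl// lerBlDr lerDl; exact: box_ge0.
have [_ cI] := @dominated_cvg4 R g (fun=> 0) G mg (integrable4_meas (integrable4_0 R))
  (ae4S (fun z => @cg (of_coords z)) (ae_neq 0)) iG (ae4S (fun z _ k => gG k (of_coords z)) (ae_neq 0)).
rewrite integral4_0 in cI.
pose c := 320 * B.
have c0 : 0 <= c := mulr_ge0 (ler0n _ _) B0.
have main k : e < integral4 (g k) + c * k.+1%:R^-1.
  have [_ h] := hx k.
  have [_ ik] := integrable_log_kernel (x_ k) cf fi.
  have ikk : integrable4 (fun y => shifted_kernel (x_ k) y * f y).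
    apply: integrable4_eq (integrable4D ik (integrable4Z (ln (enorm (x_ k))) fi)) => y /=.
    by rewrite /shifted_kernel; ring.
  have ikn : integrable4 (fun y => `|shifted_kernel (x_ k) y| * `|f y|).
    by apply: integrable4_eq (integrable4_norm ikk) => y /=; rewrite normrM.
  have E : V f (x_ k) + integral4 f * ln (enorm (x_ k)) = integral4 (fun y => shifted_kernel (x_ k) y * f y).
    rewrite /V [integral4 f * _]mulrC -(integral4Z _ fi) -integral4D//; last exact: integrable4Z.
    by apply: eq_integral4 => y; rewrite /shifted_kernel; ring.
  have nb : integral4 (fun y => b k y * (`|shifted_kernel (x_ k) y| * `|f y|)) <=
      c / enorm (x_ k) * ln (enorm (x_ k)).
    exact: (near_box_bound cf fi B0 fB (x4 k) (l1 k)).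
  have ig : integrable4 (g k) by apply: (le_integrable4 (mg k) iG) => y; exact: gG.
  have ib : integrable4 (fun y => b k y * (`|shifted_kernel (x_ k) y| * `|f y|)).
    apply: (le_integrable4 _ ikn).
      by apply: measurable_funM; [exact: measurable_box|exact: mk].
    move=> y; rewrite normrM ger0_norm ?box_ge0// (ger0_norm (mulr_ge0 _ _))//.
    by rewrite ler_piMl ?mulr_ge0// -subr_ge0.
  have T : `|V f (x_ k) + integral4 f * ln (enorm (x_ k))| <=
      ln (enorm (x_ k)) * integral4 (g k) + c / enorm (x_ k) * ln (enorm (x_ k)).
    rewrite E (le_trans (le_normr_integral4 ikk))//.
    apply: (le_trans _ (lerD (lexx _) nb)).
    rewrite -(integral4Z _ ig) -integral4D//; last exact: integrable4Z.
    rewrite le_eqVlt; apply/orP; left; apply/eqP; apply: eq_integral4 => y.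
    rewrite gE normrM; field; by rewrite gt_eqF.
  have xk : k.+1%:R <= enorm (x_ k) by have := hx1 k; have := expR_ge1Dx (k.+1%:R : R); lra.
  have kp : 0 < k.+1%:R :> R by rewrite ltr0n.
  have h5 : (enorm (x_ k))^-1 <= k.+1%:R^-1 by rewrite lef_pV2 ?posrE.
  have h6 : c / enorm (x_ k) <= c / k.+1%:R by rewrite ler_wpM2l.
  have h7 := lt_le_trans h T.
  rewrite -(ltr_pM2r (l0 k)).
  apply: (lt_le_trans h7).
  by rewrite [in leRHS]mulrDl mulrC lerD2l ler_wpM2r// ltW.
have hl : integral4 (g k) + c * k.+1%:R^-1 @[k --> \oo] --> (0 : R).
  rewrite -[0 in X in _ --> X]addr0 -[X in _ --> _ + X](mulr0 (c)).
  by exact: (cvgD cI (cvgM (cvg_cst _) (@cvg_harmonic R))).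
have /cvgrPdist_lt /(_ e e0) [K _ /(_ K (leqnn K))] := hl.
rewrite /= sub0r normrN => h; have := main K.
by rewrite ltNge => /negP; apply; rewrite (le_trans (ler_norm _))// ltW.
Qed.

End asymptotics.

(** * The decomposition of u and its expansion at infinity *)

Theorem theorem1p2 (R : realType) (p : R) (u : 'rV[R]_4 -> R) :
  0 < p ->
  Ck 4 u ->
  (forall x : 'rV[R]_4,
      bilaplacian u x = (1 - enorm x `^ p) * expR (4 * u x)) ->
  integrable4 (fun y => (1 - enorm y `^ p) * expR (4 * u y)) ->
  let Lambda := integral4 (fun y => (1 - enorm y `^ p) * expR (4 * u y)) in
  let v := fun x : 'rV[R]_4 =>
    (8 * pi ^+ 2)^-1 *
      integral4 (fun y => ln (enorm y / enorm (x - y)) *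
                          ((1 - enorm y `^ p) * expR (4 * u y))) in
  exists P : 'rV[R]_4 -> R,
    [/\ poly_deg_le2 P,
        (exists M : R, forall x, P x <= M),
        (forall x, u x = v x + P x) &
        (forall eps : R, 0 < eps -> exists r : R, forall x : 'rV[R]_4,
            r < enorm x ->
            `| u x - (- (Lambda / (8 * pi ^+ 2)) * ln (enorm x) + P x) |
              <= eps * ln (enorm x))].
Proof.
move=> p0 Cu uE fi Lambda v.
pose f y := (1 - enorm y `^ p) * expR (4 * u y).
have fE : bilaplacian u = f by apply/funext.
have cf : continuous f by rewrite -fE; exact: bilaplacian_continuous.
have cu := Ck_continuous Cu.
have ei := integrable_expR p0 cu fi.
have pi0 : 0 < 8 * pi ^+ 2 :> R by rewrite mulr_gt0 ?exprn_gt0 ?pi_gt0.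
set c := (8 * pi ^+ 2)^-1 in v *.
have c0 : 0 < c by rewrite invr_gt0.
pose P x := u x - v x.
have pP : poly_deg_le2 P by have := u_sub_V_poly Cu; rewrite fE; apply.
have uP x : u x = c * V f x + P x by rewrite /P /v /V addrC subrK.
have [C1 [C2 [C10 PC]]] := poly_log_upper cu cf fi ei (ltW c0) pP uP.
have [M PM] := poly_bounded_above pP C10 PC.
have [n [B [B0 fB]]] := density_growth p0 (ltW c0) cf fi uP PM.
exists P; split => //; first by exists M.
(* The error for u is c times the error for V, hence the tolerance e / c. *)
move=> e e0; have [r hr] := V_asymptotics cf fi B0 fB (divr_gt0 e0 c0).
exists r => x xr; have := hr x xr.
rewrite (_ : u x - _ = c * (V f x + integral4 f * ln (enorm x))).
  rewrite normrM (gtr0_norm c0) => h.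
  have -> : e * ln (enorm x) = c * (e / c * ln (enorm x)).
    by rewrite mulrA [c * (e / c)]mulrC divfK ?gt_eqF.
  exact: ler_wpM2l (ltW c0) _ _ h.
by rewrite uP -/c /Lambda -/f; ring.
Qed.
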